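(* Let $F_n$ be a free group of finite rank $n$ and let $\mathbb{A}$ be a finitely generated abelian group. Then the subgroup intersection problem for $F_n\times\mathbb{A}$ is solvable.
   Context: The subgroup intersection problem for a finitely generated group $G$: given two finite sets $R,S$ of words in the generators of $G$, decide whether the intersection $\langle R\rangle\cap\langle S\rangle$ is finitely generated and, in the affirmative case, compute a (finite) generating set for the intersection. The problem is solvable if there is an algorithm performing this task. *)

(* Defs.v *)
From HB Require Import structures.
From mathcomp Require Import all_boot.

Set Implicit Arguments.
Unset Strict Implicit.
Unset Printing Implicit Defensive.

Local Open Scope group_scope.

(* General recursive functions: minimization is restricted to regular         *)
(* functions, so every function of the class is total. The recursion and      *)
(* minimization clauses specify g by its defining equations.                  *)
Inductive recursive : forall k : nat, (k.-tuple nat -> nat) -> Prop :=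
| RecZero : recursive (fun _ : 0.-tuple nat => 0%N)
| RecSucc : recursive (fun v : 1.-tuple nat => (thead v).+1)
| RecProj k (i : 'I_k) : recursive (fun v : k.-tuple nat => tnth v i)
| RecComp k m (f : m.-tuple nat -> nat) (g : 'I_m -> k.-tuple nat -> nat) :
    recursive f -> (forall i, recursive (g i)) ->
    recursive (fun v : k.-tuple nat => f [tuple g i v | i < m])
| RecPrim k (f : k.-tuple nat -> nat) (h : k.+2.-tuple nat -> nat)
    (g : k.+1.-tuple nat -> nat) :
    recursive f -> recursive h ->
    (forall v : k.-tuple nat, g [tuple of 0%N :: v] = f v) ->
    (forall (n : nat) (v : k.-tuple nat), g [tuple of n.+1 :: v] =
                 h [tuple of n :: g [tuple of n :: v] :: v]) ->
    recursive g
| RecMin k (f : k.+1.-tuple nat -> nat) (g : k.-tuple nat -> nat) :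
    recursive f ->
    (forall v : k.-tuple nat, f [tuple of g v :: v] = 0%N) ->
    (forall (v : k.-tuple nat) (y : nat), (y < g v)%N -> f [tuple of y :: v] <> 0%N) ->
    recursive g.

(* A letter (i, b) stands for the i-th generator if b is false, and for its   *)
(* inverse if b is true.                                                      *)
Definition word (k : nat) := seq ('I_k * bool).

Definition eval_word (G : groupType) (k : nat) (g : 'I_k -> G) (w : word k) : G :=
  \prod_(l <- w) (if l.2 then (g l.1)^-1 else g l.1).

Definition code_letter (k : nat) (l : 'I_k * bool) : nat :=
  ((val l.1).*2 + l.2)%N.

Definition code_word (k : nat) (w : word k) : nat :=
  CodeSeq.code (map (@code_letter k) w).

Definition code_words (k : nat) (R : seq (word k)) : nat :=
  CodeSeq.code (map (@code_word k) R).

Definition code_answer (k : nat) (o : option (seq (word k))) : nat :=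
  if o is Some T then (code_words T).+1 else 0%N.

Definition computable (k : nat)
    (f : seq (word k) -> seq (word k) -> option (seq (word k))) : Prop :=
  exists phi : 2.-tuple nat -> nat, recursive phi /\
    forall R S, phi [tuple code_words R; code_words S] = code_answer (f R S).

Inductive generated (G : groupType) (X : G -> Prop) : G -> Prop :=
| GenIn x : X x -> generated X x
| Gen1 : generated X 1
| GenM x y : generated X x -> generated X y -> generated X (x * y)
| GenV x : generated X x -> generated X x^-1.

Definition finitely_generated (G : groupType) (H : G -> Prop) : Prop :=
  exists X : seq G, forall y, H y <-> generated (fun x => x \in X) y.

Definition generating_family (G : groupType) (k : nat) (g : 'I_k -> G) : Prop :=
  forall y, generated (fun x => exists i, x = g i) y.

Definition subgroup_of_words (G : groupType) (k : nat) (g : 'I_k -> G)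
    (R : seq (word k)) : G -> Prop :=
  generated (fun x => exists2 w, w \in R & x = eval_word g w).

Definition words_inter (G : groupType) (k : nat) (g : 'I_k -> G)
    (R S : seq (word k)) (y : G) : Prop :=
  subgroup_of_words g R y /\ subgroup_of_words g S y.

(* Finite sets of words are given as lists, and None is the negative answer.   *)
(* The problem is required to be solvable with respect to every finite        *)
(* generating family of G.                                                    *)
Definition subgroup_intersection_solvable (G : groupType) : Prop :=
  forall (k : nat) (g : 'I_k -> G), generating_family g ->
  exists f : seq (word k) -> seq (word k) -> option (seq (word k)),
    computable f /\
    forall R S : seq (word k),
      match f R S with
      | Some T => forall y, subgroup_of_words g T y <-> words_inter g R S y
      | None => ~ finitely_generated (words_inter g R S)
      end.

Definition free_basis (F : groupType) (n : nat) (x : 'I_n -> F) : Prop :=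
  forall (H : groupType) (h : 'I_n -> H),
  exists phi : {multiplicative F -> H},
    (forall i, phi (x i) = h i) /\
    forall psi : {multiplicative F -> H},
      (forall i, psi (x i) = h i) -> psi =1 phi.

(* Main.v *)
Require Import Defs.
From HB Require Import structures.
From mathcomp Require Import all_boot ssralg ssrnum ssrint zify ring.
From mathcomp Require Import boolp.

(** The algorithm is a search. For finite sets R and S of words there is a kind
   of certificate for the statement that a finite set T generates the
   intersection of the subgroups of R and S, and another kind for the statement
   that this intersection is not finitely generated. Both statements are thus
   semidecidable, one of them holds for some T, and running through all
   certificates is a total recursive function ([sd_choice], [quotient_solvable]).
   No running time has to be bounded and no algorithm on words, such as folding,
   has to be carried out or verified: the existence of a certificate may be
   proved by any classical argument.

   The abelian factor is a quotient of a free abelian group of finite rank by a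
   finitely generated subgroup. When generators of that subgroup are added to R
   and S, the problem moves to the product E of a free group F and a free abelian
   group. Let pi be the projection of E to F, whose kernel is central and is
   embedded into a power of the integers by the coordinate characters. Let H and
   K be the subgroups of E generated by R and S, and D their fibre product over
   F. The intersection of H and K is the part of D on which the two components
   have the same coordinates.

   A subgroup such as H is described by a finite deterministic graph whose edges
   carry a letter of F and an element of E above it. Because closed walks can be
   reduced, and distinct reduced words have distinct values, such a graph bounds
   H from above: it determines the central elements of H ([reads_ker]), and two
   such graphs, read synchronously, determine generators of D ([pair_sound]).
   A piece of the Schreier graph of the projection of H is such a graph
   ([graph_exists]).

   If generators of D are known, the kernel of the differences of the coordinates
   is certified one character at a time ([chain_sound]); the certificate exists
   if and only if the kernel is finitely generated, since the quotients are
   cyclic ([chain_complete]). This settles the positive answer ([inter_certP]).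

   For the negative answer, the projection of the intersection is a normal
   subgroup of the intersection P of pi(H) and pi(K). A nontrivial finitely
   generated subgroup of F that is normalized by w contains a power of w
   ([normalizer_power]): far away from the core of its Schreier graph no
   nontrivial short word is a closed walk. So the intersection is not finitely
   generated if it has a nontrivial projection and if some integer character
   vanishes on the central elements of H and of K but takes different values on
   two elements of H and K with the same projection ([infinite_cert_sound]).
   Conversely, if the projection is trivial, then the intersection lies in a
   finitely generated abelian group. If no character is as described, then the
   central elements of H and K span the same rational space of coordinate
   differences as D ([lincomb_separate]), the projection of the intersection has
   finite index in P, and the intersection is finitely generated
   ([infinite_cert_complete]). *)

Set Implicit Arguments.
Unset Strict Implicit.
Unset Printing Implicit Defensive.

(** * Recursive functions of few variables *)

Lemma recursive_ext k (f g : k.-tuple nat -> nat) :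
  f =1 g -> recursive f -> recursive g.
Proof. by move=> /funext ->. Qed.

Definition rec1 (f : nat -> nat) :=
  recursive (fun v : 1.-tuple nat => f (nth 0 v 0)).
Definition rec2 (f : nat -> nat -> nat) :=
  recursive (fun v : 2.-tuple nat => f (nth 0 v 0) (nth 0 v 1)).
Definition rec3 (f : nat -> nat -> nat -> nat) :=
  recursive (fun v : 3.-tuple nat => f (nth 0 v 0) (nth 0 v 1) (nth 0 v 2)).

Lemma rec_nth k i : i < k -> recursive (fun v : k.-tuple nat => nth 0 v i).
Proof.
move=> ik; apply: recursive_ext (RecProj (Ordinal ik)) => v.
by rewrite (tnth_nth 0).
Qed.

Lemma rec_app1 f k (a : k.-tuple nat -> nat) :
  rec1 f -> recursive a -> recursive (fun v => f (a v)).
Proof.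
move=> rf ra; apply: recursive_ext (RecComp rf (fun _ : 'I_1 => ra)) => v.
by rewrite -[0]/(nat_of_ord (@ord0 0)) -tnth_nth tnth_mktuple.
Qed.

Lemma rec_app2 f k (a b : k.-tuple nat -> nat) :
  rec2 f -> recursive a -> recursive b -> recursive (fun v => f (a v) (b v)).
Proof.
move=> rf ra rb.
pose g (i : 'I_2) := if i == 0 :> nat then a else b.
have rg i : recursive (g i) by rewrite /g; case: ifP.
apply: recursive_ext (RecComp rf rg) => v.
by rewrite -(tnth_nth 0 _ (Ordinal (isT : 0 < 2)))
  -(tnth_nth 0 _ (Ordinal (isT : 1 < 2))) !tnth_mktuple.
Qed.

Lemma rec_app3 f k (a b c : k.-tuple nat -> nat) :
  rec3 f -> recursive a -> recursive b -> recursive c ->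
  recursive (fun v => f (a v) (b v) (c v)).
Proof.
move=> rf ra rb rc.
pose g (i : 'I_3) := if i == 0 :> nat then a else if i == 1 :> nat then b else c.
have rg i : recursive (g i) by rewrite /g; case: ifP => // _; case: ifP.
apply: recursive_ext (RecComp rf rg) => v.
by rewrite -(tnth_nth 0 _ (Ordinal (isT : 0 < 3)))
  -(tnth_nth 0 _ (Ordinal (isT : 1 < 3)))
  -(tnth_nth 0 _ (Ordinal (isT : 2 < 3))) !tnth_mktuple.
Qed.

Lemma rec_succ : rec1 succn.
Proof. by apply: recursive_ext RecSucc => v; rewrite /thead (tnth_nth 0). Qed.

Lemma rec_const k c : recursive (fun _ : k.-tuple nat => c).
Proof.
elim: c => [|c IHc]; last exact: rec_app1 rec_succ IHc.
apply: recursive_ext (RecComp RecZero (g := fun i : 'I_0 => fun=> 0) _) => //.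
by case.
Qed.

Lemma rec1_prim c h f : rec2 h -> f 0 = c -> (forall n, f n.+1 = h n (f n)) ->
  rec1 f.
Proof.
by move=> rh f0 fS; apply: RecPrim (rec_const 0 c) rh _ _ => [v|n v] /=.
Qed.

Lemma rec2_prim a h f : rec1 a -> rec3 h -> (forall x, f 0 x = a x) ->
  (forall n x, f n.+1 x = h n (f n x) x) -> rec2 f.
Proof. by move=> ra rh f0 fS; apply: RecPrim ra rh _ _ => [v|n v] /=. Qed.

Lemma rec1_min f m : rec2 f -> (forall x, f (m x) x = 0) ->
  (forall x y, y < m x -> f y x <> 0) -> rec1 m.
Proof. by move=> rf m0 mmin; apply: RecMin rf _ _ => [v|v y] /=; auto. Qed.

Ltac rec_solve := rewrite /rec1 /rec2 /rec3; lazy beta; repeat first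
  [ exact: rec_const | exact: rec_nth
  | match goal with
    | h : rec1 ?f |- recursive (fun v => ?f _) => apply: (rec_app1 h)
    | h : rec2 ?f |- recursive (fun v => ?f _ _) => apply: (rec_app2 h)
    | h : rec3 ?f |- recursive (fun v => ?f _ _ _) => apply: (rec_app3 h)
    end ].

Lemma rec_pred : rec1 predn.
Proof. by apply: (@rec1_prim 0 (fun n _ => n)) => //; rec_solve. Qed.

Lemma rec_double : rec1 double.
Proof.
have h := rec_succ; apply: (@rec1_prim 0 (fun _ a => a.+2)) => //; rewrite /rec2.
by apply: (rec_app1 h); apply: (rec_app1 h); exact: rec_nth.
Qed.

Lemma rec_not : rec1 (fun n => n == 0).
Proof. by apply: (@rec1_prim 1 (fun _ _ => 0)) => //; rec_solve. Qed.

Lemma rec_odd : rec1 odd.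
Proof.
have h := rec_not; apply: (@rec1_prim 0 (fun _ a => a == 0)) => //=.
  by apply: (rec_app1 h); exact: rec_nth.
by move=> n; case: odd.
Qed.

Lemma rec_add : rec2 addn.
Proof.
have h := rec_succ; apply: (@rec2_prim id (fun _ a _ => a.+1)) => //.
  by rec_solve.
by apply: (rec_app1 h); exact: rec_nth.
Qed.

Lemma rec_half : rec1 half.
Proof.
have hodd := rec_odd; have hadd := rec_add.
apply: (@rec1_prim 0 (fun n a => odd n + a)) => //=.
  by apply: (rec_app2 hadd); [apply: (rec_app1 hodd)|]; exact: rec_nth.
by move=> n; rewrite uphalf_half.
Qed.

(** * A recursive pairing function *)

(** This is the pairing for which [CodeSeq.code (n :: s)] is the successor of
   the pair of [n] and [CodeSeq.code s]. *)
Definition npair a b := (iter a double b.*2.+1).-1.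

(** The first component of a pair with code [m] is the exponent of two in
   [m.+1], so it is the number of halvings that make [m.+1] odd. *)
Definition nhalf a m := iter a half m.+1.
Fact nfst_ex m : exists a, odd (nhalf a m).
Proof.
rewrite /nhalf; elim/ltn_ind: m => m IH.
case o: (odd m.+1); first by exists 0.
have [k mE] : exists k, m = k.*2.+1.
  exists m./2; move: o => /= /negbFE o; by rewrite -[LHS]odd_double_half o.
have [|a ha] := IH k; first by rewrite mE -addnn; rewrite ltnS leq_addr.
by exists a.+1; rewrite iterSr mE -doubleS doubleK.
Qed.
Definition nfst m := ex_minn (nfst_ex m).
Definition nsnd m := (nhalf (nfst m) m)./2.

Lemma npairS a b : (npair a b).+1 = iter a double b.*2.+1.
Proof.
rewrite prednK //; elim: a => //= a IH; by rewrite -double0 ltn_double.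
Qed.

Lemma iter_half_double a m k : iter a half (iter (a + k) double m) = iter k double m.
Proof. by elim: a => [|a IH] //; rewrite iterSr addSn iterS doubleK. Qed.

Lemma nfst_pair a b : nfst (npair a b) = a.
Proof.
rewrite /nfst; case: ex_minnP => c; rewrite /nhalf npairS => ho hmin.
have le1 : c <= a.
  by apply: hmin; rewrite -{2}[a]addn0 iter_half_double /= odd_double.
case: (ltngtP c a) le1 => // lt _.
by move: ho; rewrite -(subnKC lt) addSnnS iter_half_double /= odd_double.
Qed.

Lemma nsnd_pair a b : nsnd (npair a b) = b.
Proof.
rewrite /nsnd nfst_pair /nhalf npairS -{2}[a]addn0 iter_half_double /=.
by rewrite uphalf_double.
Qed.

Lemma npairK m : npair (nfst m) (nsnd m) = m.
Proof.
apply: succn_inj; rewrite npairS /nsnd /nfst /nhalf.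
case: ex_minnP => a; rewrite /nhalf => ho hmin.
have -> : (iter a half m.+1)./2.*2.+1 = iter a half m.+1.
  by rewrite -[RHS]odd_double_half ho.
have : forall c, c < a -> ~~ odd (iter c half m.+1).
  by move=> c; apply: contraTN => /hmin; rewrite leqNgt.
elim: a {ho hmin} => [|a IH] // H.
rewrite iterSr [iter a.+1 half _]iterS -[RHS]IH; last by move=> c /ltnW /H.
by congr iter; rewrite -[RHS]odd_double_half (negbTE (H a _)).
Qed.

Lemma code_cons n s : CodeSeq.code (n :: s) = (npair n (CodeSeq.code s)).+1.
Proof.
rewrite npairS /=; elim: n => [|n IH]; first by rewrite mul1n.
by rewrite expnS -mulnA IH mul2n.
Qed.

Lemma rec_pair : rec2 npair.
Proof.
have h1 := rec_double; have h2 := rec_succ; have h3 := rec_pred.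
have h4 : rec2 (fun a b => iter a double b.*2.+1).
  apply: (@rec2_prim (fun b => b.*2.+1) (fun _ a _ => a.*2)) => //.
    by apply: (rec_app1 h2); apply: (rec_app1 h1); exact: rec_nth.
  by apply: (rec_app1 h1); exact: rec_nth.
by apply: (rec_app1 h3).
Qed.

Lemma rec_nhalf : rec2 nhalf.
Proof.
have h1 := rec_half; have h2 := rec_succ.
apply: (@rec2_prim succn (fun _ a _ => a./2)) => //.
by apply: (rec_app1 h1); exact: rec_nth.
Qed.

Lemma rec_nfst : rec1 nfst.
Proof.
have h1 := rec_nhalf; have h2 := rec_odd; have h3 := rec_not.
apply: (@rec1_min (fun a m => (nat_of_bool (odd (nhalf a m))) == 0)).
- apply: (rec_app1 h3); apply: (rec_app1 h2); rec_solve.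
- by move=> m; rewrite /nfst; case: ex_minnP => a ->.
- move=> m a; rewrite /nfst; case: ex_minnP => b _ hmin lt.
  by case: odd (hmin a) => //; rewrite leqNgt lt => /(_ isT).
Qed.

Lemma rec_nsnd : rec1 nsnd.
Proof.
have h1 := rec_nhalf; have h2 := rec_half; have h3 := rec_nfst.
by apply: (rec_app1 h2); rec_solve.
Qed.

(** * Numbered types and computable functions *)

Lemma decodeS c : CodeSeq.decode c.+1 = nfst c :: CodeSeq.decode (nsnd c).
Proof.
apply: (can_inj CodeSeq.codeK).
by rewrite CodeSeq.decodeK code_cons CodeSeq.decodeK npairK.
Qed.

Lemma size_decode c : size (CodeSeq.decode c) <= c.
Proof.
rewrite -{2}[c]CodeSeq.decodeK; elim: (CodeSeq.decode c) => // n s IH.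
rewrite code_cons /=; apply: leq_ltn_trans IH _; rewrite npairS.
elim: n => [|n IH] /=; first by rewrite ltnS -addnn leq_addr.
by apply: leq_trans IH _; rewrite -[leqRHS]addnn leq_addr.
Qed.

(** A value may have many codes. This allows the elements of a group to be coded
   by the words that represent them, and objects such as finite sets of group
   elements to be handled directly, with words never mentioned. *)
Class Numbered (T : Type) := {
  rep : nat -> T;
  rep_surj : forall t, exists m, rep m = t
}.

#[export] Program Instance num_nat : Numbered nat := {| rep := id |}.
Next Obligation. by exists t. Qed.

#[export] Program Instance num_bool : Numbered bool := {| rep m := m != 0 |}.
Next Obligation. by exists t; case: t. Qed.

#[export] Program Instance num_prod S T (_ : Numbered S) (_ : Numbered T) : Numbered (S * T) :=
  {| rep m := (rep (nfst m), rep (nsnd m)) |}.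
Next Obligation.
have [m1 <-] := rep_surj s; have [m2 <-] := rep_surj t.
by exists (npair m1 m2); rewrite nfst_pair nsnd_pair.
Qed.

#[export] Program Instance num_seq T (_ : Numbered T) : Numbered (seq T) :=
  {| rep m := map rep (CodeSeq.decode m) |}.
Next Obligation.
elim: t => [|y t [m <-]]; first by exists 0.
have [k <-] := rep_surj y.
by exists (CodeSeq.code (k :: CodeSeq.decode m)); rewrite CodeSeq.codeK.
Qed.

(** A code of [f x] is computed from any code of [x]; the code that is found may
   depend on the code of [x] that is given. *)
Definition effective S T {_ : Numbered S} {_ : Numbered T} (f : S -> T) :=
  exists phi, rec1 phi /\ forall m, rep (phi m) = f (rep m).

Section Closure.

Context {X Y Z : Type} {numX : Numbered X} {numY : Numbered Y} {numZ : Numbered Z}.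

Lemma effective_ext (f g : X -> Y) : f =1 g -> effective f -> effective g.
Proof. by move=> /funext ->. Qed.

Lemma effective_id : effective (fun x : X => x).
Proof. by exists id; split=> //; rec_solve. Qed.

Lemma effective_const (c : Y) : effective (fun _ : X => c).
Proof. by have [m <-] := rep_surj c; exists (fun=> m); split=> //; rec_solve. Qed.

Lemma effective_rep (f : X -> nat) : effective f -> effective (fun x => rep (f x) : Y).
Proof.
by case=> phi [r h]; exists phi; split=> // m; rewrite -h.
Qed.

Lemma effective_comp (f : Y -> Z) (g : X -> Y) :
  effective f -> effective g -> effective (fun x => f (g x)).
Proof.
case=> phi [r h] [psi [r' h']]; exists (fun m => phi (psi m)); split.
  by rec_solve.
by move=> m; rewrite h h'.
Qed.

Lemma effective_pair (f : X -> Y) (g : X -> Z) :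
  effective f -> effective g -> effective (fun x => (f x, g x)).
Proof.
case=> phi [r h] [psi [r' h']]; exists (fun m => npair (phi m) (psi m)); split.
  by have h2 := rec_pair; rec_solve.
by move=> m; rewrite /= nfst_pair nsnd_pair h h'.
Qed.

Lemma effective_fst (f : X -> Y * Z) : effective f -> effective (fun x => (f x).1).
Proof.
case=> phi [r h]; exists (fun m => nfst (phi m)); split.
  by have h2 := rec_nfst; rec_solve.
by move=> m; rewrite -h.
Qed.

Lemma effective_snd (f : X -> Y * Z) : effective f -> effective (fun x => (f x).2).
Proof.
case=> phi [r h]; exists (fun m => nsnd (phi m)); split.
  by have h2 := rec_nsnd; rec_solve.
by move=> m; rewrite -h.
Qed.

Lemma effective_succ (f : X -> nat) : effective f -> effective (fun x => (f x).+1).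
Proof.
case=> phi [r h]; exists (fun m => (phi m).+1); split.
  by have h2 := rec_succ; rec_solve.
by move=> m; rewrite -h.
Qed.

Lemma effective_pred (f : X -> nat) : effective f -> effective (fun x => (f x).-1).
Proof.
case=> phi [r h]; exists (fun m => (phi m).-1); split.
  by have h2 := rec_pred; rec_solve.
by move=> m; rewrite -h.
Qed.

Lemma effective_pos (f : X -> nat) : effective f -> effective (fun x => f x != 0).
Proof. by case=> phi [r h]; exists phi; split=> // m; rewrite -h. Qed.

Lemma effective_odd (f : X -> nat) : effective f -> effective (fun x => odd (f x)).
Proof.
case=> phi [r h]; exists (fun m => odd (phi m)); split.
  exact: (rec_app1 rec_odd r).
by move=> m; rewrite -h /=; case: odd.
Qed.

Lemma effective_half (f : X -> nat) : effective f -> effective (fun x => (f x)./2).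
Proof.
case=> phi [r h]; exists (fun m => (phi m)./2); split.
  exact: (rec_app1 rec_half r).
by move=> m; rewrite -h.
Qed.

Lemma effective_if (b : X -> bool) (f g : X -> Y) : effective b -> effective f -> effective g ->
  effective (fun x => if b x then f x else g x).
Proof.
case=> phi [r h] [psi [r' h']] [chi [r'' h'']].
pose s n u v := if n is 0 then v else u : nat.
have rs : rec3 s.
  have h2 : rec2 (fun n p => s n (nfst p) (nsnd p)).
    apply: (@rec2_prim nsnd (fun _ _ p => nfst p)) => //.
      exact: rec_nsnd.
    by apply: (rec_app1 rec_nfst); exact: rec_nth.
  have h3 := rec_pair.
  have := rec_app2 h2 (@rec_nth 3 0 isT)
    (rec_app2 rec_pair (@rec_nth 3 1 isT) (@rec_nth 3 2 isT)).
  by apply: recursive_ext => v; rewrite nfst_pair nsnd_pair.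
exists (fun m => s (phi m) (psi m) (chi m)); split; first by rec_solve.
by move=> m; rewrite -h -h' -h'' /= /s; case: (phi m).
Qed.

Lemma effective_iter (n : X -> nat) (s : X -> Y -> Y) (a : X -> Y) :
  effective n -> effective (fun z => s z.1 z.2) -> effective a ->
  effective (fun x => iter (n x) (s x) (a x)).
Proof.
case=> phi [r h] [psi [r' h']] [chi [r'' h'']].
pose g k m := iter k (fun c => psi (npair m c)) (chi m).
have rg : rec2 g.
  apply: (@rec2_prim chi (fun _ c m => psi (npair m c))) => //.
  by have h2 := rec_pair; rec_solve.
exists (fun m => g (phi m) m); split; first by rec_solve.
move=> m; rewrite -h /g /=; elim: (phi m) => //= k IH.
by rewrite h' /= nfst_pair nsnd_pair IH.
Qed.

Lemma effective_cons (f : X -> Y) (s : X -> seq Y) :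
  effective f -> effective s -> effective (fun x => f x :: s x).
Proof.
case=> phi [r h] [psi [r' h']].
exists (fun m => (npair (phi m) (psi m)).+1); split.
  by have h1 := rec_succ; have h2 := rec_pair; rec_solve.
move=> m; rewrite -h -h' -[LHS]/(map rep (CodeSeq.decode (npair _ _).+1)).
by rewrite decodeS nfst_pair nsnd_pair.
Qed.

(** A loop carries the code of the remaining list; the code of the whole list
   bounds its length, so it serves as the number of rounds. *)
Lemma effective_foldl (l : X -> seq Y) (f : X -> Y -> Z -> Z) (a : X -> Z) :
  effective l -> effective (fun t => f t.1 t.2.1 t.2.2) -> effective a ->
  effective (fun x => foldl (fun acc y => f x y acc) (a x) (l x)).
Proof.
case=> phi [r h] [psi [r' h']] [chi [r'' h'']].
pose step m st := if nfst st is c.+1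
  then npair (nsnd c) (psi (npair m (npair (nfst c) (nsnd st)))) else st.
have rstep : rec2 step.
  pose aux n m st := if n is c.+1
    then npair (nsnd c) (psi (npair m (npair (nfst c) (nsnd st)))) else st.
  have raux : rec2 (fun n p => aux n (nfst p) (nsnd p)).
    apply: (@rec2_prim nsnd (fun c _ p => npair (nsnd c)
      (psi (npair (nfst p) (npair (nfst c) (nsnd (nsnd p))))))) => //.
      exact: rec_nsnd.
    by have h1 := rec_nfst; have h2 := rec_nsnd; have h3 := rec_pair; rec_solve.
  have := rec_app2 raux (rec_app1 rec_nfst (@rec_nth 2 1 isT))
    (rec_app2 rec_pair (@rec_nth 2 0 isT) (@rec_nth 2 1 isT)).
  by apply: recursive_ext => v; rewrite nfst_pair nsnd_pair.
pose g k m := iter k (step m) (npair (phi m) (chi m)).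
have rg : rec2 g.
  apply: (@rec2_prim (fun m => npair (phi m) (chi m)) (fun _ c m => step m c)) => //.
    by have h3 := rec_pair; rec_solve.
  by rec_solve.
exists (fun m => nsnd (g (phi m) m)); split.
  by have h2 := rec_nsnd; rec_solve.
move=> m; rewrite -h -h'' /g.
have key k c b : size (CodeSeq.decode c) <= k ->
    rep (nsnd (iter k (step m) (npair c b))) =
    foldl (fun acc y => f (rep m) y acc) (rep b) (map rep (CodeSeq.decode c)).
  elim: k c b => [|k IH] [|c] b.
  - by rewrite nsnd_pair.
  - by rewrite decodeS.
  - have st0 : step m (npair 0 b) = npair 0 b by rewrite /step nfst_pair.
    by rewrite iterSr st0 => _; rewrite IH.
  rewrite decodeS iterSr ltnS {2}/step nfst_pair nsnd_pair => /IH ->.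
  by rewrite [rep (psi _)]h' /= !(nfst_pair, nsnd_pair).
exact: key (size_decode _).
Qed.

End Closure.

Ltac effective_solve := rewrite /=; repeat first
  [ exact: effective_id | exact: effective_const | assumption
  | apply: effective_fst | apply: effective_snd | apply: effective_pair | apply: effective_cons
  | apply: effective_succ | apply: effective_pred | apply: effective_odd | apply: effective_half
  | apply: effective_pos | apply: effective_if ].

Section Closure2.

Context {X Y Z : Type} {numX : Numbered X} {numY : Numbered Y} {numZ : Numbered Z}.

Lemma effective_rev (s : X -> seq Y) : effective s -> effective (fun x => rev (s x)).
Proof.
move=> cs; rewrite (_ : (fun x => _) = fun x => foldl (fun a y => y :: a) [::] (s x)).
  by apply: (effective_foldl (f := fun _ y a => y :: a)) => //; effective_solve.
apply: funext => x; rewrite -[in RHS](revK (s x)) foldl_rev.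
by elim: (rev (s x)) => //= y l <-.
Qed.

Lemma effective_foldr (l : X -> seq Y) (f : X -> Y -> Z -> Z) (a : X -> Z) :
  effective l -> effective (fun t => f t.1 t.2.1 t.2.2) -> effective a ->
  effective (fun x => foldr (f x) (a x) (l x)).
Proof.
move=> cl cf ca.
rewrite (_ : (fun x => _) = fun x => foldl (fun b y => f x y b) (a x) (rev (l x))).
  by apply: effective_foldl => //; exact: effective_rev.
by apply: funext => x; rewrite foldl_rev.
Qed.

End Closure2.

Section Closure3.

Context {X Y Z : Type} {numX : Numbered X} {numY : Numbered Y} {numZ : Numbered Z}.

Lemma effective_map (l : X -> seq Y) (f : X -> Y -> Z) :
  effective l -> effective (fun t => f t.1 t.2) -> effective (fun x => map (f x) (l x)).
Proof.
move=> cl cf.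
apply: (effective_foldr (f := fun x y a => f x y :: a)) => //; effective_solve.
by apply: (effective_comp (f := fun t => f t.1 t.2) (g := fun t => (t.1, t.2.1))) => //; effective_solve.
Qed.

Lemma effective_cat (s t : X -> seq Y) : effective s -> effective t -> effective (fun x => s x ++ t x).
Proof.
move=> cs ct; apply: effective_ext (effective_foldr (f := fun _ y a => y :: a) cs _ ct).
  by move=> x; elim: (s x) => //= y l ->.
by effective_solve.
Qed.

Lemma effective_all (l : X -> seq Y) (p : X -> Y -> bool) :
  effective l -> effective (fun t => p t.1 t.2) -> effective (fun x => all (p x) (l x)).
Proof.
move=> cl cp.
apply: effective_ext (effective_foldr (f := fun x y b => if p x y then b else false)
  (a := fun=> true) cl _ _); last by effective_solve.
  by move=> x; elim: (l x) => //= y s ->.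
effective_solve.
by apply: (effective_comp (f := fun t => p t.1 t.2) (g := fun t => (t.1, t.2.1))) => //; effective_solve.
Qed.

Lemma effective_and (p q : X -> bool) : effective p -> effective q -> effective (fun x => p x && q x).
Proof. by move=> cp cq; apply: effective_if => //; effective_solve. Qed.

Lemma effective_or (p q : X -> bool) : effective p -> effective q -> effective (fun x => p x || q x).
Proof. by move=> cp cq; apply: effective_if => //; effective_solve. Qed.

Lemma effective_not (p : X -> bool) : effective p -> effective (fun x => ~~ p x).
Proof.
move=> cp; rewrite (_ : (fun x => _) = fun x => if p x then false else true).
  by effective_solve.
by apply: funext => x; case: (p x).
Qed.

Lemma effective_has (l : X -> seq Y) (p : X -> Y -> bool) :
  effective l -> effective (fun t => p t.1 t.2) -> effective (fun x => has (p x) (l x)).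
Proof.
move=> cl cp.
apply: effective_ext (effective_foldr (f := fun x y b => if p x y then true else b)
  (a := fun=> false) cl _ _); last by effective_solve.
  by move=> x; elim: (l x) => //= y s ->.
effective_solve.
by apply: (effective_comp (f := fun t => p t.1 t.2) (g := fun t => (t.1, t.2.1))) => //; effective_solve.
Qed.

Lemma effective_size (s : X -> seq Y) : effective s -> effective (fun x => size (s x)).
Proof.
move=> cs; apply: effective_ext (effective_foldr (f := fun _ _ n => n.+1) (a := fun=> 0) cs _ _);
  last by effective_solve.
  by move=> x; elim: (s x) => //= y l ->.
by effective_solve.
Qed.

Lemma effective_add (f g : X -> nat) : effective f -> effective g -> effective (fun x => f x + g x).
Proof.
move=> cf cg; rewrite (_ : (fun x => _) = fun x => iter (f x) succn (g x)).
  by apply: (effective_iter (s := fun _ n => n.+1)) => //; effective_solve.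
by apply: funext => x; rewrite iter_succn addnC.
Qed.

End Closure3.

Section Closure4.

Context {X Y Z : Type} {numX : Numbered X} {numY : Numbered Y} {numZ : Numbered Z}.

Lemma effective_subn (f g : X -> nat) : effective f -> effective g ->
  effective (fun x => f x - g x).
Proof.
move=> cf cg; apply: effective_ext (effective_iter (s := fun _ n => n.-1) cg _ cf).
  by move=> x; elim: (g x) => [|n IH]; rewrite ?subn0 //= IH subnS.
by effective_solve.
Qed.

Lemma effective_ltn (f g : X -> nat) : effective f -> effective g ->
  effective (fun x => f x < g x).
Proof.
move=> cf cg; apply: effective_ext (effective_pos (effective_subn cg cf)).
by move=> x; rewrite subn_eq0 -ltnNge.
Qed.

Lemma effective_eqn (f g : X -> nat) : effective f -> effective g ->
  effective (fun x => f x == g x).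
Proof.
move=> cf cg; apply: effective_ext (effective_not
  (effective_or (effective_ltn cf cg) (effective_ltn cg cf))).
by move=> x; rewrite negb_or -!leqNgt andbC -eqn_leq.
Qed.

Lemma effective_behead (s : X -> seq Y) : effective s -> effective (fun x => behead (s x)).
Proof.
apply: (effective_comp (f := behead)); exists (fun m => nsnd m.-1); split.
  exact: (rec_app1 rec_nsnd rec_pred).
case=> [|m]; first by rewrite -[0.-1]/(npair 0 0) nsnd_pair.
by rewrite -[RHS]/(behead (map rep (CodeSeq.decode m.+1))) decodeS.
Qed.

End Closure4.

Section Closure5.

Context {X Y : Type} {numX : Numbered X} {numY : Numbered Y}.

Lemma effective_nth (s : X -> seq Y) (n : X -> nat) (d : Y) :
  effective s -> effective n -> effective (fun x => nth d (s x) (n x)).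
Proof.
move=> cs cn.
have ch : effective (fun l : seq Y => head d l).
  rewrite (_ : (fun x => _) = fun x => foldr (fun y _ => y) d x).
    by apply: (effective_foldr (f := fun _ y _ => y)); effective_solve.
  by apply: funext; case.
rewrite (_ : (fun x => _) = fun x => head d (iter (n x) behead (s x))).
  apply: (effective_comp (f := head d)) => //.
  apply: (effective_iter (s := fun _ l => behead l)) => //.
  by apply: effective_behead; effective_solve.
apply: funext => x; rewrite -nth0.
elim: (n x) (s x) => //= k IH; case=> [|y l]; rewrite ?nth_nil -?iterS ?iterSr /=.
  by rewrite -IH nth_nil.
by rewrite -IH.
Qed.

End Closure5.

(** * Semidecidable predicates *)

(** As in the definition of recursive enumerability by projection: the witness
   is a number, and checking it is a computation. *)
Definition sd X {_ : Numbered X} (P : X -> Prop) :=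
  exists p : X * nat -> bool, effective p /\ forall x, P x <-> exists w, p (x, w).

Section Semidecidable.

Context {X Y : Type} {numX : Numbered X} {numY : Numbered Y}.

Lemma effective_unpack : effective (fun z : X * nat => ((z.1, rep (nfst z.2) : Y), nsnd z.2)).
Proof.
apply: effective_pair; [apply: effective_pair; first by effective_solve|].
  apply: effective_rep; exists (fun m => nfst (nsnd m)); split=> //.
  exact: (rec_app1 rec_nfst rec_nsnd).
exists (fun m => nsnd (nsnd m)); split=> //.
exact: (rec_app1 rec_nsnd rec_nsnd).
Qed.

Lemma sd_ext (P Q : X -> Prop) : (forall x, P x <-> Q x) -> sd P -> sd Q.
Proof. by move=> h [p [cp hp]]; exists p; split=> // x; rewrite -h. Qed.

Lemma sd_dec (p : X -> bool) : effective p -> sd (fun x => p x).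
Proof.
move=> cp; exists (fun z => p z.1); split.
  by apply: (effective_comp (f := p)) => //; effective_solve.
by move=> x; split=> [|[]] //; exists 0.
Qed.

Lemma sd_comp (P : Y -> Prop) (f : X -> Y) : sd P -> effective f -> sd (fun x => P (f x)).
Proof.
case=> p [cp hp] cf; exists (fun z => p (f z.1, z.2)); split.
  apply: (effective_comp (f := p) (g := fun z => (f z.1, z.2))) => //; apply: effective_pair.
    by apply: (effective_comp (f := f)) => //; effective_solve.
  by effective_solve.
by move=> x; rewrite hp.
Qed.

Lemma sd_or (P Q : X -> Prop) : sd P -> sd Q -> sd (fun x => P x \/ Q x).
Proof.
case=> p [cp hp] [q [cq hq]]; exists (fun z => p z || q z); split.
  exact: effective_or.
move=> x; rewrite hp hq; split=> [[[w h]|[w h]]|[w /orP[h|h]]].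
- by exists w; rewrite h.
- by exists w; rewrite h orbT.
- by left; exists w.
- by right; exists w.
Qed.

Lemma sd_ex (P : X -> Y -> Prop) :
  sd (fun z => P z.1 z.2) -> sd (fun x => exists y, P x y).
Proof.
case=> p [cp hp]; exists (fun z => p ((z.1, rep (nfst z.2)), nsnd z.2)); split.
  exact: effective_comp cp effective_unpack.
move=> x; split=> [[y]|[w h]].
  have [m <-] := rep_surj y => /(hp (_, _))[w h].
  by exists (npair m w); rewrite /= nfst_pair nsnd_pair.
by exists (rep (nfst w)); apply/(hp (_, _)); exists (nsnd w).
Qed.

End Semidecidable.

Lemma sd_and X {numX : Numbered X} (P Q : X -> Prop) :
  sd P -> sd Q -> sd (fun x => P x /\ Q x).
Proof.
case=> p [cp hp] [q [cq hq]].
apply: sd_ext (sd_ex (P := fun x (ww : nat * nat) => p (x, ww.1) && q (x, ww.2)) _).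
  move=> x; rewrite hp hq; split=> [[[w1 w2] /andP[]]|[[w1 h1] [w2 h2]]].
    by split; [exists w1|exists w2].
  by exists (w1, w2); rewrite /= h1.
apply: sd_dec; apply: effective_and.
  by apply: (effective_comp (f := p) (g := fun z => (z.1, z.2.1))) => //; effective_solve.
by apply: (effective_comp (f := q) (g := fun z => (z.1, z.2.2))) => //; effective_solve.
Qed.

(** The witnesses for the finitely many members of the list have a common
   bound, and the bound is a witness for all of them. *)
Lemma sd_all X {numX : Numbered X} (Y : eqType) {numY : Numbered Y}
    (P : X -> Y -> Prop) (l : X -> seq Y) :
  effective l -> sd (fun z => P z.1 z.2) -> sd (fun x => forall y, y \in l x -> P x y).
Proof.
move=> cl [p [cp hp]].
pose down n := iter n (fun s => size s :: s) [::].
have size_down n : size (down n) = n by elim: n => //= n ->.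
have mem_down k n : k < n -> k \in down n.
  elim: n => //= n IH; rewrite in_cons size_down ltnS leq_eqVlt.
  by case/orP=> [->|/IH ->] //; rewrite orbT.
exists (fun z => all (fun y => has (fun w => p ((z.1, y), w)) (down z.2)) (l z.1)); split.
  apply: (effective_all (p := fun z y => has (fun w => p ((z.1, y), w)) (down z.2))).
    by apply: (effective_comp (f := l)) => //; effective_solve.
  apply: (effective_has (l := fun z => down z.1.2) (p := fun z w => p ((z.1.1, z.2), w))).
    apply: (effective_iter (s := fun _ s => size s :: s)); effective_solve.
    by apply: effective_size; effective_solve.
  apply: (effective_comp (f := p) (g := fun z => ((z.1.1.1, z.1.2), z.2))) => //.
  by effective_solve.
move=> x; split=> [h|[w /allP h] y /h /hasP[k _ pk]]; last first.
  by apply/(hp (_, _)); exists k.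
elim: (l x) h => [|y s IH] h; first by exists 0.
have [w /allP hw] := IH (fun z zs => h z (@mem_behead _ (y :: s) z zs)).
have /(hp (_, _)) [k hk] := h y (mem_head _ _).
exists (maxn w k.+1); rewrite /=; apply/andP; split.
  by apply/hasP; exists k => //; apply: mem_down; rewrite leq_max ltnSn orbT.
apply/allP => z /hw /hasP[j jw pj]; apply/hasP; exists j => //; apply: mem_down.
have {jw} : j < w.
  elim: {+}w jw => //= n IHn; rewrite in_cons size_down => /predU1P[->|/IHn] //.
  by move/ltnW.
by rewrite leq_max => ->.
Qed.

(** Since the test depends on the value only and not on its code, so does the
   least witness; this makes the search a function on values. *)
Lemma effective_mu X {numX : Numbered X} (p : X * nat -> bool) : effective p ->
  (forall x, exists w, p (x, w)) ->
  exists h : X -> nat, effective h /\ forall x, p (x, h x).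
Proof.
move=> [phi [r hphi]] ex; exists (fun x => ex_minn (ex x)); split; last first.
  by move=> x; case: ex_minnP.
exists (fun m => ex_minn (ex (rep m))); split=> //.
have e w m : p (rep m, w) = (phi (npair m w) != 0).
  transitivity (rep (phi (npair m w)) : bool) => //.
  by rewrite hphi /= nfst_pair nsnd_pair.
apply: (rec1_min (f := fun w m => (phi (npair m w)) == 0)).
- have h2 := rec_pair; apply: (rec_app1 rec_not).
  by rec_solve.
- by move=> m; case: ex_minnP => w; rewrite e => /negbTE ->.
- move=> m w; case: ex_minnP => v _ hmin lt.
  case E: (_ == 0) => // _; have := hmin w; rewrite e E => /(_ isT).
  by rewrite leqNgt lt.
Qed.

(** A total semidecidable relation contains the graph of a computable function:
   pairs of a value and a witness are searched through. *)
Theorem sd_choice X Y {numX : Numbered X} {numY : Numbered Y} (P : X -> Y -> Prop) :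
  sd (fun z => P z.1 z.2) -> (forall x, exists y, P x y) ->
  exists h : X -> Y, effective h /\ forall x, P x (h x).
Proof.
case=> p [cp hp] ex.
pose q (z : X * nat) := p ((z.1, @rep Y numY (nfst z.2)), nsnd z.2).
have cq : effective q.
  exact: effective_comp cp effective_unpack.
have exq x : exists w, q (x, w).
  have [y] := ex x; have [m <-] := rep_surj y => /(hp (_, _))[w h].
  by exists (npair m w); rewrite /q /= nfst_pair nsnd_pair.
have [h [[phi [r ch]] hh]] := effective_mu cq exq.
exists (fun x => rep (nfst (h x))); split.
  exists (fun m => nfst (phi m)); split; first by have h1 := rec_nfst; rec_solve.
  by move=> m; rewrite -ch.
by move=> x; apply/(hp (_, _)); exists (nsnd (h x)); exact: hh.
Qed.

Local Open Scope group_scope.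

(** * Finitely generated subgroups *)

Section Subgroups.

Variable G : groupType.
Implicit Types (H J : G -> Prop) (X Y : seq G).

Definition subgroup H :=
  [/\ H 1, forall x y, H x -> H y -> H (x * y) & forall x, H x -> H x^-1].

Definition gen X : G -> Prop := generated (fun y => y \in X).

Lemma generated_min (P : G -> Prop) H : subgroup H ->
  (forall x, P x -> H x) -> forall y, generated P y -> H y.
Proof. by case=> H1 HM HV PH y; elim=> {y} //; auto. Qed.

Lemma gen_subgroup X : subgroup (gen X).
Proof. by split; [exact: Gen1 | exact: GenM | exact: GenV]. Qed.

Lemma gen_in X x : x \in X -> gen X x.
Proof. exact: GenIn. Qed.

Lemma gen_min X H : subgroup H -> (forall x, x \in X -> H x) ->
  forall y, gen X y -> H y.
Proof. exact: generated_min. Qed.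

Lemma gen_le X Y : (forall x, x \in X -> gen Y x) -> forall y, gen X y -> gen Y y.
Proof. exact: gen_min (gen_subgroup Y). Qed.

Lemma gen_subset X Y : {subset X <= Y} -> forall y, gen X y -> gen Y y.
Proof. by move=> XY; apply: gen_le => x /XY; exact: gen_in. Qed.

Lemma gen_nil y : gen [::] y -> y = 1.
Proof.
apply: (gen_min (H := fun y => y = 1)) => //.
by split=> [//|x z -> ->|x ->]; rewrite ?mulg1 ?invg1.
Qed.

Lemma subgroup_prod H s : subgroup H -> (forall x, x \in s -> H x) ->
  H (\prod_(x <- s) x).
Proof.
move=> [H1 HM _] sH; rewrite big_seq; elim/big_ind: _ => //.
Qed.

Lemma subgroup_exp H x k : subgroup H -> H x -> H (x ^+ k).
Proof.
by move=> [H1 HM _] Hx; elim: k => [|k IH]; rewrite ?expg0 // expgS; exact: HM.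
Qed.

(** Membership in a subgroup is witnessed by a list of generators and inverses
   of generators; this is the form in which it can be searched for. *)
Lemma gen_letters X y : gen X y <->
  exists s : seq G, (forall z, z \in s -> (z \in X) || (z^-1 \in X)) /\ y = \prod_(z <- s) z.
Proof.
split=> [|[s [sX ->]]]; last first.
  apply: subgroup_prod (gen_subgroup X) _ => z /sX /orP[|zX]; first exact: gen_in.
  by rewrite -[z]invgK; apply/GenV/gen_in.
elim=> {y} [x xX||x y _ [s [sX ->]] _ [t [tX ->]]|x _ [s [sX ->]]].
- exists [:: x]; rewrite big_seq1; split=> // z; rewrite inE => /eqP ->.
  by rewrite xX.
- by exists [::]; rewrite big_nil.
- exists (s ++ t); rewrite big_cat; split=> // z.
  by rewrite mem_cat => /orP[/sX|/tX].
- exists (rev (map inv s)); split.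
    move=> z; rewrite mem_rev => /mapP[u /sX h ->].
    by rewrite invgK orbC.
  elim: s {sX} => [|u s IH]; first by rewrite !big_nil invg1.
  by rewrite big_cons invgM IH /= rev_cons -cats1 big_cat big_seq1.
Qed.

Lemma fg_ext H J : (forall x, H x <-> J x) ->
  finitely_generated H -> finitely_generated J.
Proof. by move=> HJ [X hX]; exists X => y; rewrite -HJ. Qed.

Lemma filter_prop (T : eqType) (P : T -> Prop) (s : seq T) :
  exists t : seq T, forall x, x \in t <-> x \in s /\ P x.
Proof.
exists (filter (fun x => `[< P x >]) s) => x; rewrite mem_filter.
by split=> [/andP[/asboolP ? ->]|[-> ?]] //; rewrite andbT; apply/asboolP.
Qed.

(** Following a word letter by letter while keeping track of a representative
   in [E] writes it as a product of elements [e * l * e'^-1] of the subgroup;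
   this gives both the theorem that subgroups of finite index are finitely
   generated and its variants for words that stay in finitely many cosets. *)
Lemma schreier_fg J (E L : seq G) : subgroup J ->
  (exists2 e, e \in E & J e) ->
  (forall y, J y -> exists s, [/\ {subset s <= L}, y = \prod_(z <- s) z &
     forall i, exists2 e, e \in E & J (\prod_(z <- take i s) z * e^-1)]) ->
  finitely_generated J.
Proof.
move=> subJ [e0 e0E Je0] wordJ; have [J1 JM JV] := subJ.
pose steps := [seq a * e^-1 | a <- [seq e * l | e <- E, l <- L], e <- E].
have [X hX] := filter_prop J (E ++ steps).
have genJ y : gen X y -> J y by apply: gen_min => // x /hX[].
have stepX e l e' : e \in E -> l \in L -> e' \in E -> J (e * l * e'^-1) ->
    gen X (e * l * e'^-1).
  move=> eE lL e'E Jx; apply/gen_in/hX; split=> //.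
  rewrite mem_cat; apply/orP; right; apply: allpairs_f => //.
  exact: allpairs_f.
have genE e : e \in E -> J e -> gen X e.
  by move=> eE Je; apply/gen_in/hX; rewrite mem_cat eE.
exists X => y; split=> [Jy|/genJ //].
have [s [sL yE hs]] := wordJ y Jy.
have [e eE he] : exists2 e, e \in E & gen X (\prod_(z <- s) z * e^-1).
  suff key n : exists2 e, e \in E & gen X (\prod_(z <- take n s) z * e^-1).
    by have := key (size s); rewrite take_size.
  elim: n => [|n [e eE he]].
    exists e0 => //; rewrite take0 big_nil mul1g; exact/GenV/genE.
  case: (leqP (size s) n) => [le|lt].
    by exists e => //; rewrite take_oversize ?leqW //; rewrite take_oversize in he.
  have [e' e'E he'] := hs n.+1; exists e' => //.
  move: he'; rewrite (take_nth 1) // -cats1 big_cat big_seq1 /=.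
  set p := \prod_(z <- take n s) z in he * => he'.
  rewrite (_ : p * _ * _ = (p * e^-1) * (e * nth 1 s n * e'^-1)); last first.
    by rewrite !mulgA mulgVK.
  apply: (GenM he); apply: stepX => //; first by apply/sL/mem_nth.
  rewrite (_ : _ * _ = (p * e^-1)^-1 * (p * nth 1 s n * e'^-1)).
    by apply: JM => //; apply/JV/genJ.
  by rewrite invgM invgK !mulgA mulgVK.
rewrite -yE in he; rewrite -[y](mulgVK e).
apply: (GenM he); apply: genE => //.
rewrite (_ : e = (y * e^-1)^-1 * y); last by rewrite invgM invgK mulgVK.
by apply: JM => //; apply/JV/genJ.
Qed.

End Subgroups.

(** ** Homomorphic images and extensions *)

Definition is_hom (G G' : groupType) (f : G -> G') := forall x y, f (x * y) = f x * f y.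

Section Homomorphisms.

Variables (G G' : groupType) (f : G -> G').
Hypothesis fM : is_hom f.

Lemma hom1 : f 1 = 1.
Proof. by apply: (mulgI (f 1)); rewrite -fM !mulg1. Qed.

Lemma homV x : f x^-1 = (f x)^-1.
Proof. by apply: (mulgI (f x)); rewrite -fM !mulgV hom1. Qed.

Lemma hom_prod s : f (\prod_(x <- s) x) = \prod_(x <- map f s) x.
Proof. by elim: s => [|x s IH]; rewrite ?big_nil ?hom1 // !big_cons fM IH. Qed.

Lemma homX x k : f (x ^+ k) = f x ^+ k.
Proof. by elim: k => [|k IH]; rewrite ?expg0 ?hom1 // !expgS fM IH. Qed.

Lemma generated_hom (P : G -> Prop) y :
  generated (fun z => exists2 x, P x & z = f x) y <->
  exists2 x, generated P x & f x = y.
Proof.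
split=> [|[x Px <-]].
  elim=> {y} [_ [x Px ->]||y z _ [x Px <-] _ [u Pu <-]|y _ [x Px <-]].
  - by exists x => //; exact: GenIn.
  - by exists 1; [exact: Gen1 | exact: hom1].
  - by exists (x * u); [exact: GenM | rewrite fM].
  - by exists x^-1; [exact: GenV | rewrite homV].
elim: Px => {x} [x Px||x z _ IHx _ IHz|x _ IH].
- by apply: GenIn; exists x.
- by rewrite hom1; exact: Gen1.
- by rewrite fM; exact: GenM.
- by rewrite homV; exact: GenV.
Qed.

Lemma gen_hom X y : gen (map f X) y <-> exists2 x, gen X x & f x = y.
Proof.
rewrite -generated_hom; split; apply: generated_min; try exact: gen_subgroup.
- by split; [exact: Gen1|exact: GenM|exact: GenV].
- by move=> _ /mapP[x xX ->]; apply: GenIn; exists x.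
- by move=> _ [x xX ->]; apply: gen_in; exact: map_f.
Qed.

Lemma subgroup_preim (J : G' -> Prop) : subgroup J -> subgroup (fun x => J (f x)).
Proof.
case=> J1 JM JV; split=> [|x y|x]; rewrite ?hom1 ?fM ?homV; auto.
Qed.

Lemma subgroup_image (H : G -> Prop) : subgroup H ->
  subgroup (fun y => exists2 x, H x & f x = y).
Proof.
case=> H1 HM HV; split=> [|_ _ [x Hx <-] [y Hy <-]|_ [x Hx <-]].
- by exists 1; rewrite ?hom1.
- by exists (x * y); rewrite ?fM; auto.
- by exists x^-1; rewrite ?homV; auto.
Qed.

Lemma image_fg (H : G -> Prop) : finitely_generated H ->
  finitely_generated (fun y => exists2 x, H x & f x = y).
Proof.
case=> X hX; exists (map f X) => y; rewrite -/(gen _ _) gen_hom.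
by split=> -[x hx <-]; exists x => //; apply/hX.
Qed.

Lemma extension_fg (H : G -> Prop) : subgroup H ->
  finitely_generated (fun y => exists2 x, H x & f x = y) ->
  finitely_generated (fun x => H x /\ f x = 1) ->
  finitely_generated H.
Proof.
move=> subH [Y hY] [K hK]; have [H1 HM HV] := subH.
have [X [XH YX]] : exists X : seq G, (forall x, x \in X -> H x) /\
    forall y, y \in Y -> exists2 x, x \in X & f x = y.
  have : forall y, y \in Y -> exists2 x, H x & f x = y.
    by move=> y yY; apply/hY/gen_in.
  elim: Y {hY} => [|y Y IH] h; first by exists [::].
  have [x Hx fx] := h y (mem_head _ _).
  have [|X [XH YX]] := IH; first by move=> z zY; apply: h; rewrite inE zY orbT.
  exists (x :: X); split=> [z|z]; rewrite inE.
    by case/predU1P=> [->|/XH].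
  case/predU1P=> [->|/YX [u uX fu]]; first by exists x; rewrite ?mem_head.
  by exists u; rewrite ?inE ?uX ?orbT.
exists (X ++ K) => h; split; last first.
  apply: gen_min => // x; rewrite mem_cat => /orP[/XH //|xK].
  by have [] : H x /\ f x = 1 by apply/hK/gen_in.
move=> Hh; have : gen Y (f h) by apply/hY; exists h.
have imY : {subset Y <= map f X}.
  by move=> y /YX [x xX <-]; exact: map_f.
move/(gen_subset imY)/gen_hom => [x genx fx].
have Hx : H x by apply: gen_min genx.
rewrite -[h](mulVKg x); apply: GenM.
  by apply: gen_subset genx => z; rewrite mem_cat => ->.
have : gen K (x^-1 * h) by apply/hK; split; [auto | rewrite fM homV fx mulVg].
by apply: gen_subset => z; rewrite mem_cat orbC => ->.
Qed.

End Homomorphisms.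

(** * Integer characters *)

Section Characters.

Variable G : groupType.

Definition ihom (c : G -> int) := forall x y, c (x * y) = (c x + c y)%R.

Section OneCharacter.

Variables (c : G -> int).
Hypothesis cM : ihom c.

Lemma ihom1 : c 1 = 0%R.
Proof. by have := cM 1 1; rewrite mulg1; lia. Qed.

Lemma ihomV x : c x^-1 = (- c x)%R.
Proof. by have := cM x x^-1; rewrite mulgV ihom1; lia. Qed.

Lemma ihomX x k : c (x ^+ k) = (k%:Z * c x)%R.
Proof.
elim: k => [|k IH]; first by rewrite expg0 ihom1; lia.
by rewrite expgS cM IH; lia.
Qed.

(** A subgroup of the integers is cyclic: [d] is an element of the subgroup on
   which the character takes its smallest nonzero absolute value. *)
Lemma ihom_split D : subgroup D -> exists d, [/\ D d, c d <> 0%R \/ d = 1 &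
  forall y, D y -> exists a z, [/\ gen [:: d] a, D z, c z = 0%R & y = a * z]].
Proof.
move=> [D1 DM DV].
case: (pselect (exists y, D y /\ c y <> 0%R)) => [ex|nex]; last first.
  exists 1; split=> [//||y Dy]; first by right.
  exists 1, y; split=> //; rewrite ?mul1g //; first exact: Gen1.
  by apply/eqP/negPn/negP => /eqP cy; apply: nex; exists y.
have [d [Dd cd dmin]] : exists d, [/\ D d, c d <> 0%R &
    forall y, D y -> c y <> 0%R -> `|c d|%N <= `|c y|%N].
  have [y [Dy cy]] := ex; have [k] := ubnP `|c y|%N.
  elim: k y Dy cy => // k IH y Dy cy lt.
  case: (pselect (exists z, [/\ D z, c z <> 0%R & `|c z|%N < `|c y|%N])).
    by case=> z [Dz cz lz]; apply: (IH z) => //; apply: leq_trans lz _.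
  move=> h; exists y; split=> // z Dz cz; case: leqP => // l; case: h.
  by exists z.
exists d; split=> // [|y Dy]; first by left.
have [k] := ubnP `|c y|%N; elim: k y Dy => // k IH y Dy lt.
case: (pselect (c y = 0%R)) => [cy|cy].
  by exists 1, y; split=> //; rewrite ?mul1g //; exact: Gen1.
have := dmin y Dy cy => le.
have [d' [Dd' gd' lt']] : exists d', [/\ D d', gen [:: d] d' &
    (`|c (d'^-1 * y)| < `|c y|)%N].
  case: (pselect (0 <= c d * c y)%R) => s.
    exists d; split=> //; first by apply: gen_in; rewrite inE.
    by rewrite cM ihomV; move: cd cy le s; nia.
  exists d^-1; split; first exact: DV.
    by apply: GenV; apply: gen_in; rewrite inE.
  by rewrite cM !ihomV; move: cd cy le s; nia.
have [||a [z [ga Dz cz E]]] := IH (d'^-1 * y); first by auto.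
  exact: leq_trans lt' _.
exists (d' * a), z; split=> //; first exact: GenM.
by rewrite -mulgA -E mulVKg.
Qed.

Lemma gen_cycle (d a : G) : gen [:: d] a -> exists i j, a = d ^+ i * d ^- j.
Proof.
apply: (gen_min (H := fun a => exists i j, a = d ^+ i * d ^- j)) => [|x]; last first.
  by rewrite inE => /eqP ->; exists 1%N, 0%N; rewrite expg1 expg0 invg1 mulg1.
split=> [|_ _ [i [j ->]] [k [l ->]]|_ [i [j ->]]].
- by exists 0%N, 0%N; rewrite expg0 invg1 mulg1.
- exists (i + k)%N, (j + l)%N; rewrite -!expVgn !expgnDr !mulgA; congr (_ * _).
  rewrite -!mulgA; congr (_ * _); apply: commuteX2.
  exact/commute_sym/commuteV.
- by exists j, i; rewrite invgM invgK.
Qed.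

Lemma ihom_cycle0 d a : gen [:: d] a -> c a = 0%R -> c d <> 0%R \/ d = 1 -> a = 1.
Proof.
move=> ga ca [cd|d1]; last first.
  by have := ga; rewrite d1 => /gen_le h; apply/gen_nil/h => x; rewrite inE => /eqP ->; exact: Gen1.
have [i [j E]] := gen_cycle ga; move: ca; rewrite E cM ihomV !ihomX => h.
suff -> : i = j by rewrite mulgV.
by move: cd h; nia.
Qed.

End OneCharacter.

(** ** Kernels of finitely many characters *)

Variable e : nat -> G -> int.
Hypothesis eM : forall j, ihom (e j).

(** A certificate that the kernel of the [j]-th character on the subgroup
   generated by [X] lies in the subgroup generated by [Y]. As [d] normalizes the
   latter, every element of the former is a power of [d] times an element of the
   latter, and the character vanishes on it only if the power is trivial. *)
Definition step (j : nat) (X Y : seq G) :=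
  exists d, [/\ e j d <> 0%R \/ d = 1,
    forall x, x \in X -> gen (d :: Y) x &
    forall y, y \in Y -> [/\ e j y = 0%R, gen Y (d * y * d^-1) & gen Y (d^-1 * y * d)]].

Lemma step_sound j X Y x : step j X Y -> gen X x -> e j x = 0%R -> gen Y x.
Proof.
move=> [d [hd XY nY]] gx ex.
have [a [y [ga gy E]]] : exists a y, [/\ gen [:: d] a, gen Y y & x = a * y].
  have nd a y : gen [:: d] a -> gen Y y -> gen Y (a * y * a^-1) /\ gen Y (a^-1 * y * a).
    pose N a := forall y, gen Y y -> gen Y (a * y * a^-1) /\ gen Y (a^-1 * y * a).
    move=> ga; move: y; apply: (gen_min (H := N)) ga => [|b].
      split=> [z gz|b1 b2 h1 h2 z gz|b h z gz].
      - by rewrite invg1 !mul1g !mulg1.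
      - split; first by have := (h1 _ (h2 z gz).1).1; rewrite invgM !mulgA.
        by have := (h2 _ (h1 z gz).2).2; rewrite invgM !mulgA.
      - by have [] := h z gz; rewrite invgK.
    rewrite inE => /eqP -> z gz; split.
      apply: (gen_min (H := fun z => gen Y (d * z * d^-1))) gz.
        have h : is_hom (fun z => d * z * d^-1).
          by move=> u v; rewrite !mulgA mulgVK.
        exact: (subgroup_preim h (gen_subgroup Y)).
      by move=> u /nY[].
    apply: (gen_min (H := fun z => gen Y (d^-1 * z * d))) gz.
      have h : is_hom (fun z => d^-1 * z * d).
        by move=> u v; rewrite !mulgA mulgK.
      exact: (subgroup_preim h (gen_subgroup Y)).
    by move=> u /nY[].
  have : gen (d :: Y) x by apply: gen_le gx.
  apply: (gen_min (H := fun x => exists a y, [/\ gen [:: d] a, gen Y y & x = a * y])).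
    split.
    - by exists 1, 1; split; rewrite ?mulg1 //; exact: Gen1.
    - move=> _ _ [a [y [ga gy ->]]] [b [z [gb gz ->]]].
      exists (a * b), (b^-1 * y * b * z); split; first exact: GenM.
        by apply: GenM => //; have [] := nd b y gb gy.
      by rewrite !mulgA mulgK.
    - move=> _ [a [y [ga gy ->]]]; exists a^-1, (a * y^-1 * a^-1); split.
      + exact: GenV.
      + by have [] := nd a y^-1 ga (GenV gy).
      + by rewrite invgM !mulgA mulVg mul1g.
  move=> u; rewrite inE => /predU1P[->|uY].
    exists d, 1; split; rewrite ?mulg1 //; last exact: Gen1.
    by apply: gen_in; rewrite inE.
  by exists 1, u; split; rewrite ?mul1g //; [exact: Gen1 | exact: gen_in].
have ey : e j y = 0%R.
  apply: (gen_min (H := fun y => e j y = 0%R)) gy => [|u /nY[] //].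
  split=> [|u v eu ev|u eu]; rewrite ?(ihom1 (eM j)) ?eM ?(ihomV (eM j)); lia.
suff a1 : a = 1 by rewrite E a1 mul1g.
apply: (ihom_cycle0 (eM j)) ga _ hd.
by move: ex; rewrite E eM ey; lia.
Qed.

(** One character is removed at a time, because a single character has a cyclic
   image: no certificate for the linear independence of several values of
   characters is needed. *)
Fixpoint chain (js : seq nat) (X T : seq G) : Prop :=
  if js is j :: js' then exists Y, step j X Y /\ chain js' Y T
  else forall x, x \in X -> gen T x.

Lemma chain_sound js X T x : chain js X T -> gen X x ->
  (forall j, j \in js -> e j x = 0%R) -> gen T x.
Proof.
elim: js X => [|j js IH] X /=; first by move=> XT gx _; exact: gen_le gx.
move=> [Y [st ch]] gx ex; apply: (IH Y) => //.
  by apply: step_sound st gx _; apply: ex; rewrite mem_head.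
by move=> i ijs; apply: ex; rewrite inE ijs orbT.
Qed.

Lemma subgroup_ker j D : subgroup D -> subgroup (fun x => D x /\ e j x = 0%R).
Proof.
move=> [D1 DM DV]; split=> [|x y [Dx ex] [Dy ey]|x [Dx ex]].
- by rewrite (ihom1 (eM j)).
- by split; [auto | rewrite eM ex ey].
- by split; [auto | rewrite (ihomV (eM j)) ex].
Qed.

(** Because quotients by kernels of integer characters are cyclic, finite
   generation of a common kernel propagates upwards to [D]; the certificate
   is built along the way. *)
Lemma chain_complete js D T : subgroup D ->
  (forall x, (D x /\ forall j, j \in js -> e j x = 0%R) <-> gen T x) ->
  exists X, (forall x, D x <-> gen X x) /\ chain js X T.
Proof.
elim: js D => [|j js IH] D subD hT.
  exists T; split; last by move=> x; exact: gen_in.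
  by move=> x; rewrite -hT; split=> [Dx|[]].
have [Y [hY chY]] : exists Y, (forall x, (D x /\ e j x = 0%R) <-> gen Y x) /\ chain js Y T.
  apply: IH => [|x]; first exact: subgroup_ker.
  rewrite -hT; split=> [[[Dx ex] h]|[Dx h]].
    by split=> // i; rewrite inE => /predU1P[->|/h].
  split; first by split=> //; apply: h; rewrite mem_head.
  by move=> i ijs; apply: h; rewrite inE ijs orbT.
have [d [Dd hd split_d]] := ihom_split (eM j) subD.
have [D1 DM DV] := subD.
have hX x : D x <-> gen (d :: Y) x.
  split=> [/split_d[a [z [ga Dz ez ->]]]|].
    apply: GenM; first by apply: gen_subset ga => u; rewrite !inE => ->.
    have /hY : D z /\ e j z = 0%R by [].
    by apply: gen_subset => u; rewrite inE orbC => ->.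
  apply: gen_min => // u; rewrite inE => /predU1P[->|/gen_in uY] //.
  by have [] : D u /\ e j u = 0%R by apply/hY.
exists (d :: Y); split=> //=; exists Y; split=> //.
exists d; split=> // [x|y /gen_in/hY[Dy ey]]; first exact: gen_in.
split=> //; apply/hY; split; rewrite ?eM ?(ihomV (eM j)) ?ey; auto; lia.
Qed.

(** ** Integral combinations of characters *)

Fixpoint lincomb (cs : seq int) (js : seq nat) (x : G) : int :=
  if js is j :: js' then (head 0 cs * e j x + lincomb (behead cs) js' x)%R else 0%R.

Lemma lincombM cs js : ihom (lincomb cs js).
Proof.
elim: js cs => [|j js IH] cs x y //=.
by rewrite eM IH; lia.
Qed.

Lemma lincomb_scale k cs js x :
  lincomb (map (fun c => k * c)%R cs) js x = (k * lincomb cs js x)%R.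
Proof.
elim: js cs => [|j js IH] cs /=; first lia.
case: cs => [|c cs] /=; last by rewrite IH; lia.
by have /= := IH [::]; lia.
Qed.

(** Over the rationals a vector outside a subspace is separated from it by a
   linear form; over the integers the alternative is that a multiple of the
   vector lies in the subgroup. *)
Lemma lincomb_separate js L v : subgroup L ->
  (exists m z, [/\ 0 < m, L z & forall j, j \in js -> e j (v ^+ m) = e j z]) \/
  (exists cs, (forall z, L z -> lincomb cs js z = 0%R) /\ lincomb cs js v <> 0%R).
Proof.
elim: js L v => [|j js IH] L v subL.
  by left; exists 1%N, 1; split=> //; have [] := subL.
have [L1 LM LV] := subL.
have [d [Ld hd split_d]] := ihom_split (eM j) subL.
have lin_split cs ks (a z : G) : lincomb cs ks d = 0%R -> gen [:: d] a ->
    lincomb cs ks (a * z) = lincomb cs ks z.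
  move=> d0 ga; rewrite (lincombM cs ks) (_ : lincomb cs ks a = 0%R) ?GRing.add0r //.
  apply: (gen_min (H := fun a => lincomb cs ks a = 0%R)) ga => [|u]; last first.
    by rewrite inE => /eqP ->.
  have cM := lincombM cs ks.
  by split=> [|x u hx hu|x hx]; rewrite ?(ihom1 cM) ?cM ?(ihomV cM); lia.
case: (pselect (e j d = 0%R)) => [ed|ed].
  have eL z : L z -> e j z = 0%R.
    move=> /split_d[a [y [ga _ ey ->]]]; rewrite eM ey.
    by have [i [k ->]] := gen_cycle ga; rewrite eM (ihomV (eM j)) !(ihomX (eM j)) ed; lia.
  case: (pselect (e j v = 0%R)) => [ev|ev].
    have [[m [z [m0 Lz h]]]|[cs [h1 h2]]] := IH L v subL.
      left; exists m, z; split=> // i; rewrite inE => /predU1P[->|/h //].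
      by rewrite (ihomX (eM j)) ev (eL _ Lz); lia.
    right; exists (0%R :: cs); split=> [z Lz|] /=; last lia.
    by rewrite h1 //; lia.
  right; exists [:: 1%R]; have l0 x : lincomb [::] js x = 0%R.
    by elim: (js) => //= i ks ->; lia.
  by split=> [z Lz|] /=; rewrite l0; [rewrite (eL z Lz)|]; lia.
have [d' [Ld' ed' sg sd']] : exists d', [/\ L d', e j d' <> 0%R, (e j v * e j d' <= 0)%R
    & forall cs ks, lincomb cs ks d' = lincomb cs ks d \/ lincomb cs ks d' = (- lincomb cs ks d)%R].
  case: (pselect (e j v * e j d <= 0)%R) => s.
    by exists d; split=> //; left.
  exists d^-1; split; first exact: LV.
  - by rewrite (ihomV (eM j)); lia.
  - by rewrite (ihomV (eM j)); nia.
  - by move=> cs ks; right; rewrite (ihomV (lincombM cs ks)).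
(* The combination [w] of [v] and [d'] is the one that the [j]-th character    *)
(* kills; the sign of [d'] makes both exponents natural numbers.               *)
pose a := `|e j d'|%N; pose b := `|e j v|%N.
have a0 : 0 < a by rewrite /a; lia.
pose w := v ^+ a * d' ^+ b.
have ew : e j w = 0%R.
  by rewrite /w eM !(ihomX (eM j)) /a /b; move: ed' sg; nia.
have [[m [z [m0 Lz h]]]|[cs [h1 h2]]] := IH _ w (subgroup_ker j subL).
  left; exists (a * m)%N, (z * (d' ^+ (b * m))^-1); split.
  - by rewrite muln_gt0 a0.
  - apply: LM; first by case: Lz.
    by apply: LV; exact: subgroup_exp.
  move=> i; rewrite eM (ihomV (eM i)) !(ihomX (eM i)) inE.
  case/predU1P=> [->|/h]; last by rewrite !(ihomX (eM i)) eM !(ihomX (eM i)); nia.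
  by case: Lz ew => _ ->; rewrite eM !(ihomX (eM j)); nia.
(* The coefficient of the [j]-th character is chosen to kill [d].              *)
right; pose k := lincomb cs js d.
pose cs' := (- k)%R :: map (fun c => e j d * c)%R cs.
have E x : lincomb cs' (j :: js) x = (e j d * lincomb cs js x - k * e j x)%R.
  by rewrite /= lincomb_scale; lia.
have d0 : lincomb cs' (j :: js) d = 0%R by rewrite E /k; lia.
exists cs'; split=> [z /split_d[u [y [gu Ly ey ->]]]|].
  by rewrite (lin_split _ _ _ _ d0 gu) E ey h1 //; lia.
have : lincomb cs' (j :: js) w <> 0%R by rewrite E ew; nia.
have d'0 : lincomb cs' (j :: js) d' = 0%R.
  by have [->|->] := sd' cs' (j :: js); rewrite d0.
have cM := lincombM cs' (j :: js).
by rewrite /w cM !(ihomX cM) d'0; move: a0; nia.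
Qed.

End Characters.

(** ** Subgroups cut out by characters modulo a subgroup *)

Section FiniteIndex.

Variables (G : groupType) (e : nat -> G -> int).
Hypothesis eM : forall j, ihom (e j).
Variables (js : seq nat) (L : G -> Prop).
Hypothesis subL : subgroup L.

Definition agrees_mod (y : G) := exists2 z, L z & forall j, j \in js -> e j y = e j z.

Let B := agrees_mod.

Lemma agrees_subgroup : subgroup B.
Proof.
have [L1 LM LV] := subL; split=> [|x y [u Lu hu] [v Lv hv]|x [u Lu hu]].
- by exists 1.
- by exists (u * v) => [|j jjs]; [auto | rewrite !eM hu ?hv].
- by exists u^-1 => [|j jjs]; [auto | rewrite !(ihomV (eM j)) hu].
Qed.

Lemma agrees_ext y y' : (forall j, e j y = e j y') -> B y -> B y'.
Proof. by move=> h [z Lz hz]; exists z => // j /hz; rewrite h. Qed.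

(** Membership in [B] depends on the values of the characters only, so modulo
   [B] the group is commutative: every element is a product of powers of the
   generators, with exponents that matter only modulo the orders. *)
Lemma finite_reps X : (forall x, x \in X -> exists2 m, 0 < m & B (x ^+ m)) ->
  exists E : seq G, (forall u, u \in E -> gen X u) /\
    forall y, gen X y -> exists2 u, u \in E & B (y * u^-1).
Proof.
have [B1 BM BV] := agrees_subgroup.
elim: X => [|x X IH] hX.
  exists [:: 1]; split=> [u|y /gen_nil ->]; first by rewrite inE => /eqP ->; exact: Gen1.
  by exists 1; rewrite ?inE ?mulgV.
have [|E [EX hE]] := IH; first by move=> z zX; apply: hX; rewrite inE zX orbT.
have [m m0 Bm] := hX x (mem_head _ _).
have subX : {subset X <= x :: X} by move=> z zX; rewrite inE zX orbT.
exists [seq x ^+ k * u | k <- iota 0 m, u <- E]; split.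
  move=> _ /allpairsP[[k u] /= [_ uE ->]]; apply: GenM.
    by apply: subgroup_exp; [exact: gen_subgroup | exact/gen_in/mem_head].
  exact: gen_subset subX _ (EX u uE).
pose Q y := exists k u, u \in E /\ B (y * (x ^+ k * u)^-1).
move=> y gy; suff [k [u [uE h]]] : Q y.
  exists (x ^+ (k %% m) * u).
    by apply: allpairs_f => //; rewrite mem_iota /= add0n ltn_mod.
  have Bq := subgroup_exp (k %/ m) agrees_subgroup Bm.
  apply: agrees_ext (BM _ _ h Bq) => j.
  rewrite !(eM, ihomV (eM j), ihomX (eM j)) {1}(divn_eq k m).
  by rewrite PoszD PoszM; ring.
move: y gy; apply: gen_min; last first.
  move=> z; rewrite inE => /predU1P[->|zX].
    have [u uE h] := hE 1 (Gen1 _); exists 1%N, u; split=> //.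
    apply: agrees_ext h => j.
    by rewrite !(eM, ihomV (eM j), ihomX (eM j)) (ihom1 (eM j)); lia.
  have [u uE h] := hE z (gen_in zX); exists 0%N, u; split=> //.
  by rewrite expg0 mul1g.
split.
- by have [u uE h] := hE 1 (Gen1 _); exists 0%N, u; rewrite expg0 (mul1g u).
- move=> y z [k [u [uE hu]]] [l [v [vE hv]]].
  have [w wE hw] := hE _ (GenM (EX u uE) (EX v vE)).
  exists (k + l)%N, w; split=> //.
  apply: agrees_ext (BM _ _ (BM _ _ hu hv) hw) => j.
  by rewrite !(eM, ihomV (eM j), ihomX (eM j)) PoszD; ring.
- move=> y [k [u [uE hu]]].
  have [w wE hw] := hE _ (GenV (EX u uE)).
  (* Modulo [m], multiplication by [m.-1] is negation.                         *)
  exists (k * m.-1)%N, w; split=> //.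
  have Bq := subgroup_exp k agrees_subgroup Bm.
  apply: agrees_ext (BM _ _ (BM _ _ (BV _ hu) hw) (BV _ Bq)) => j.
  rewrite !(eM, ihomV (eM j), ihomX (eM j)) -{1}(prednK m0) -addn1 !PoszM PoszD.
  by ring.
Qed.

Lemma agrees_fg X : (forall x, x \in X -> exists2 m, 0 < m & B (x ^+ m)) ->
  finitely_generated (fun y => gen X y /\ B y).
Proof.
move=> hX; have [E [EX hE]] := finite_reps hX.
have [B1 BM BV] := agrees_subgroup.
have gV y u : gen X y -> u \in E -> B (y * u^-1) -> gen X (y * u^-1) /\ B (y * u^-1).
  by move=> gy /EX gu; split=> //; apply: GenM => //; exact: GenV.
apply: (schreier_fg (E := E) (L := X ++ map inv X)).
- split=> [|x y [gx Bx] [gy By]|x [gx Bx]]; split; auto; try exact: Gen1.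
    exact: GenM.
  exact: GenV.
- have [u uE] := hE 1 (Gen1 _); rewrite mul1g => /BV; rewrite invgK => Bu.
  by exists u => //; split; auto.
move=> y [/gen_letters[s [sX yE]] _]; exists s; split=> //.
  move=> z /sX /orP[zX|zX]; rewrite mem_cat ?zX //.
  by rewrite -[z]invgK map_f ?orbT.
move=> i; have gp : gen X (\prod_(z <- take i s) z).
  apply/gen_letters; exists (take i s); split=> // z /mem_take; exact: sX.
by have [u uE h] := hE _ gp; exists u => //; auto.
Qed.

End FiniteIndex.

(** * Folded graphs with labels in a central extension *)

(** A letter is a signed generator: [l.*2] is a generator and [l.*2.+1] its
   inverse. *)
Definition negl (l : nat) := if odd l then l.-1 else l.+1.

Lemma neglK : involutive negl.
Proof. by move=> l; rewrite /negl; case o: (odd l) => /=; rewrite ?o //; case: l o => //= l /negbTE ->. Qed.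

Lemma negl_half l : (negl l)./2 = l./2.
Proof. by rewrite /negl; case o: (odd l); lia. Qed.

Lemma odd_negl l : odd (negl l) = ~~ odd l.
Proof. by rewrite /negl; case o: (odd l); lia. Qed.

Lemma negl_lt n l : l < n.*2 -> negl l < n.*2.
Proof. by rewrite /negl; case o: (odd l); lia. Qed.

Definition reduced (w : seq nat) := sorted (fun a b => b != negl a) w.

Definition invw (w : seq nat) := rev (map negl w).

Lemma invwK : involutive invw.
Proof.
by move=> w; rewrite /invw map_rev revK -map_comp map_id_in // => l _; exact: neglK.
Qed.

Lemma invw_cons l w : invw (l :: w) = rcons (invw w) (negl l).
Proof. by rewrite /invw /= rev_cons. Qed.

Lemma invw_rcons w l : invw (rcons w l) = negl l :: invw w.
Proof. by rewrite /invw map_rcons rev_rcons. Qed.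

Lemma reduced_invw w : reduced w -> reduced (invw w).
Proof.
move=> rw; rewrite /invw /reduced -map_rev sorted_map rev_sorted.
apply: sub_sorted rw => a b /=; rewrite /relpre /=; apply: contra => /eqP ->.
by rewrite neglK.
Qed.

Lemma all_invw n w : all (gtn n.*2) w -> all (gtn n.*2) (invw w).
Proof.
rewrite /invw all_rev all_map => /allP h; apply/allP => l /h /= ll.
exact: negl_lt.
Qed.

Lemma reduced_tail a w : reduced (a :: w) -> reduced w.
Proof. exact: path_sorted. Qed.

Section Extension.

Variables (E F : groupType) (pi : E -> F) (n : nat) (xl : nat -> F)
  (e : nat -> E -> int) (js : seq nat).

Definition evw (w : seq nat) := \prod_(l <- w) xl l.

Hypothesis piM : is_hom pi.
Hypothesis central : forall a b, pi a = 1 -> commute a b.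
Hypothesis eM : forall j, ihom (e j).
Hypothesis ker_inj : forall a, pi a = 1 -> (forall j, j \in js -> e j a = 0%R) -> a = 1.
Hypothesis pi_surj : forall f, exists a, pi a = f.
Hypothesis xl_negl : forall l, xl (negl l) = (xl l)^-1.
Hypothesis reduced_inj : forall w w', all (gtn n.*2) w -> all (gtn n.*2) w' ->
  reduced w -> reduced w' -> evw w = evw w' -> w = w'.
Hypothesis ev_surj : forall f, exists2 w, all (gtn n.*2) w & evw w = f.

Lemma evw_cat w w' : evw (w ++ w') = evw w * evw w'.
Proof. by rewrite /evw big_cat. Qed.

Lemma evw_nil : evw [::] = 1.
Proof. by rewrite /evw big_nil. Qed.

Lemma evw_cons l w : evw (l :: w) = xl l * evw w.
Proof. by rewrite /evw big_cons. Qed.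

Lemma evw_rcons w l : evw (rcons w l) = evw w * xl l.
Proof. by rewrite -cats1 evw_cat evw_cons evw_nil mulg1. Qed.

Lemma evw_inv w : evw (invw w) = (evw w)^-1.
Proof.
rewrite /invw; elim: w => [|l w IH]; first by rewrite evw_nil invg1.
by rewrite /= rev_cons evw_rcons IH xl_negl evw_cons invgM.
Qed.

Let subker : subgroup (fun a => pi a = 1).
Proof.
by split=> [|x y hx hy|x hx]; rewrite ?(hom1 piM) ?piM ?(homV piM) ?hx ?hy ?mulg1 ?invg1.
Qed.

(** ** Walks *)

Definition edge := (nat * nat * nat * E)%type.
Definition esrc (a : edge) : nat := a.1.1.1.
Definition elet (a : edge) : nat := a.1.1.2.
Definition etgt (a : edge) : nat := a.1.2.
Definition elab (a : edge) : E := a.2.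

Fixpoint walk (p : nat) (s : seq edge) (q : nat) :=
  if s is a :: s' then (esrc a == p) && walk (etgt a) s' q else p == q.

Definition labs (s : seq edge) := \prod_(a <- map elab s) a.

Lemma labs_nil : labs [::] = 1. Proof. by rewrite /labs big_nil. Qed.
Lemma labs_cons a s : labs (a :: s) = elab a * labs s.
Proof. by rewrite /labs big_cons. Qed.
Lemma labs_cat s t : labs (s ++ t) = labs s * labs t.
Proof. by rewrite /labs map_cat big_cat. Qed.

Lemma walk_cat p s q t r : walk p s q -> walk q t r -> walk p (s ++ t) r.
Proof.
elim: s p => [|a s IH] p /=; first by move/eqP->.
by case/andP=> -> /IH h /h.
Qed.

(** A Stallings graph whose edges carry, besides a letter, an element of the
   central extension above that letter. Backtracking is the only way to read a
   letter and its inverse in succession, which is determinism in both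
   directions, and it costs an element of the central subgroup generated by [K]. *)
Definition graph_ok (Gm : seq edge) (K : seq E) :=
  (forall a, a \in Gm -> elet a < n.*2 /\ pi (elab a) = xl (elet a)) /\
  (forall a, a \in Gm -> forall b, b \in Gm ->
     etgt a = esrc b -> elet b = negl (elet a) ->
     etgt b = esrc a /\ gen K (elab a * elab b)) /\
  (forall z, z \in K -> pi z = 1).

Definition reads (Gm : seq edge) (K : seq E) (h : E) :=
  exists s, [/\ forall a, a \in s -> a \in Gm, walk 0 s 0 & gen K (h * (labs s)^-1)].

Definition graph_cert (R : seq E) (Gm : seq edge) (K : seq E) :=
  graph_ok Gm K /\ (forall z, z \in K -> gen R z) /\
  (forall h, h \in R -> reads Gm K h /\ reads Gm K h^-1).

Section Sound.

Variables (Gm : seq edge) (K : seq E).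
Hypothesis ok : graph_ok Gm K.

Lemma genK_ker z : gen K z -> pi z = 1.
Proof. by move=> gz; apply: (gen_min subker) gz; case: ok => _ []. Qed.

Lemma genK_comm z a : gen K z -> z * a = a * z.
Proof. by move=> /genK_ker /central; apply. Qed.

Lemma pi_labs s : {subset s <= Gm} -> pi (labs s) = evw (map elet s).
Proof.
case: ok => h _; elim: s => [|a s IH] sG; first by rewrite labs_nil evw_nil (hom1 piM).
rewrite labs_cons piM /= evw_cons IH; last by move=> b bs; apply: sG; rewrite inE bs orbT.
by have [_ ->] := h a (sG a (mem_head _ _)).
Qed.

Lemma lets_lt s : {subset s <= Gm} -> all (gtn n.*2) (map elet s).
Proof.
case: ok => h _ sG; apply/allP => _ /mapP[a /sG /h[la _] ->]; exact: la.
Qed.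

(** Backtracking steps can be cancelled, because backtracking returns to the
   same vertex and changes the label by an element of the central part only. *)
Lemma walk_reduce p s q : {subset s <= Gm} -> walk p s q ->
  exists t, [/\ {subset t <= Gm}, walk p t q, reduced (map elet t) &
    gen K (labs s * (labs t)^-1)].
Proof.
have [_ [okb okc]] := ok.
elim: s p => [|a s IH] p sG /=.
  by move=> pq; exists [::]; split; rewrite // mulgV; exact: Gen1.
case/andP=> /eqP <- ws.
have [t [tG wt rt gt]] := IH _ (fun b bs => sG b (@mem_behead _ (a :: s) b bs)) ws.
have aG : a \in Gm by apply: sG; rewrite mem_head.
have step : gen K (labs (a :: s) * (labs (a :: t))^-1).
  by rewrite !labs_cons invgM mulgA -(mulgA (elab a)) -(genK_comm _ gt) mulgK.
case: t tG wt rt gt step => [|b t] tG wt rt gt step.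
  by exists [:: a]; split=> // [b|/=]; [rewrite inE => /eqP -> | rewrite eqxx].
case: (altP (elet b =P negl (elet a))) => [bb|nb]; last first.
  exists (a :: b :: t); split=> //=; last by rewrite nb.
    by move=> c; rewrite inE => /predU1P[->|/tG].
  by rewrite eqxx.
have bG : b \in Gm by apply: tG; rewrite mem_head.
move: wt => /= /andP[/eqP tb wt].
have [ba gab] := okb a aG b bG (esym tb) bb.
exists t; split.
- by move=> c ct; apply: tG; rewrite inE ct orbT.
- by rewrite -ba.
- by move: rt; rewrite /reduced /=; exact: path_sorted.
have labE : labs (a :: b :: t) = elab a * elab b * labs t by rewrite !labs_cons mulgA.
by have := GenM step gab; rewrite labE invgM [X in X * _]mulgA mulgVK.
Qed.

Lemma reads_mul g h : reads Gm K g -> reads Gm K h -> reads Gm K (g * h).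
Proof.
move=> [s [sG ws gs]] [t [tG wt gt]]; exists (s ++ t); split.
- by move=> a; rewrite mem_cat => /orP[/sG|/tG].
- exact: walk_cat ws wt.
rewrite labs_cat invgM mulgA -(mulgA g) -(genK_comm g gt) -mulgA.
exact: GenM gt gs.
Qed.

Lemma reads_reduced h : reads Gm K h -> exists s,
  [/\ {subset s <= Gm}, walk 0 s 0, reduced (map elet s) & gen K (h * (labs s)^-1)].
Proof.
move=> [s [sG ws gs]]; have [t [tG wt rt gt]] := walk_reduce sG ws.
by exists t; split=> //; have := GenM gs gt; rewrite mulgA mulgVK.
Qed.

Lemma reads_pi h s : {subset s <= Gm} -> gen K (h * (labs s)^-1) ->
  pi h = evw (map elet s).
Proof.
move=> sG /genK_ker; rewrite piM (homV piM) -(pi_labs sG) => h1.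
by rewrite -[pi h](mulgVK (pi (labs s))) h1 mul1g.
Qed.

(** This is what the graph is for: it bounds the central elements of the subgroup
   from above, by a finite list. A closed walk that reads an element of the
   kernel can be reduced, and then it is empty. *)
Lemma reads_ker h : reads Gm K h -> pi h = 1 -> gen K h.
Proof.
move=> /reads_reduced[s [sG ws rs gs]] h1.
have s0 : map elet s = [::].
  apply: reduced_inj => //; first exact: lets_lt.
  by rewrite evw_nil -h1 (reads_pi sG gs).
by move: gs; case: (s) s0 => // _; rewrite labs_nil invg1 mulg1.
Qed.

End Sound.

Lemma cert_reads R Gm K h : graph_cert R Gm K -> gen R h -> reads Gm K h.
Proof.
move=> [ok [KR rR]] /gen_letters[s [sR ->]].
elim: s sR => [|a s IH] sR.
  by exists [::]; rewrite big_nil labs_nil mulgV; split=> //; exact: Gen1.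
rewrite big_cons; apply: (reads_mul ok); last first.
  by apply: IH => b bs; apply: sR; rewrite inE bs orbT.
have /orP[/rR[]//|/rR[_]] := sR a (mem_head _ _).
by rewrite invgK.
Qed.


(** ** The graph of a finitely generated subgroup *)

Lemma list_choice (S : eqType) (T : eqType) (P : S -> T -> Prop) (C : seq S) :
  (forall c, c \in C -> exists t, P c t) ->
  exists A : seq (S * T), (forall a, a \in A -> a.1 \in C /\ P a.1 a.2) /\
    forall c, c \in C -> exists t, (c, t) \in A.
Proof.
elim: C => [|c C IH] h; first by exists [::].
have [|A [AP CA]] := IH; first by move=> d dC; apply: h; rewrite inE dC orbT.
have [t Pct] := h c (mem_head _ _).
exists ((c, t) :: A); split=> [a|d]; rewrite inE.
  case/predU1P=> [->|/AP[aC Pa]]; split=> //; first exact: mem_head.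
  by rewrite aC orbT.
case/predU1P=> [->|/CA[u uA]]; first by exists t; rewrite mem_head.
by exists u; rewrite inE uA orbT.
Qed.

(** The converse of soundness, which is not part of the certificate but holds for
   the graph that is built: closed walks at 0 read elements of the subgroup. *)
Definition exact_graph (R : seq E) (Gm : seq edge) := forall p s t,
  {subset s <= Gm} -> {subset t <= Gm} -> walk 0 s p -> walk 0 t p ->
  gen R (labs s * (labs t)^-1).

Definition inverse_closed (Gm : seq edge) := forall a, a \in Gm ->
  exists b, [/\ b \in Gm, esrc b = etgt a, etgt b = esrc a & elet b = negl (elet a)].

Definition pi_image (R : seq E) (f : F) := exists2 h, gen R h & pi h = f.

Lemma pi_image_subgroup R : subgroup (pi_image R).
Proof. exact (subgroup_image piM (gen_subgroup R)). Qed.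

(** Central subgroups embed into a free abelian group through the characters, so
   the chain of kernels down to the trivial group gives generators. *)
Lemma kernel_generators (D : E -> Prop) : subgroup D ->
  exists K : seq E, forall x, (D x /\ pi x = 1) <-> gen K x.
Proof.
move=> [D1 DM DV]; have [k1 kM kV] := subker.
have [| |K [hK _]] := chain_complete eM (js := js) (T := [::]) (D := fun x => D x /\ pi x = 1).
- split=> [|x y [? ?] [? ?]|x [? ?]]; split; auto.
- move=> x; split=> [[[_ px] h]|/gen_nil ->].
    by rewrite (ker_inj px h); exact: Gen1.
  by split=> // j _; exact: ihom1.
- by exists K.
Qed.

(** The vertices are the cosets, modulo the image of the subgroup, of the
   prefixes of words for the generators: a finite piece of the Schreier graph,
   which is deterministic without any folding. *)
Theorem graph_exists R : exists Gm K,
  [/\ graph_cert R Gm K, exact_graph R Gm & inverse_closed Gm].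
Proof.
pose M := pi_image R; have [M1 MM MV] := pi_image_subgroup R.
have [H1 HM HV] := gen_subgroup R.
have [K hK] := kernel_generators (gen_subgroup R).
have [W [Wlt WR]] : exists W : seq (seq nat), (forall w, w \in W -> all (gtn n.*2) w) /\
    forall h, (h \in R) || (h^-1 \in R) -> exists2 w, w \in W & evw w = pi h.
  have [A [AP RA]] := list_choice (C := R ++ map inv R)
    (P := fun h w => all (gtn n.*2) w /\ evw w = pi h)
    (fun h _ => let: ex_intro2 w a b := ev_surj (pi h) in ex_intro _ w (conj a b)).
  exists (map snd A); split=> [_ /mapP[[h w] /AP[_ []] /= ? _ ->] //|h hR].
  have [|w wA] := RA h.
    rewrite mem_cat; case/orP: hR => [->//|hR].
    by rewrite -[h]invgK map_f ?orbT.
  by exists w; [exact: (map_f snd wA) | have [_ []] := AP _ wA].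
pose V0 := [seq evw (take i w) | w <- W, i <- iota 0 (\max_(w <- W) size w).+1].
have [V1 hV1] : exists V1, map pi V1 = V0.
  elim: V0 => [|f V0 [V1 <-]]; first by exists [::].
  by have [a <-] := pi_surj f; exists (a :: V1).
pose V := 1 :: V1.
(* The number of a vertex is the position of the first element of [V] in its   *)
(* coset; it is [size V] outside the graph.                                    *)
pose near f v := `[< M (f * (pi v)^-1) >].
pose vid f := find (near f) V.
pose rp p := nth 1 V p.
have vid_eq f f' : M (f * f'^-1) -> vid f = vid f'.
  move=> h; apply: eq_find => v; apply/asboolP/asboolP => h'.
    rewrite (_ : _ * _ = (f * f'^-1)^-1 * (f * (pi v)^-1)); first exact: MM (MV _ h) h'.
    by rewrite invgM invgK !mulgA mulgVK.
  rewrite (_ : _ * _ = (f * f'^-1) * (f' * (pi v)^-1)); first exact: MM h h'.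
  by rewrite !mulgA mulgVK.
have vid_lt f v : v \in V -> M (f * (pi v)^-1) -> vid f < size V.
  by move=> vV h; rewrite -has_find; apply/hasP; exists v => //; apply/asboolP.
have vid_near f : vid f < size V -> M (f * (pi (rp (vid f)))^-1).
  by rewrite -has_find => /(nth_find 1)/asboolP.
have vid_rp f : vid f < size V -> vid (pi (rp (vid f))) = vid f.
  by move=> h; apply/esym/vid_eq/vid_near.
have vid0 f : M f -> vid f = 0%N.
  move=> Mf; have near1 : near f 1.
    by apply/asboolP; rewrite (hom1 piM) invg1 mulg1.
  by rewrite /vid /= near1.
have rp_in p : p < size V -> rp p \in V by move=> h; exact: mem_nth.
(* [C] lists the edges without their labels; a label is chosen for each of     *)
(* them so that the closed walks at 0 have labels in the subgroup.             *)
pose C := [seq c <- [seq (vid (pi v), l, vid (pi v * xl l)) | v <- V, l <- iota 0 n.*2]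
             | c.2 < size V].
pose P (c : nat * nat * nat) (lam : E) :=
  [/\ c.1.1 < size V, c.1.2 < n.*2, c.2 < size V,
      vid (pi (rp c.1.1)) = c.1.1 /\ vid (pi (rp c.2)) = c.2 &
      pi lam = xl c.1.2 /\ gen R (rp c.1.1 * lam * (rp c.2)^-1)].
have inC f l : l < n.*2 -> vid f < size V -> vid (f * xl l) < size V ->
    (vid f, l, vid (f * xl l)) \in C.
  move=> ll lf lfl; rewrite mem_filter; apply/andP; split=> //.
  apply/allpairsPdep; exists (rp (vid f)), l; split; first exact: rp_in.
    by rewrite mem_iota.
  rewrite /= vid_rp //; congr (_, _, _); apply: vid_eq.
  rewrite invgM !mulgA mulgK; exact: vid_near.
have [Gm [GP CG]] : exists Gm : seq edge, (forall a, a \in Gm -> a.1 \in C /\ P a.1 a.2) /\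
    forall c, c \in C -> exists t, (c, t) \in Gm.
  apply: list_choice => c; rewrite mem_filter => /andP[lc /allpairsPdep[v [l [vV ll cE]]]].
  move: lc; rewrite {}cE /= => lc.
  have lv : vid (pi v) < size V by apply: (vid_lt _ v) => //; rewrite mulgV.
  have [h gh ph] : M (pi (rp (vid (pi v))) * xl l * (pi (rp (vid (pi v * xl l))))^-1).
    rewrite (_ : _ * _ = (pi v * (pi (rp (vid (pi v))))^-1)^-1 *
       (pi v * xl l * (pi (rp (vid (pi v * xl l))))^-1)).
      by apply: MM; [apply/MV/vid_near | exact: vid_near].
    by rewrite invgM invgK !mulgA mulgVK.
  exists ((rp (vid (pi v)))^-1 * h * rp (vid (pi v * xl l))); split=> //=.
  - by move: ll; rewrite mem_iota.
  - by split; apply: vid_rp.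
  - split; last by rewrite !mulgA mulgV mul1g mulgK.
    by rewrite !piM (homV piM) ph !mulgA mulVg mul1g mulgVK.
have walkR p s q : {subset s <= Gm} -> walk p s q -> gen R (rp p * labs s * (rp q)^-1).
  elim: s p => [|a s IH] p sG /=; first by move/eqP->; rewrite labs_nil mulg1 mulgV.
  case/andP=> /eqP <- /IH h.
  have [_ [_ _ _ _ [_ ga]]] := GP a (sG a (mem_head _ _)).
  have := GenM ga (h (fun b bs => sG b (@mem_behead _ (a :: s) b bs))).
  by rewrite labs_cons !mulgA mulgVK.
have labR s : {subset s <= Gm} -> walk 0 s 0 -> gen R (labs s).
  by move=> sG /(walkR _ _ _ sG); rewrite /rp /= mul1g invg1 mulg1.
have ok : graph_ok Gm K.
  split=> [a /GP[_ [_ la _ _ [pa _]]] //|]; split; last first.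
    by move=> z /gen_in/hK[].
  move=> a /GP[_ [p1 _ _ [vp _] [pa ga]]] b /GP[_ [_ _ _ [_ vq] [pb gb]]] tb lb.
  have := GenM ga gb; rewrite -/(esrc b) -tb !mulgA mulgVK => gab.
  have pab : pi (elab a * elab b) = 1.
    by rewrite piM pa pb -/(elet b) lb xl_negl mulgV.
  have pE : esrc a = etgt b.
    rewrite /esrc -vp /etgt -vq; apply: vid_eq.
    eexists; first exact: gab.
    by rewrite -(mulgA (rp _)) !piM -(piM a.2) pab mulg1 (homV piM).
  split=> //; apply/hK; split=> //.
  move: gab; rewrite -/(etgt b) -pE -(mulgA (rp _)) -(central _ pab).
  by rewrite mulgK.
have readw w f : all (gtn n.*2) w -> (forall i, vid (f * evw (take i w)) < size V) ->
    exists s, [/\ {subset s <= Gm}, walk (vid f) s (vid (f * evw w)) & map elet s = w].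
  elim: w f => [|l w IH] f; first by exists [::]; rewrite /= evw_nil mulg1.
  case/andP=> ll wl h.
  have [|s [sG ws es]] := IH (f * xl l) wl.
    by move=> i; have := h i.+1; rewrite /= evw_cons mulgA.
  have [||lam aG] := CG _ (inC f l ll _ _).
  - by have := h 0%N; rewrite take0 evw_nil mulg1.
  - by have := h 1%N; rewrite /= take0 evw_cons evw_nil mulg1.
  exists ((vid f, l, vid (f * xl l), lam) :: s); split.
  - by move=> b; rewrite inE => /predU1P[->|/sG].
  - by rewrite /= /esrc /etgt /= eqxx evw_cons mulgA.
  - by rewrite /= es.
have readR h : (h \in R) || (h^-1 \in R) -> reads Gm K h.
  move=> hR; have [w wW ew] := WR h hR.
  have gh : gen R h.
    case/orP: hR => [/gen_in //|/gen_in/GenV]; by rewrite invgK.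
  have [|s [sG ws es]] := readw w 1 (Wlt w wW).
    move=> i; rewrite mul1g.
    have : evw (take i w) \in map pi V1.
      rewrite hV1; wlog le : i / i <= size w.
        case: (leqP i (size w)) => [le|/ltnW lt]; first exact.
        by rewrite take_oversize //; move/(_ (size w) (leqnn _)); rewrite take_size.
      apply/allpairsPdep; exists w, i; split=> //.
      rewrite mem_iota add0n ltnS; apply: leq_trans le _.
      exact: leq_bigmax_seq.
    case/mapP=> v vV ->; apply: (vid_lt _ v); rewrite ?mulgV //.
    by rewrite inE vV orbT.
  have ws0 : walk 0 s 0.
    by move: ws; rewrite mul1g ew !vid0 //; exists h.
  exists s; split=> //; apply/hK; split.
    apply: GenM => //; apply: GenV; exact: labR.
  by rewrite piM (homV piM) (pi_labs ok sG) es ew mulgV.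
exists Gm, K; split.
- split=> //; split; first by move=> z /gen_in/hK[].
  by move=> h hR; split; apply: readR; rewrite ?invgK hR ?orbT.
- move=> p s t sG tG /(walkR _ _ _ sG) hs /(walkR _ _ _ tG) ht.
  have := GenM hs (GenV ht); rewrite /rp /= !mul1g !invgM invgK.
  by rewrite !mulgA mulgVK.
- move=> a /GP[_ [p1 la p2 [vp vq] [pa ga]]].
  have vid2 : vid (pi (rp a.1.2) * xl (negl a.1.1.2)) = a.1.1.1.
    rewrite -[RHS]vp; apply: vid_eq; have := MV _ (ex_intro2 _ _ _ ga (erefl _)).
    by rewrite !piM (homV piM) pa !invgM invgK xl_negl !mulgA.
  have [||lam bG] := CG _ (inC (pi (rp a.1.2)) (negl a.1.1.2) (negl_lt la) _ _).
  - by rewrite vq.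
  - by rewrite vid2.
  by eexists; split; first exact: bG; rewrite /esrc /etgt /elet /=.
Qed.


(** ** Fibre products *)

Definition fibre (R S : seq E) (z : E * E) :=
  [/\ gen R z.1, gen S z.2 & pi z.1 = pi z.2].

Lemma fibre_subgroup R S : subgroup (fibre R S).
Proof.
split=> [|x y [x1 x2 x3] [y1 y2 y3]|x [x1 x2 x3]].
- by split; [exact: Gen1 | exact: Gen1 |].
- by split; [exact: GenM | exact: GenM | rewrite !piM x3 y3].
- by split; [exact: GenV | exact: GenV | rewrite !(homV piM) x3].
Qed.

(** A certificate that [Del] generates the fibre product. The list [Th] holds
   elements whose components label synchronized walks to a pair of vertices;
   closure under synchronized steps, up to the subgroup of [Del], is what an
   induction along two such walks needs. *)
Definition pair_cert (GR : seq edge) (KR : seq E) (GS : seq edge) (KS : seq E)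
    (Del : seq (E * E)) :=
  exists Th : seq (nat * nat * (E * E)),
  (exists t, t \in Th /\ t.1 == (0, 0)%N) /\
  (forall t, t \in Th -> t.1 == (0, 0)%N -> gen Del t.2) /\
  (forall t, t \in Th -> forall a, a \in GR -> forall b, b \in GS ->
    [&& esrc a == t.1.1, esrc b == t.1.2 & elet a == elet b] ->
    exists t', [/\ t' \in Th, t'.1 == (etgt a, etgt b) &
      gen Del (t.2 * (elab a, elab b) * t'.2^-1)]) /\
  (forall z, z \in KR -> gen Del (z, 1)) /\
  (forall z, z \in KS -> gen Del (1, z)).

Lemma is_hom_left : is_hom (fun z : E => (z, 1 : E)).
Proof. by move=> x y; rewrite -[RHS]/(_, _) /= mulg1. Qed.

Lemma is_hom_right : is_hom (fun z : E => (1 : E, z)).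
Proof. by move=> x y; rewrite -[RHS]/(_, _) /= mulg1. Qed.

Lemma is_hom_diag : is_hom (fun z : E => (z, z)).
Proof. by []. Qed.

(** Reduced words for the two components of an element of the fibre product
   are equal, so they can be read synchronously. *)
Lemma pair_sound R S GR KR GS KS Del z :
  graph_cert R GR KR -> graph_cert S GS KS -> pair_cert GR KR GS KS Del ->
  fibre R S z -> gen Del z.
Proof.
move=> cR cS [Th [[t0 [t0T t00]] [zero [next [DR DS]]]]] [gR gS hpi].
have [okR _] := cR; have [okS _] := cS.
have [s [sG ws rs gs]] := reads_reduced okR (cert_reads cR gR).
have [t [tG wt rt gt]] := reads_reduced okS (cert_reads cS gS).
have est : map elet s = map elet t.
  apply: reduced_inj => //; [exact: (lets_lt okR)|exact: (lets_lt okS)|].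
  by rewrite -(reads_pi okR sG gs) -(reads_pi okS tG gt).
have key p q p' q' u : u \in Th -> u.1 = (p, q) -> walk p s p' -> walk q t q' ->
    exists v, [/\ v \in Th, v.1 = (p', q') & gen Del (u.2 * (labs s, labs t) * v.2^-1)].
  clear rs rt ws wt gs gt.
  elim: s t sG tG est p q u => [|a s IH] [|b t] //= sG tG.
    move=> _ p q u uT u1 /eqP <- /eqP <-; exists u; split=> //.
    by rewrite !labs_nil mulg1 mulgV; exact: Gen1.
  move=> [eab est] p q u uT u1 /andP[/eqP pa ws] /andP[/eqP qb wt].
  have aG : a \in GR by apply: sG; rewrite mem_head.
  have bG : b \in GS by apply: tG; rewrite mem_head.
  have [|u' [u'T /eqP u'1 gu]] := next u uT a aG b bG.
    by rewrite u1 pa qb eab !eqxx.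
  have [||v [vT v1 gv]] := IH t _ _ est _ _ u' u'T u'1 ws wt.
  - by move=> c cs; apply: sG; rewrite inE cs orbT.
  - by move=> c cs; apply: tG; rewrite inE cs orbT.
  exists v; split=> //; have := GenM gu gv.
  by rewrite !mulgA mulgVK -(mulgA u.2) !labs_cons.
have [v [vT v1 gv]] := key _ _ _ _ _ t0T (eqP t00) ws wt.
have gst : gen Del (labs s, labs t).
  have := GenM (GenM (GenV (zero _ t0T t00)) gv) (zero _ vT (introT eqP v1)).
  by rewrite !mulgA mulVg mul1g mulgVK.
have gl x : gen KR x -> gen Del (x, 1).
  move=> gx; apply: (gen_min (H := fun x => gen Del (x, 1))) gx => [|y yK]; last exact: DR.
  exact: (subgroup_preim is_hom_left (gen_subgroup Del)).
have gr x : gen KS x -> gen Del (1, x).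
  move=> gx; apply: (gen_min (H := fun x => gen Del (1, x))) gx => [|y yK]; last exact: DS.
  exact: (subgroup_preim is_hom_right (gen_subgroup Del)).
have := GenM (GenM (gl _ gs) (gr _ gt)) gst.
rewrite (_ : _ * _ = z) //; case: (z) => x y /=.
rewrite -[LHS]/(_, _) /=; congr (_, _).
  by rewrite mulg1 mulgVK.
by rewrite mul1g mulgVK.
Qed.

Lemma walk_end G p s q : {subset s <= G} -> walk p s q -> q \in p :: map etgt G.
Proof.
elim: s p => [|a s IH] p sG /=; first by move/eqP->; rewrite mem_head.
case/andP=> _ /IH h; have /h : {subset s <= G}.
  by move=> b bs; apply: sG; rewrite inE bs orbT.
rewrite !inE => /predU1P[->|->]; last by rewrite orbT.
by rewrite map_f ?orbT //; apply: sG; rewrite mem_head.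
Qed.

Lemma walk_rcons p s a q : walk p s q -> esrc a = q -> walk p (rcons s a) (etgt a).
Proof.
by move=> ws aq; rewrite -cats1; apply: walk_cat ws _; rewrite /= aq !eqxx.
Qed.

Lemma subset_rcons (G : seq edge) s a :
  {subset s <= G} -> a \in G -> {subset rcons s a <= G}.
Proof. by move=> sG aG b; rewrite mem_rcons inE => /predU1P[->|/sG]. Qed.

Section PairExists.

Variables (R S : seq E) (GR : seq edge) (KR : seq E) (GS : seq edge) (KS : seq E).
Hypotheses (cR : graph_cert R GR KR) (cS : graph_cert S GS KS).
Hypotheses (xR : exact_graph R GR) (xS : exact_graph S GS).

(** One synchronized pair of walks is chosen for each pair of vertices that is
   reached. All conditions ask that finitely many elements, which lie in the
   fibre product and do not depend on [Del], belong to its subgroup. *)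
Lemma pair_exists : exists B : seq (E * E), forall Del,
  (forall z, z \in B -> fibre R S z -> gen Del z) -> pair_cert GR KR GS KS Del.
Proof.
have [okR [KRR _]] := cR; have [okS [KSS _]] := cS.
pose reach (c : nat * nat) (z : E * E) := exists s t,
  [/\ {subset s <= GR} /\ {subset t <= GS}, walk 0 s c.1, walk 0 t c.2,
      map elet s = map elet t & z = (labs s, labs t)].
have reachD c z z' : reach c z -> reach c z' -> fibre R S (z * z'^-1).
  move=> [s [t [[sG tG] ws wt est ->]]] [s' [t' [[s'G t'G] ws' wt' est' ->]]].
  split; first exact: xR ws ws'.
    exact: xS wt wt'.
  rewrite /= !piM !(homV piM) (pi_labs okR sG) (pi_labs okR s'G).
  by rewrite (pi_labs okS tG) (pi_labs okS t'G) est est'.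
have reach0 : reach (0, 0)%N 1.
  by exists [::], [::]; split; rewrite ?labs_nil.
have [C hC] := filter_prop (fun c => exists z, reach c z)
  [seq (p, q) | p <- 0%N :: map etgt GR, q <- 0%N :: map etgt GS].
have inC c z : reach c z -> c \in C.
  move=> h; apply/hC; split; last by exists z.
  case: h => s [t [[sG tG] ws wt _ _]]; case: c ws wt => p q ws wt.
  by apply: allpairs_f; [exact: walk_end ws | exact: walk_end wt].
have [Th [ThP CTh]] := list_choice (P := reach) (fun c cC => proj2 ((hC c).1 cC)).
pose edges := [seq (a, b) | a <- GR, b <- GS].
exists (map snd Th ++ map (fun z => (z, 1)) KR ++ map (fun z => (1, z)) KS ++
  [seq x * y.2^-1 | x <- [seq t.2 * (elab ab.1, elab ab.2) | t <- Th, ab <- edges], y <- Th]).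
move=> Del hDel; exists Th; split.
  by have [z zT] := CTh _ (inC _ _ reach0); exists ((0, 0)%N, z).
split.
  move=> t tT /eqP t1; apply: hDel; first by rewrite mem_cat map_f.
  have [_] := ThP t tT; rewrite t1 => h.
  by have := reachD _ _ _ h reach0; rewrite invg1 mulg1.
split; last first.
  split=> z zK; apply: hDel.
  - by rewrite !mem_cat map_f ?orbT.
  - by split=> /=; [exact: KRR | exact: Gen1 | rewrite (hom1 piM) (genK_ker okR (gen_in zK))].
  - by rewrite !mem_cat map_f ?orbT.
  - by split=> /=; [exact: Gen1 | exact: KSS | rewrite (hom1 piM) (genK_ker okS (gen_in zK))].
move=> t tT a aR b bS /and3P[/eqP ta /eqP tb /eqP lab].
have [_ [s [u [[sG uG] ws wu est t2]]]] := ThP t tT.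
have reach' : reach (etgt a, etgt b) (t.2 * (elab a, elab b)).
  exists (rcons s a), (rcons u b); split.
  - by split; exact: subset_rcons.
  - exact: walk_rcons ws ta.
  - exact: walk_rcons wu tb.
  - by rewrite !map_rcons est lab.
  - rewrite t2 -!cats1 !labs_cat !labs_cons labs_nil !mulg1.
    by rewrite -[LHS]/(_, _).
have [z zT] := CTh _ (inC _ _ reach').
exists ((etgt a, etgt b), z); split=> //.
apply: hDel; last first.
  by apply: reachD reach' _; have [_] := ThP _ zT.
rewrite !mem_cat; apply/orP; right; apply/orP; right; apply/orP; right.
apply/allpairsP; exists (t.2 * (elab a, elab b), ((etgt a, etgt b), z)); split=> //=.
apply/allpairsP; exists (t, (a, b)); split=> //=.
by apply: allpairs_f.
Qed.

Lemma fibre_fg : exists Del, pair_cert GR KR GS KS Del /\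
  forall z, fibre R S z <-> gen Del z.
Proof.
have [B hB] := pair_exists; have [Del hDel] := filter_prop (fibre R S) B.
have cDel : pair_cert GR KR GS KS Del.
  by apply: hB => z zB fz; apply/gen_in/hDel.
exists Del; split=> // z; split; first exact: (pair_sound cR cS cDel).
by apply: gen_min => [|x /hDel[]//]; exact: fibre_subgroup.
Qed.

End PairExists.

(** ** Certificates for generators of the intersection *)

(** The intersection of two subgroups is the part of their fibre product on which
   the components agree, that is, the common kernel of these characters. *)
Definition eps (j : nat) (z : E * E) : int := (e j z.1 - e j z.2)%R.

Lemma epsM j : ihom (eps j).
Proof. by move=> x y; rewrite /eps /= !eM; lia. Qed.

Definition diag (T : seq E) := map (fun t => (t, t)) T.

Lemma gen_diag T z : gen (diag T) z <-> gen T z.1 /\ z.1 = z.2.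
Proof.
rewrite /diag (gen_hom is_hom_diag); split=> [[x gx <-] //|].
by case: z => x y /= [gx <-]; exists x.
Qed.

Definition inter_cert (R S T : seq E) :=
  exists GR KR GS KS Del,
    [/\ graph_cert R GR KR, graph_cert S GS KS, pair_cert GR KR GS KS Del,
      chain eps js Del (diag T) & forall t, t \in T -> gen R t /\ gen S t].

Lemma fibre_diag R S z : (fibre R S z /\ forall j, j \in js -> eps j z = 0%R) <->
  (gen R z.1 /\ gen S z.1) /\ z.1 = z.2.
Proof.
case: z => x y; split=> /= [[[gx gy hpi] h]|[[gx gy] <-]]; last first.
  by split=> // j _; rewrite /eps /=; lia.
suff xy : x = y by rewrite {2}xy.
have : x * y^-1 = 1.
  apply: ker_inj; first by rewrite piM (homV piM) -hpi mulgV.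
  by move=> j /h; rewrite eM (ihomV (eM j)).
by move=> h1; rewrite -[x](mulgVK y) h1 mul1g.
Qed.

Theorem inter_certP R S T :
  inter_cert R S T <-> forall y, gen T y <-> gen R y /\ gen S y.
Proof.
split=> [[GR [KR [GS [KS [Del [cR cS cP ch hT]]]]]] y|hT].
  split=> [gy|[gR gS]].
    apply: (gen_min (H := fun y => gen R y /\ gen S y)) gy => [|//].
    split=> [|u v [? ?] [? ?]|u [? ?]]; split; solve [exact: Gen1|exact: GenM|exact: GenV].
  have fy : fibre R S (y, y) by [].
  have gD := pair_sound cR cS cP fy.
  suff /gen_diag[] : gen (diag T) (y, y) by [].
  by apply: (chain_sound epsM) ch gD _ => j _; rewrite /eps /=; lia.
have [GR [KR [cR xR _]]] := graph_exists R.
have [GS [KS [cS xS _]]] := graph_exists S.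
have [Del [hDel ch]] := chain_complete epsM (js := js) (T := diag T) (fibre_subgroup R S)
  (fun z => iff_trans (fibre_diag R S z) (iff_trans (and_iff_compat_r _ (iff_sym (hT z.1)))
     (iff_sym (gen_diag T z)))).
have [B hB] := pair_exists cR cS xR xS.
exists GR, KR, GS, KS, Del; split=> //.
  by apply: hB => z _ /hDel.
by move=> t /gen_in/hT.
Qed.

(** ** Normalizers of finitely generated subgroups of a free group *)

Lemma reduced_cons a b w : reduced (a :: b :: w) = (b != negl a) && reduced (b :: w).
Proof. by []. Qed.

Lemma reduced_drop w1 w2 : reduced (w1 ++ w2) -> reduced w2.
Proof. by elim: w1 => //= a w1 IH /reduced_tail. Qed.

Lemma reduced_rcons w a b : reduced (rcons (rcons w a) b) = reduced (rcons w a) && (b != negl a).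
Proof.
by case: w => [|c w]; rewrite /reduced //= ?andbT // rcons_path last_rcons.
Qed.

Lemma reduced_cat_inv w w' l l' : l <> l' -> reduced (rcons w l) -> reduced (rcons w' l') ->
  reduced (rcons w l ++ invw (rcons w' l')).
Proof.
move=> ll' rw rw'.
have rev' := reduced_invw rw'.
move: rev'; rewrite invw_rcons /reduced.
case: w rw => [|c w] rw /= rev'.
  rewrite rev' andbT; apply/eqP => h; apply: ll'.
  by rewrite -[l]neglK -h neglK.
rewrite cat_path last_rcons /= rev' andbT.
move: rw; rewrite /reduced /= => ->; rewrite /=.
by apply/eqP => h; apply: ll'; rewrite -[l]neglK -h neglK.
Qed.

Lemma exists_reduced f : exists w, [/\ all (gtn n.*2) w, reduced w & evw w = f].
Proof.
have [w wl <-] := ev_surj f; elim: w wl => [|l w IH] /=; first by exists [::].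
case/andP=> ll /IH[[|b v] [vl rv ev]].
  by exists [:: l]; split; rewrite //= ?ll // !(evw_cons l) ev.
case: (altP (b =P negl l)) => [bl|nb].
  exists v; split; [by case/andP: vl | exact: reduced_tail rv |].
  by rewrite evw_cons -ev evw_cons bl xl_negl mulVKg.
exists [:: l, b & v]; split; last by rewrite !(evw_cons l) ev.
  by rewrite /= ll.
by rewrite reduced_cons nb.
Qed.

(** Each letter of [v] cancels at most the last letter that is left. *)
Lemma reduced_mul_short l z v : all (gtn n.*2) (l :: z) -> all (gtn n.*2) v ->
  reduced (l :: z) -> size v <= size z ->
  exists z', [/\ all (gtn n.*2) (l :: z'), reduced (l :: z') &
    evw (l :: z') = evw (l :: z) * evw v].
Proof.
elim: v z => [|b v IH] z; first by exists z; rewrite evw_nil mulg1.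
elim/last_ind: z => [|z t _] // zl /andP[bl vl] rz.
rewrite /= size_rcons ltnS => sz.
case: (altP (b =P negl t)) => [bt|nbt].
  have [|||z' [h1 h2 h3]] := IH z _ vl.
  - by move: zl; rewrite /= all_rcons => /andP[->/andP[_ ->]].
  - by move: rz; rewrite /reduced /= rcons_path => /andP[].
  - exact: sz.
  exists z'; split=> //; rewrite h3 -rcons_cons evw_rcons (evw_cons b) bt xl_negl.
  by rewrite -mulgA mulVKg.
have [|||z' [h1 h2 h3]] := IH (rcons (rcons z t) b) _ vl.
- by rewrite -!rcons_cons !all_rcons bl /=; move: zl; rewrite -rcons_cons all_rcons.
- by rewrite -!rcons_cons reduced_rcons nbt rcons_cons rz.
- by rewrite !size_rcons leqW // leqW.
by exists z'; split=> //; rewrite h3 -rcons_cons evw_rcons (evw_cons b) mulgA.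
Qed.

Fixpoint short_words (k : nat) : seq (seq nat) :=
  if k is k'.+1 then [::] :: [seq l :: w | l <- iota 0 n.*2, w <- short_words k']
  else [:: [::]].

Lemma mem_short_words k w : all (gtn n.*2) w -> size w <= k -> w \in short_words k.
Proof.
elim: k w => [|k IH] [|l w] //= /andP[ll wl] sw; rewrite inE /=.
by apply: allpairs_f; [rewrite mem_iota | exact: IH].
Qed.

Section Core.

Variables (T : seq E) (Gm : seq edge) (K : seq E).
Hypotheses (cT : graph_cert T Gm K) (xT : exact_graph T Gm) (iT : inverse_closed Gm).

Let M := pi_image T.
Let subM : subgroup M := pi_image_subgroup T.
Let ok : graph_ok Gm K := proj1 cT.

(** The cosets that are vertices of the graph, as a set of group elements. *)
Definition core (y : F) := exists p s,
  [/\ {subset s <= Gm}, walk 0 s p & M (y * (evw (map elet s))^-1)].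

Lemma walk_inv p s q : {subset s <= Gm} -> walk p s q ->
  exists t, [/\ {subset t <= Gm}, walk q t p & map elet t = invw (map elet s)].
Proof.
elim: s p => [|a s IH] p sG /=; first by move/eqP->; exists [::]; rewrite /= eqxx.
case/andP=> /eqP <- ws.
have [|t [tG wt lt]] := IH _ _ ws; first by move=> b bs; apply: sG; rewrite inE bs orbT.
have [b [bG sb tb lb]] := iT (sG a (mem_head _ _)).
exists (rcons t b); split; first exact: subset_rcons.
  by rewrite -tb; apply: walk_rcons wt _.
by rewrite map_rcons lt lb /invw /= rev_cons.
Qed.

(** The graph contains every reduced path of the Schreier graph between two of
   its vertices: together with walks to its ends the path forms a closed walk,
   which is read in the graph by soundness, and reduction recovers the path. *)
Lemma core_step a a' l w : core a -> core a' -> all (gtn n.*2) (l :: w) ->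
  reduced (l :: w) -> M (a * evw (l :: w) * a'^-1) -> core (a * xl l).
Proof.
have [M1 MM MV] := subM.
move=> [p [s [sG ws hs]]] [p' [s' [s'G ws' hs']]] lw rw hM.
have [t [tG wt lt]] := walk_inv sG ws.
pose A := evw (map elet s); pose A' := evw (map elet s').
have [h gh ph] : M (A * evw (l :: w) * A'^-1).
  have := MM _ _ (MM _ _ (MV _ hs) hM) hs'.
  by rewrite -/A -/A' !invgM invgK !mulgA !mulgVK.
have [u [uG wu ru gu]] := reads_reduced ok (cert_reads cT gh).
have catG : {subset t ++ u ++ s' <= Gm}.
  by move=> b; rewrite !mem_cat => /or3P[/tG|/uG|/s'G].
have [v [vG wv rv gv]] := walk_reduce ok catG (walk_cat wt (walk_cat wu ws')).
have ev : map elet v = l :: w.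
  apply: reduced_inj => //; first exact: (lets_lt ok vG).
  rewrite -(reads_pi ok vG gv) (pi_labs ok catG) !map_cat !evw_cat lt evw_inv.
  rewrite -(reads_pi ok uG gu) ph -/A -/A' !mulgA mulVg mul1g mulgVK //.
case: v vG wv ev {rv gv} => [|b v] //= vG /andP[/eqP pb _] [bl _].
exists (etgt b), (rcons s b); split.
- by apply: subset_rcons => //; apply: vG; rewrite mem_head.
- exact: walk_rcons ws pb.
by rewrite map_rcons evw_rcons bl invgM mulgA mulgK.
Qed.

Definition exits (a : F) (z : seq nat) := if z is l :: _ then ~ core (a * xl l) else True.

(** Outside the core the Schreier graph is a forest: a reduced word that leaves
   the core never returns, so its end determines it. *)
Lemma exits_unique a a' z z' : core a -> core a' ->
  all (gtn n.*2) z -> all (gtn n.*2) z' -> reduced z -> reduced z' ->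
  exits a z -> exits a' z' -> M (a * evw z * (a' * evw z')^-1) -> z = z'.
Proof.
have [M1 MM MV] := subM; move=> ca ca'.
elim/last_ind: z z' => [|z l IH] z'.
  case: z' => // l z' _ al _ rz _ ex hM; case: ex.
  apply: (core_step ca' ca al rz).
  by have := MV _ hM; rewrite evw_nil mulg1 invgM invgK.
elim/last_ind: z' => [|z' l' _] al al' rz rz' ex ex' hM.
  rewrite evw_nil mulg1 in hM.
  have : exists b v, rcons z l = b :: v by case: (z) => [|c v]; rewrite /=; eauto.
  case=> b [v E0]; rewrite E0 in al rz ex hM; case: ex.
  exact: core_step al rz hM.
case: (eqVneq l l') => [ll'|/eqP ll'].
  rewrite -{l'}ll' in al' rz' ex' hM *; congr rcons.
  apply: IH.
  - by move: al; rewrite all_rcons => /andP[].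
  - by move: al'; rewrite all_rcons => /andP[].
  - by move: rz; case: (z) => [|c v] //; rewrite /reduced /= rcons_path => /andP[].
  - by move: rz'; case: (z') => [|c v] //; rewrite /reduced /= rcons_path => /andP[].
  - by move: ex; case: (z).
  - by move: ex'; case: (z').
  - by move: hM; rewrite !evw_rcons !invgM !mulgA mulgK.
have rr := reduced_cat_inv ll' rz rz'.
have : exists b v, rcons z l = b :: v by case: (z) => [|c v]; rewrite /=; eauto.
case=> b [v E0]; rewrite E0 in al rr ex hM; case: ex.
apply: (core_step ca ca' (w := v ++ invw (rcons z' l'))) => //.
  by rewrite -cat_cons all_cat al all_invw.
by move: hM; rewrite -cat_cons evw_cat evw_inv invgM !mulgA.
Qed.

Lemma core_split a w : core a -> exists w1 w2,
  [/\ w = w1 ++ w2, core (a * evw w1) & exits (a * evw w1) w2].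
Proof.
elim: w a => [|l w IH] a ca; first by exists [::], [::]; rewrite evw_nil mulg1.
case: (pselect (core (a * xl l))) => [cal|nc].
  have [w1 [w2 [-> h1 h2]]] := IH _ cal.
  by exists (l :: w1), w2; rewrite evw_cons mulgA.
by exists [::], (l :: w); rewrite evw_nil mulg1.
Qed.

Lemma core_finite : exists Y : seq F, forall y, core y -> exists2 f, f \in Y & M (y * f^-1).
Proof.
have [C hC] := filter_prop (fun p => exists s, {subset s <= Gm} /\ walk 0 s p)
  (0%N :: map etgt Gm).
have [A [AP CA]] := list_choice (fun c cC => proj2 ((hC c).1 cC)).
exists (map (fun c => evw (map elet c.2)) A) => y [p [s [sG ws hs]]].
have pC : p \in C by apply/hC; split; [exact: walk_end ws | exists s].
have [t tA] := CA p pC; have [_ [/= tG wt]] := AP _ tA.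
exists (evw (map elet t)); first by apply/mapP; exists (p, t).
have [M1 MM MV] := subM.
rewrite (_ : _ * _ = (y * (evw (map elet s))^-1) *
   (evw (map elet s) * (evw (map elet t))^-1)); last by rewrite !mulgA mulgVK.
apply: MM => //; exists (labs s * (labs t)^-1); first exact: xT ws wt.
by rewrite piM (homV piM) !(pi_labs ok).
Qed.

(** If [m] is nontrivial then conjugation brings it into the finitely generated
   subgroup only from finitely many cosets: from a vertex at distance more than
   the length of [m] from the core, [m] cannot be read as a closed walk. *)
Lemma conjugators_finite (m : F) : m <> 1 ->
  exists Y : seq F, forall y, M (y * m * y^-1) -> exists2 f, f \in Y & M (y * f^-1).
Proof.
move=> m1; have [M1 MM MV] := subM.
have [v [vl rv ev]] := exists_reduced m.
have [Y hY] := core_finite.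
exists [seq f * evw z | f <- Y, z <- short_words (size v)] => y hM.
have c1 : core 1.
  by exists 0%N, [::]; split=> //; rewrite evw_nil invg1 mulg1.
have [w [wl rw ew]] := exists_reduced y.
have [w1 [z [wE]]] := core_split w c1; rewrite mul1g => cw ez.
have zl : all (gtn n.*2) z by move: wl; rewrite wE all_cat => /andP[].
have rz : reduced z by move: rw; rewrite wE => /reduced_drop.
have yE : y = evw w1 * evw z by rewrite -ew wE evw_cat.
have sz : size z <= size v.
  rewrite leqNgt; apply/negP => lt; apply: m1.
  case: z {wE} zl rz yE ez lt => [|l z] // zl rz yE ez; rewrite ltnS => lt.
  have [z' [z'l rz' ez']] := reduced_mul_short zl vl rz lt.
  have zz' : l :: z' = l :: z.
    apply: (exits_unique cw cw) => //.
    by rewrite ez' ev mulgA -yE.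
  move: ez'; rewrite zz' ev => /(congr1 (mul (evw (l :: z))^-1)).
  by rewrite mulVg mulKg.
have [f fY hf] := hY _ cw.
exists (f * evw z); first by apply: allpairs_f => //; exact: mem_short_words.
by rewrite yE invgM mulgA mulgK.
Qed.

(** If all powers of [w] conjugate [m] into the subgroup then two of them lie in
   the same coset. *)
Lemma normalizer_power (m w : F) : m <> 1 -> (forall i, M (w ^+ i * m * (w ^+ i)^-1)) ->
  exists2 k, 0 < k & M (w ^+ k).
Proof.
move=> m1 hw; have [Y hY] := conjugators_finite m1; have [M1 MM MV] := subM.
pose idx i := find (fun f => `[< M (w ^+ i * f^-1) >]) Y.
have idx_lt i : idx i < size Y.
  rewrite -has_find; have [f fY h] := hY _ (hw i).
  by apply/hasP; exists f => //; apply/asboolP.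
have : ~~ uniq (map idx (iota 0 (size Y).+1)).
  apply/negP => /uniq_leq_size h.
  have /h : {subset map idx (iota 0 (size Y).+1) <= iota 0 (size Y)}.
    by move=> _ /mapP[i _ ->]; rewrite mem_iota add0n idx_lt.
  by rewrite size_map !size_iota ltnn.
case/(uniqPn 0%N) => i [j [ij]]; rewrite size_map size_iota => jl.
rewrite !(nth_map 0%N) ?size_iota ?(ltn_trans ij) // !nth_iota ?(ltn_trans ij) // !add0n => E0.
exists (j - i)%N; first by rewrite subn_gt0.
have near i' : M (w ^+ i' * (nth 1 Y (idx i'))^-1).
  by have := idx_lt i'; rewrite -has_find => /(nth_find 1)/asboolP.
have := MM _ _ (near j) (MV _ (near i)).
by rewrite E0 invgM invgK mulgA mulgVK expgnFr // ltnW.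
Qed.

End Core.

(** ** Certificates for intersections that are not finitely generated *)

(** The intersection projects to a nontrivial normal subgroup of the intersection
   of the projections. If it were finitely generated then by [normalizer_power]
   every element of the latter would have a power in the former. The witness
   against this is an element [pi h] such that a character which does not see
   the central parts of the subgroups takes different values on its two lifts. *)
Definition infinite_cert (R S : seq E) :=
  exists GR KR GS KS, [/\ graph_cert R GR KR, graph_cert S GS KS,
    exists y, [/\ gen R y, gen S y & pi y <> 1] &
    exists h k cs, [/\ gen R h, gen S k, pi h = pi k,
      (forall z, z \in KR -> lincomb e cs js z = 0%R) /\
      (forall z, z \in KS -> lincomb e cs js z = 0%R) &
      lincomb e cs js h <> lincomb e cs js k]].

Lemma pi_eq_central a b : pi a = pi b -> exists c, a = b * c /\ pi c = 1.
Proof.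
move=> ab; exists (b^-1 * a); split; first by rewrite mulVKg.
by rewrite piM (homV piM) ab mulVg.
Qed.

Lemma lincomb_ker cs X z : (forall x, x \in X -> lincomb e cs js x = 0%R) -> gen X z ->
  lincomb e cs js z = 0%R.
Proof.
move=> hX; apply: (gen_min (H := fun z => lincomb e cs js z = 0%R)) => //.
have cM := lincombM eM cs js.
by split=> [|x u hx hu|x hx]; rewrite ?(ihom1 cM) ?cM ?(ihomV cM); lia.
Qed.

Theorem infinite_cert_sound R S : infinite_cert R S ->
  ~ finitely_generated (fun y => gen R y /\ gen S y).
Proof.
move=> [GR [KR [GS [KS [cR cS [y [yR yS y1]] [h [k [cs [gh gk hk [cKR cKS] neq]]]]]]]]].
move=> [T hT]; apply: neq.
have hT' z : gen T z <-> gen R z /\ gen S z by rewrite hT.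
have [Gm [K [cT xT iT]]] := graph_exists T.
(* As [h] and [k] differ by a central element, conjugation by either is the    *)
(* same.                                                                       *)
have conj i : pi_image T (pi h ^+ i * pi y * (pi h ^+ i)^-1).
  exists (h ^+ i * y * (h ^+ i)^-1); last by rewrite !piM (homV piM) (homX piM).
  apply/hT'; split.
    have gi := subgroup_exp i (gen_subgroup R) gh.
    by apply: GenM; [exact: GenM | exact: GenV].
  have [c [-> c1]] : exists c, h ^+ i = k ^+ i * c /\ pi c = 1.
    by apply: pi_eq_central; rewrite !(homX piM) hk.
  rewrite -(mulgA _ c) (central y c1) invgM !mulgA mulgK.
  have gi := subgroup_exp i (gen_subgroup S) gk.
  by apply: GenM; [exact: GenM | exact: GenV].
have [j j0 [t /hT'[tR tS] pt]] := normalizer_power cT xT iT y1 conj.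
have cM := lincombM eM cs js.
have val a X G Ks : graph_cert X G Ks -> gen X a -> gen X t -> pi a = pi h ->
    (forall z, z \in Ks -> lincomb e cs js z = 0%R) ->
    (j%:Z * lincomb e cs js a)%R = lincomb e cs js t.
  move=> cX ga gt ah cKs.
  have gat : gen X (a ^+ j * t^-1).
    by apply: GenM; [exact: subgroup_exp (gen_subgroup X) _ | exact: GenV].
  have at1 : pi (a ^+ j * t^-1) = 1.
    by rewrite piM (homV piM) (homX piM) ah pt mulgV.
  have := lincomb_ker cKs (reads_ker (proj1 cX) (cert_reads cX gat) at1).
  by rewrite cM (ihomX cM) (ihomV cM); lia.
have e1 := val _ _ _ _ cR gh tR (erefl _) cKR.
have e2 := val _ _ _ _ cS gk tS (esym hk) cKS.
by move: e1 e2 j0; nia.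
Qed.

Lemma lincomb_eps cs ks z : lincomb eps cs ks z = (lincomb e cs ks z.1 - lincomb e cs ks z.2)%R.
Proof.
elim: ks cs => [|j ks IH] cs //=.
by rewrite IH /eps; lia.
Qed.

(** If no character separates, then every element of the fibre product has a
   power with the same characters as a pair of central elements. Hence the
   elements that have the same characters as such a pair form a subgroup of
   finite index in a finitely generated group; its projection is the projection
   of the intersection, which is therefore an extension of finitely generated
   groups. *)
Theorem infinite_cert_complete R S :
  ~ finitely_generated (fun y => gen R y /\ gen S y) -> infinite_cert R S.
Proof.
move=> nfg.
have subJ : subgroup (fun y => gen R y /\ gen S y).
  by split=> [|u v [? ?] [? ?]|u [? ?]]; split; solve [exact: Gen1|exact: GenM|exact: GenV].
have [GR [KR [cR xR _]]] := graph_exists R.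
have [GS [KS [cS xS _]]] := graph_exists S.
have [kerfg hkerfg] := kernel_generators subJ.
exists GR, KR, GS, KS; split=> //.
  case: (pselect (exists y, [/\ gen R y, gen S y & pi y <> 1])) => // h; case: nfg.
  exists kerfg => y; rewrite -/(gen kerfg y) -hkerfg; split=> [[gR gS]|[]//].
  split=> //; case: (pselect (pi y = 1)) => // y1; case: h; by exists y.
apply: contrapT => hno; apply: nfg.
have [Del [cD hD]] := fibre_fg cR cS xR xS.
pose L (z : E * E) := gen KR z.1 /\ gen KS z.2.
have subL : subgroup L.
  by split=> [|u v [? ?] [? ?]|u [? ?]]; split; solve [exact: Gen1|exact: GenM|exact: GenV].
have [okR [KRR _]] := cR; have [okS [KSS _]] := cS.
have powL d : d \in Del -> exists2 m, 0 < m & agrees_mod eps js L (d ^+ m).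
  move=> /gen_in/hD[dR dS dpi].
  have [[m [z [m0 Lz h]]]|[cs [h1 h2]]] := lincomb_separate epsM js d subL.
    by exists m => //; exists z.
  case: hno; exists d.1, d.2, cs; split=> //.
    split=> z zK.
      have := h1 (z, 1) (conj (gen_in zK) (Gen1 _)).
      by rewrite lincomb_eps /= (ihom1 (lincombM eM cs js)); lia.
    have := h1 (1, z) (conj (Gen1 _) (gen_in zK)).
    by rewrite lincomb_eps /= (ihom1 (lincombM eM cs js)); lia.
  by move: h2; rewrite lincomb_eps => h2 h3; apply: h2; rewrite h3 GRing.subrr.
have fgN := agrees_fg epsM subL powL.
apply: (extension_fg piM subJ); last by exists kerfg => x; rewrite -/(gen kerfg x) -hkerfg.
have p1M : is_hom (fun z : E * E => pi z.1) by move=> x y /=; rewrite piM.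
apply: fg_ext (image_fg p1M fgN) => f; split=> [[z [gz [u [u1 u2] hu]] <-]|[x [xgR xgS] <-]].
  have [zR zS zpi] : fibre R S z by exact/hD.
  have u1' : pi u.1 = 1 := genK_ker okR u1.
  have u2' : pi u.2 = 1 := genK_ker okS u2.
  have : fibre R S (z * u^-1) /\ forall j, j \in js -> eps j (z * u^-1) = 0%R.
    split; last by move=> j /hu; rewrite epsM (ihomV (epsM j)); lia.
    split; rewrite /= ?piM ?(homV piM) ?u1' ?u2' ?zpi //.
      apply: GenM => //; apply: GenV; exact: gen_le KRR _ u1.
    apply: GenM => //; apply: GenV; exact: gen_le KSS _ u2.
  move/fibre_diag => [[gR gS] _].
  exists (z * u^-1).1 => //.
  by rewrite /= piM (homV piM) u1' invg1 mulg1.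
exists (x, x) => //; split; first exact/hD.
exists 1; first by case: subL.
by move=> j _; rewrite (ihom1 (epsM j)) /eps /=; lia.
Qed.

End Extension.

(** * Semidecidability of the certificates *)

(** ** Quotients of numbered types *)

(** Codes are inherited along a surjection, so a function on [T] is effective as
   soon as its composite with the surjection is. *)
Definition num_quot S T (numS : Numbered S) (q : S -> T) (qs : forall t, exists s, q s = t) : Numbered T.
Proof.
exists (fun m => q (rep m)) => t.
by have [s <-] := qs t; have [m <-] := rep_surj s; exists m.
Defined.

Section Quotient.

Context {S T X : Type} {numS : Numbered S} {numX : Numbered X}.
Variables (q : S -> T) (qs : forall t, exists s, q s = t).
Let numT := num_quot numS qs.
Local Existing Instance numT.

Lemma effective_quot : effective q.
Proof. by exists id; split=> //; rec_solve. Qed.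

Lemma effective_quot1 (f : T -> X) : effective (fun s => f (q s)) -> effective f.
Proof. by case=> phi [r h]; exists phi; split=> // m; rewrite h. Qed.

Lemma effective_quot2 (f : T -> T -> X) :
  effective (fun z => f (q z.1) (q z.2)) -> effective (fun z => f z.1 z.2).
Proof. by case=> phi [r h]; exists phi; split=> // m; rewrite h. Qed.

End Quotient.

Definition int_of_pair (p : nat * nat) : int := (p.1%:Z - p.2%:Z)%R.

Lemma int_of_pair_surj z : exists p, int_of_pair p = z.
Proof. by case: z => m; [exists (m, 0%N) | exists (0%N, m.+1)]; rewrite /int_of_pair /=; lia. Qed.

#[export] Instance num_int : Numbered int := num_quot _ int_of_pair_surj.

Ltac effective_auto := rewrite /=; repeat first
  [ exact: effective_id | exact: effective_const | assumption
  | match goal with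
    | h : effective ?f |- effective (fun x => ?f _) => apply: (effective_comp (f := f)); first exact: h
    end
  | apply: effective_fst | apply: effective_snd | apply: effective_pair | apply: effective_cons
  | apply: effective_succ | apply: effective_pred | apply: effective_odd | apply: effective_half
  | apply: effective_pos | apply: effective_and | apply: effective_or | apply: effective_not
  | apply: effective_cat | apply: effective_ltn | apply: effective_eqn | apply: effective_add ].

Section Integers.

Context {X : Type} {numX : Numbered X}.

Lemma effective_int_op (op : int -> int -> int) (opp : nat * nat -> nat * nat -> nat * nat) :
  (forall a b, op (int_of_pair a) (int_of_pair b) = int_of_pair (opp a b)) ->
  effective (fun z => opp z.1 z.2) -> forall f g : X -> int, effective f -> effective g ->
  effective (fun x => op (f x) (g x)).
Proof.
move=> h c f g cf cg.
have cop : effective (fun z => op z.1 z.2).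
  apply: (effective_quot2 int_of_pair_surj).
  apply: effective_ext (fun z => esym (h z.1 z.2)) _.
  by apply: (effective_comp (f := int_of_pair)); [exact: effective_quot | exact: c].
apply: (effective_comp (f := fun z => op z.1 z.2) (g := fun x => (f x, g x))) => //.
by effective_auto.
Qed.

Lemma effective_muln (f g : X -> nat) : effective f -> effective g -> effective (fun x => f x * g x)%N.
Proof.
move=> cf cg; apply: effective_ext (effective_iter (s := fun x a => (g x + a)%N) (a := fun=> 0%N) cf _ _).
- by move=> x; elim: (f x) => //= k ->.
- by effective_auto.
- exact: effective_const.
Qed.

Lemma effective_int_add (f g : X -> int) : effective f -> effective g -> effective (fun x => f x + g x)%R.
Proof.
apply: (@effective_int_op _ (fun a b => (a.1 + b.1, a.2 + b.2)%N)); last by effective_auto.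
by move=> a b; rewrite /int_of_pair /=; lia.
Qed.

Lemma effective_int_sub (f g : X -> int) : effective f -> effective g -> effective (fun x => f x - g x)%R.
Proof.
apply: (@effective_int_op (fun a b => a - b)%R (fun a b => (a.1 + b.2, a.2 + b.1)%N)).
  by move=> a b; rewrite /int_of_pair /=; lia.
by effective_auto.
Qed.

End Integers.

Lemma effective_int_mul X {numX : Numbered X} (f g : X -> int) :
  effective f -> effective g -> effective (fun x => f x * g x)%R.
Proof.
apply: (@effective_int_op _ _ _ (fun a b => (a.1 * b.1 + a.2 * b.2, a.1 * b.2 + a.2 * b.1)%N)).
  by move=> a b; rewrite /int_of_pair /=; nia.
by apply: effective_pair; apply: effective_add; apply: effective_muln; effective_auto.
Qed.

(** ** Decidable equality *)

Definition deceq (T : eqType) {numT : Numbered T} := effective (fun z : T * T => z.1 == z.2).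
Arguments deceq T {numT}.

Lemma deceq_nat : deceq nat.
Proof. by rewrite /deceq; effective_auto. Qed.

Lemma deceq_int : deceq int.
Proof.
apply: (effective_quot2 int_of_pair_surj (f := fun a b => a == b)).
apply: (@effective_ext _ _ _ _ (fun z => z.1.1 + z.2.2 == z.2.1 + z.1.2)%N).
  by move=> z; rewrite /int_of_pair; apply/eqP/eqP; lia.
by effective_auto.
Qed.

Section Equality.

Context {X : Type} {numX : Numbered X} {T : eqType} {numT : Numbered T}.
Hypothesis dT : deceq T.
Variables f g : X -> T.
Hypotheses (cf : effective f) (cg : effective g).

Lemma effective_eq : effective (fun x => f x == g x).
Proof.
by apply: (effective_comp (f := fun z => z.1 == z.2) (g := fun x => (f x, g x))) => //; effective_auto.
Qed.

Lemma sd_eq : sd (fun x => f x = g x).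
Proof. by apply: sd_ext (sd_dec effective_eq) => x; split=> /eqP. Qed.

Lemma sd_neq : sd (fun x => f x <> g x).
Proof.
apply: (@sd_ext _ _ (fun x => f x != g x)); last by apply: sd_dec; apply/effective_not/effective_eq.
by move=> x; split=> /eqP.
Qed.

Lemma sd_imp_eq (P : X -> Prop) : sd P -> sd (fun x => f x = g x -> P x).
Proof.
move=> sP; apply: (@sd_ext _ _ (fun x => f x <> g x \/ P x)); last exact: sd_or sd_neq sP.
move=> x; split=> [[ne /ne|]|h] //.
by case: (pselect (f x = g x)) => [/h|]; [right|left].
Qed.

Lemma effective_mem (s : X -> seq T) : effective s -> effective (fun x => f x \in s x).
Proof.
move=> cs; apply: effective_ext (effective_has (p := fun x y => y == f x) cs _).
  by move=> x; rewrite has_pred1.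
by apply: (effective_comp (f := fun z => z.1 == z.2) (g := fun x => (x.2, f x.1))) => //; effective_auto.
Qed.

End Equality.

Lemma deceq_prod (S T : eqType) {numS : Numbered S} {numT : Numbered T} :
  deceq S -> deceq T -> deceq (S * T)%type.
Proof.
move=> dS dT; rewrite /deceq.
apply: (@effective_ext _ _ _ _ (fun z => (z.1.1 == z.2.1) && (z.1.2 == z.2.2))) => //.
by apply: effective_and; apply: effective_eq => //; effective_auto.
Qed.

Section Connectives.

Context {X : Type} {numX : Numbered X}.
Implicit Types P Q R : X -> Prop.

Lemma sd_imp (b : X -> bool) P : effective b -> sd P -> sd (fun x => b x -> P x).
Proof.
move=> cb sP; apply: (@sd_ext _ _ (fun x => ~~ b x \/ P x)).
  move=> x; split=> [[/negbTE->|]//|h].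
  by case: (boolP (b x)) => [/h|]; [right|left].
by apply: sd_or => //; apply: sd_dec; exact: effective_not.
Qed.

Lemma sd_and3 P Q R : sd P -> sd Q -> sd R -> sd (fun x => [/\ P x, Q x & R x]).
Proof.
move=> sP sQ sR; apply: (@sd_ext _ _ (fun x => P x /\ Q x /\ R x)).
  by move=> x; split=> [[? []]|[]].
by do 2 apply: sd_and => //.
Qed.

Lemma sd_and4 P Q R S : sd P -> sd Q -> sd R -> sd S ->
  sd (fun x => [/\ P x, Q x, R x & S x]).
Proof.
move=> sP sQ sR sS; apply: (@sd_ext _ _ (fun x => P x /\ Q x /\ R x /\ S x)).
  by move=> x; split=> [[? [? []]]|[]].
by do 3 apply: sd_and => //.
Qed.

Lemma sd_and5 P Q R S U : sd P -> sd Q -> sd R -> sd S -> sd U ->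
  sd (fun x => [/\ P x, Q x, R x, S x & U x]).
Proof.
move=> sP sQ sR sS sU; apply: (@sd_ext _ _ (fun x => P x /\ Q x /\ R x /\ S x /\ U x)).
  by move=> x; split=> [[? [? [? []]]]|[]].
by do 4 apply: sd_and => //.
Qed.

End Connectives.

(** ** Numbered groups *)

Record effective_group (G : groupType) {numG : Numbered G} := CompGroup {
  cg_mul : effective (fun z : G * G => z.1 * z.2);
  cg_inv : effective (fun x : G => x^-1);
  cg_eq : deceq G
}.
Arguments effective_group G {numG}.

Lemma effective_group_prod (G H : groupType) {numG : Numbered G} {numH : Numbered H} :
  effective_group G -> effective_group H -> effective_group (G * H)%type.
Proof.
case=> mG iG eG [mH iH eH]; split; last exact: deceq_prod.
- apply: (@effective_ext _ _ _ _ (fun z => (z.1.1 * z.2.1, z.1.2 * z.2.2))) => //.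
  apply: effective_pair.
    by apply: (effective_comp (f := fun z => z.1 * z.2) (g := fun z => (z.1.1, z.2.1))) => //; effective_auto.
  by apply: (effective_comp (f := fun z => z.1 * z.2) (g := fun z => (z.1.2, z.2.2))) => //; effective_auto.
- apply: (@effective_ext _ _ _ _ (fun z => (z.1^-1, z.2^-1))) => //.
  apply: effective_pair.
    by apply: (effective_comp (f := fun z => z^-1)) => //; effective_auto.
  by apply: (effective_comp (f := fun z => z^-1)) => //; effective_auto.
Qed.

Section CompGroup.

Context {X : Type} {numX : Numbered X} {G : groupType} {numG : Numbered G}.
Hypothesis cG : effective_group G.

Lemma effective_mulg (f g : X -> G) : effective f -> effective g -> effective (fun x => f x * g x).
Proof.
move=> cf cg; have [m _ _] := cG.
by apply: (effective_comp (f := fun z => z.1 * z.2) (g := fun x => (f x, g x))) => //; effective_auto.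
Qed.

Lemma effective_invg (f : X -> G) : effective f -> effective (fun x => (f x)^-1).
Proof.
by move=> cf; have [_ i _] := cG; apply: (effective_comp (f := fun z => z^-1)).
Qed.

End CompGroup.

Section CompGroup2.

Context {X : Type} {numX : Numbered X} {G : groupType} {numG : Numbered G}.
Hypothesis cG : effective_group G.

Lemma effective_prodg (s : X -> seq G) : effective s -> effective (fun x => \prod_(y <- s x) y).
Proof.
move=> cs; apply: effective_ext (effective_foldr (f := fun _ y a => y * a) (a := fun=> 1) cs _ _).
- by move=> x; elim: (s x) => [|y l IH]; rewrite ?big_nil ?big_cons // -IH.
- by apply: effective_mulg => //; effective_auto.
- exact: effective_const.
Qed.

End CompGroup2.

Section CompGroup3.

Context {X : Type} {numX : Numbered X} {G : groupType} {numG : Numbered G}.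
Hypothesis cG : effective_group G.

Lemma sd_gen (s : X -> seq G) (y : X -> G) : effective s -> effective y -> sd (fun x => gen (s x) (y x)).
Proof.
move=> cs cy; have eG := cg_eq cG.
apply: sd_ext (fun x => iff_sym (gen_letters (s x) (y x))) _.
apply: sd_ex; apply: sd_and.
  apply: sd_all; first by effective_auto.
  apply: sd_dec; apply: effective_or; apply: effective_mem => //; effective_auto.
  by apply: effective_invg => //; effective_auto.
apply: sd_eq => //; first by effective_auto.
by apply: (effective_prodg cG); effective_auto.
Qed.

End CompGroup3.

(** ** Certificates in a numbered central extension *)

Section CertificatesChain.

Context {G : groupType} {numG : Numbered G}.
Hypothesis cG : effective_group G.
Variable e : nat -> G -> int.
Hypothesis ce : forall j, effective (e j).

Ltac group_auto := repeat first
  [ apply: (effective_mulg cG) | apply: (effective_invg cG) | progress effective_auto ].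

Lemma sd_step j : sd (fun z : seq G * seq G => step e j z.1 z.2).
Proof.
have cj := ce j.
apply: sd_ex; apply: sd_and3.
- apply: sd_or; first by apply: (sd_neq deceq_int); effective_auto.
  by apply: (sd_eq (cg_eq cG)); effective_auto.
- by apply: sd_all; [effective_auto | apply: (sd_gen cG); effective_auto].
- apply: sd_all; first by effective_auto.
  apply: sd_and3.
  + by apply: (sd_eq deceq_int); effective_auto.
  + by apply: (sd_gen cG); group_auto.
  + by apply: (sd_gen cG); group_auto.
Qed.

Lemma sd_chain X {numX : Numbered X} js (s t : X -> seq G) :
  effective s -> effective t -> sd (fun x => chain e js (s x) (t x)).
Proof.
elim: js X numX s t => [|j js IH] X numX s t cs ct /=.
  by apply: sd_all => //; apply: (sd_gen cG); effective_auto.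
apply: sd_ex; apply: sd_and; last by apply: IH; effective_auto.
by apply: (sd_comp (f := fun z : X * seq G => (s z.1, z.2)) (sd_step j)); effective_auto.
Qed.

Lemma effective_lincomb X {numX : Numbered X} js (cs : X -> seq int) (y : X -> G) :
  effective cs -> effective y -> effective (fun x => lincomb e (cs x) js (y x)).
Proof.
move=> ccs cy; elim: js cs ccs => [|j js IH] cs ccs /=; first exact: effective_const.
have cj := ce j; apply: effective_int_add; last by apply: IH; apply: effective_behead.
apply: effective_int_mul; last by effective_auto.
apply: effective_ext (effective_nth (n := fun=> 0%N) 0%R ccs (effective_const _)).
by move=> x; rewrite nth0.
Qed.

End CertificatesChain.

Section Certificates.

Context {E F : groupType} {numE : Numbered E}.
Hypothesis cE : effective_group E.
Variables (pi : E -> F) (n : nat) (xl : nat -> F) (e : nat -> E -> int) (js : seq nat).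
Hypothesis pi1 : pi 1 = 1.
Hypothesis dpi : effective (fun z : E * E => pi z.1 == pi z.2).
Variable xE : nat -> E.
Hypotheses (cxE : effective xE) (pi_xE : forall l, pi (xE l) = xl l).
Hypothesis ce : forall j, effective (e j).

#[local] Instance num_edge : Numbered (edge E) := num_prod _ _.

Let cEE : effective_group (E * E)%type := effective_group_prod cE cE.
Let dE : deceq E := cg_eq cE.
Let dedge : deceq (nat * nat * nat * E)%type :=
  deceq_prod (deceq_prod (deceq_prod deceq_nat deceq_nat) deceq_nat) dE.

Lemma sd_pi_eq X {numX : Numbered X} (f g : X -> E) : effective f -> effective g ->
  sd (fun x => pi (f x) = pi (g x)).
Proof.
move=> cf cg; apply: (@sd_ext _ _ (fun x => pi (f x) == pi (g x))).
  by move=> x; split=> /eqP.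
by apply/sd_dec/(effective_comp (g := fun x => (f x, g x)) dpi); effective_auto.
Qed.

Lemma sd_pi_neq1 X {numX : Numbered X} (f : X -> E) : effective f ->
  sd (fun x => pi (f x) <> 1).
Proof.
move=> cf; apply: (@sd_ext _ _ (fun x => pi (f x) != pi 1)).
  by move=> x; rewrite pi1; split=> /eqP.
by apply/sd_dec/effective_not/(effective_comp (g := fun x => (f x, 1 : E)) dpi); effective_auto.
Qed.

Lemma sd_pi1 X {numX : Numbered X} (f : X -> E) : effective f -> sd (fun x => pi (f x) = 1).
Proof. by move=> cf; rewrite -pi1; apply: sd_pi_eq; effective_auto. Qed.

Lemma sd_pi_xl X {numX : Numbered X} (f : X -> E) (l : X -> nat) :
  effective f -> effective l -> sd (fun x => pi (f x) = xl (l x)).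
Proof.
move=> cf cl; apply: (@sd_ext _ _ (fun x => pi (f x) = pi (xE (l x)))).
  by move=> x; rewrite pi_xE.
by apply: sd_pi_eq; effective_auto.
Qed.

Lemma effective_esrc X {numX : Numbered X} (a : X -> edge E) :
  effective a -> effective (fun x => esrc (a x)).
Proof. by move=> ca; rewrite /esrc; do 3 apply: effective_fst; exact: ca. Qed.

Lemma effective_elet X {numX : Numbered X} (a : X -> edge E) :
  effective a -> effective (fun x => elet (a x)).
Proof. by move=> ca; rewrite /elet; apply: effective_snd; do 2 apply: effective_fst; exact: ca. Qed.

Lemma effective_etgt X {numX : Numbered X} (a : X -> edge E) :
  effective a -> effective (fun x => etgt (a x)).
Proof. by move=> ca; rewrite /etgt; apply: effective_snd; apply: effective_fst; exact: ca. Qed.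

Lemma effective_elab X {numX : Numbered X} (a : X -> edge E) :
  effective a -> effective (fun x => elab (a x)).
Proof. by move=> ca; rewrite /elab; apply: effective_snd; exact: ca. Qed.

Ltac edge_auto := effective_auto; repeat first
  [ apply: effective_esrc | apply: effective_elet | apply: effective_etgt | apply: effective_elab
  | apply: (effective_mulg cE) | apply: (effective_invg cE)
  | apply: (effective_mulg cEE) | apply: (effective_invg cEE) | progress effective_auto ].

Lemma effective_negl X {numX : Numbered X} (l : X -> nat) : effective l -> effective (fun x => negl (l x)).
Proof. by move=> cl; apply: effective_if; effective_auto. Qed.

Lemma effective_walk X {numX : Numbered X} (s : X -> seq (edge E)) (p q : X -> nat) :
  effective s -> effective p -> effective q -> effective (fun x => walk (p x) (s x) (q x)).
Proof.
move=> cs cp cq.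
pose f (a : edge E) m := if m == (etgt a).+1 then (esrc a).+1 else 0%N.
have cf : effective (fun x => foldr f (q x).+1 (s x)).
  apply: (effective_foldr (f := fun _ => f)); [exact: cs | | by effective_auto].
  by apply: effective_if; edge_auto.
apply: (@effective_ext _ _ _ _ (fun x => foldr f (q x).+1 (s x) == (p x).+1)); last by effective_auto.
move=> x; elim: (s x) (p x) => [|a t IH] r /=; first by rewrite eqSS eq_sym.
rewrite -IH -[f a _]/(if foldr f (q x).+1 t == (etgt a).+1 then (esrc a).+1 else 0%N).
by case: (foldr f _ t == _); rewrite ?eqSS ?andbT ?andbF.
Qed.

Lemma effective_labs X {numX : Numbered X} (s : X -> seq (edge E)) :
  effective s -> effective (fun x => labs (s x)).
Proof.
move=> cs; apply: (effective_prodg cE); apply: (effective_map (f := fun _ => @elab E)) => //.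
by edge_auto.
Qed.

Lemma sd_reads X {numX : Numbered X} (Gm : X -> seq (edge E)) (K : X -> seq E) (h : X -> E) :
  effective Gm -> effective K -> effective h -> sd (fun x => reads (Gm x) (K x) (h x)).
Proof.
move=> cGm cK ch; apply: sd_ex; apply: sd_and3.
- apply: (sd_all (Y := (nat * nat * nat * E)%type)); first by effective_auto.
  by apply: sd_dec; apply: (effective_mem dedge); effective_auto.
- by apply: sd_dec; apply: effective_walk; effective_auto.
- by apply: (sd_gen cE); edge_auto; apply: effective_labs; effective_auto.
Qed.

Lemma sd_graph_cert X {numX : Numbered X} (R : X -> seq E) (Gm : X -> seq (edge E)) (K : X -> seq E) :
  effective R -> effective Gm -> effective K ->
  sd (fun x => graph_cert pi n xl (R x) (Gm x) (K x)).
Proof.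
move=> cR cGm cK; apply: sd_and; [apply: sd_and; last apply: sd_and | apply: sd_and].
- apply: (sd_all (Y := (nat * nat * nat * E)%type)); first by effective_auto.
  apply: sd_and; last by apply: sd_pi_xl; edge_auto.
  by apply: sd_dec; edge_auto.
- apply: (sd_all (Y := (nat * nat * nat * E)%type)); first by effective_auto.
  apply: (sd_all (Y := (nat * nat * nat * E)%type)); first by effective_auto.
  apply: (sd_imp_eq deceq_nat); try by edge_auto.
  apply: (sd_imp_eq deceq_nat); try by [edge_auto | apply: effective_negl; edge_auto].
  apply: sd_and; first by apply: (sd_eq deceq_nat); edge_auto.
  by apply: (sd_gen cE); edge_auto.
- by apply: sd_all; [effective_auto | apply: sd_pi1; effective_auto].
- by apply: sd_all; [effective_auto | apply: (sd_gen cE); effective_auto].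
- apply: sd_all; first by effective_auto.
  by apply: sd_and; apply: sd_reads; edge_auto.
Qed.

Lemma sd_pair_cert X {numX : Numbered X} (GR GS : X -> seq (edge E)) (KR KS : X -> seq E)
    (Del : X -> seq (E * E)) :
  effective GR -> effective GS -> effective KR -> effective KS -> effective Del ->
  sd (fun x => pair_cert (GR x) (KR x) (GS x) (KS x) (Del x)).
Proof.
move=> cGR cGS cKR cKS cDel.
have dnn := deceq_prod deceq_nat deceq_nat.
have dT := deceq_prod dnn (cg_eq cEE).
apply: sd_ex; do 4?apply: sd_and.
- apply: sd_ex; apply: sd_and; first by apply: sd_dec; apply: (effective_mem dT); effective_auto.
  by apply: sd_dec; apply: (effective_eq dnn); effective_auto.
- apply: sd_all; first by effective_auto.
  apply: sd_imp; first by apply: (effective_eq dnn); effective_auto.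
  by apply: (sd_gen cEE); effective_auto.
- apply: sd_all; first by effective_auto.
  apply: (sd_all (Y := (nat * nat * nat * E)%type)); first by effective_auto.
  apply: (sd_all (Y := (nat * nat * nat * E)%type)); first by effective_auto.
  apply: sd_imp; first by edge_auto.
  apply: sd_ex; apply: sd_and3.
  + by apply: sd_dec; apply: (effective_mem dT); effective_auto.
  + by apply: sd_dec; apply: (effective_eq dnn); edge_auto.
  + by apply: (sd_gen cEE); edge_auto.
- by apply: sd_all; [effective_auto | apply: (sd_gen cEE); effective_auto].
- by apply: sd_all; [effective_auto | apply: (sd_gen cEE); effective_auto].
Qed.

Lemma effective_eps j : effective (eps e j).
Proof. by have cj := ce j; apply: effective_int_sub; effective_auto. Qed.

Theorem sd_inter_cert X {numX : Numbered X} (R S T : X -> seq E) :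
  effective R -> effective S -> effective T ->
  sd (fun x => inter_cert pi n xl e js (R x) (S x) (T x)).
Proof.
move=> cR cS cT; do 5 apply: sd_ex; apply: sd_and5.
- by apply: sd_graph_cert; effective_auto.
- by apply: sd_graph_cert; effective_auto.
- by apply: sd_pair_cert; effective_auto.
- apply: (sd_chain cEE effective_eps); first by effective_auto.
  by apply: (effective_map (f := fun _ t => (t, t))); effective_auto.
- by apply: sd_all; [effective_auto | apply: sd_and; apply: (sd_gen cE); effective_auto].
Qed.

Theorem sd_infinite_cert X {numX : Numbered X} (R S : X -> seq E) :
  effective R -> effective S -> sd (fun x => infinite_cert pi n xl e js (R x) (S x)).
Proof.
move=> cR cS; do 4 apply: sd_ex; apply: sd_and4.
- by apply: sd_graph_cert; effective_auto.
- by apply: sd_graph_cert; effective_auto.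
- apply: sd_ex; apply: sd_and3; try by apply: (sd_gen cE); effective_auto.
  by apply: sd_pi_neq1; effective_auto.
- do 3 apply: sd_ex; apply: sd_and5.
  + by apply: (sd_gen cE); effective_auto.
  + by apply: (sd_gen cE); effective_auto.
  + by apply: sd_pi_eq; effective_auto.
  + by apply: sd_and; apply: sd_all; effective_auto; apply: (sd_eq deceq_int); effective_auto;
      apply: (effective_lincomb ce); effective_auto.
  + by apply: (sd_neq deceq_int); apply: (effective_lincomb ce); effective_auto.
Qed.

End Certificates.

(** * Free groups and free abelian groups *)

(** ** The group of reduced words *)

Definition push (l : nat) (w : seq nat) : seq nat :=
  if w is b :: w' then if b == negl l then w' else l :: w else [:: l].

Definition act (u w : seq nat) := foldr push w u.

Lemma reduced_push l w : reduced w -> reduced (push l w).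
Proof.
case: w => [|b w] //= rw; case: (altP (b =P negl l)) => [_|nb].
  exact: reduced_tail rw.
by rewrite /reduced /= nb.
Qed.

Lemma reduced_act u w : reduced w -> reduced (act u w).
Proof. by move=> rw; elim: u => //= l u; exact: reduced_push. Qed.

Lemma all_push n l w : l < n.*2 -> all (gtn n.*2) w -> all (gtn n.*2) (push l w).
Proof.
case: w => [|b w] ll /=; first by rewrite ll.
by case: ifP => _ /andP[bl wl] //=; rewrite ll bl.
Qed.

Lemma all_act n u w : all (gtn n.*2) u -> all (gtn n.*2) w -> all (gtn n.*2) (act u w).
Proof. by move=> ul wl; elim: u ul => //= l u IH /andP[ll /IH]; exact: all_push. Qed.

Lemma push_negl l w : reduced w -> push l (push (negl l) w) = w.
Proof.
case: w => [|b w] rw /=; first by rewrite eqxx.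
rewrite neglK; case: (altP (b =P l)) => [bl|nb] /=; last by rewrite eqxx.
rewrite -bl; case: w rw => [|c w] //=.
by rewrite /reduced /= => /andP[/negbTE ->].
Qed.

Lemma act_push l u w : reduced w -> act (push l u) w = push l (act u w).
Proof.
move=> rw; case: u => [|b u] //=; case: (altP (b =P negl l)) => [->|] //.
by rewrite push_negl //; exact: reduced_act.
Qed.

Lemma act_act u v w : reduced w -> act (act u v) w = act u (act v w).
Proof. by move=> rw; elim: u => //= l u IH; rewrite act_push // IH. Qed.

Lemma act_nil u : reduced u -> act u [::] = u.
Proof.
elim: u => //= l u IH ru; rewrite IH; last exact: reduced_tail ru.
by case: u ru {IH} => [|b u] //=; rewrite /reduced /= => /andP[/negbTE ->].
Qed.

Lemma act_invw u : act (invw u) u = [::].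
Proof.
elim: u => //= l u IH.
by rewrite invw_cons /act foldr_rcons /= neglK eqxx.
Qed.

Section FreeGroup.

Variable n : nat.

(** The target for a homomorphism that shows that distinct reduced words have
   distinct values in any group with the universal property. *)
Definition freew := {w : seq nat | all (gtn n.*2) w && reduced w}.

HB.instance Definition _ := Choice.on freew.

Lemma freew_all (u : freew) : all (gtn n.*2) (val u).
Proof. by case/andP: (valP u). Qed.

Lemma freew_reduced (u : freew) : reduced (val u).
Proof. by case/andP: (valP u). Qed.

Fact freew_mul_subproof (u v : freew) :
  all (gtn n.*2) (act (val u) (val v)) && reduced (act (val u) (val v)).
Proof. by rewrite all_act ?freew_all //= reduced_act ?freew_reduced. Qed.

Definition freew_mul (u v : freew) : freew := Sub (act (val u) (val v)) (freew_mul_subproof u v).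

Fact freew_inv_subproof (u : freew) : all (gtn n.*2) (invw (val u)) && reduced (invw (val u)).
Proof. by rewrite all_invw ?freew_all //= reduced_invw ?freew_reduced. Qed.

Definition freew_inv (u : freew) : freew := Sub (invw (val u)) (freew_inv_subproof u).

Definition freew_one : freew := Sub [::] isT.

Fact freew_mulA : associative freew_mul.
Proof. by move=> u v w; apply: val_inj; rewrite /= act_act // freew_reduced. Qed.

Fact freew_mul1 : left_id freew_one freew_mul.
Proof. by move=> u; apply: val_inj. Qed.

Fact freew_mulr1 : right_id freew_one freew_mul.
Proof. by move=> u; apply: val_inj; rewrite /= act_nil // freew_reduced. Qed.

Fact freew_mulV : left_inverse freew_one freew_inv freew_mul.
Proof. by move=> u; apply: val_inj; rewrite /= act_invw. Qed.

Fact freew_mulrV : right_inverse freew_one freew_inv freew_mul.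
Proof. by move=> u; apply: val_inj; rewrite /= -{1}[val u]invwK act_invw. Qed.

HB.instance Definition _ := isGroup.Build freew
  freew_mulA freew_mul1 freew_mulr1 freew_mulV freew_mulrV.

Variables (F : groupType) (x : 'I_n -> F).

(** With a value for every number, every list of numbers is a word; the search
   has to terminate on meaningless input too. *)
Definition letter (l : nat) : F :=
  if insub l./2 is Some i then if odd l then (x i)^-1 else x i else 1.

Lemma letter_negl l : letter (negl l) = (letter l)^-1.
Proof.
rewrite /letter negl_half odd_negl; case: insub => [i|]; last by rewrite invg1.
by case: odd; rewrite ?invgK.
Qed.

Lemma letter_out l : n.*2 <= l -> letter l = 1.
Proof. by move=> h; rewrite /letter insubF //; lia. Qed.

Let ev := evw letter.

Lemma ev_push l w : ev (push l w) = letter l * ev w.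
Proof.
rewrite /ev; case: w => [|b w] /=; first by rewrite evw_cons.
case: eqP => [->|_]; last by rewrite !evw_cons.
by rewrite evw_cons letter_negl mulVKg.
Qed.

Lemma ev_act u w : ev (act u w) = ev u * ev w.
Proof.
elim: u => [|l u IH] /=; first by rewrite /ev evw_nil mul1g.
by rewrite ev_push IH mulgA /ev evw_cons.
Qed.

Hypothesis basis : free_basis x.

Fact gen_subproof (i : 'I_n) : all (gtn n.*2) [:: (val i).*2] && reduced [:: (val i).*2].
Proof. by rewrite /= andbT; have := ltn_ord i; rewrite /reduced /=; lia. Qed.

Definition free_gen (i : 'I_n) : freew := Sub [:: (val i).*2] (gen_subproof i).

Lemma basis_reduce : exists phi : F -> freew, is_hom phi /\
  forall w, all (gtn n.*2) w -> val (phi (ev w)) = act w [::].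
Proof.
have [phi [phix _]] := basis free_gen; exists phi.
have phiM : is_hom phi by move=> a b; rewrite gmulfM.
split=> // w; elim: w => [|l w IH] /=; first by rewrite /ev evw_nil (hom1 phiM).
case/andP=> ll /IH IHw; rewrite /ev evw_cons phiM -/ev.
rewrite -[LHS]/(act (val (phi (letter l))) (val (phi (ev w)))) IHw.
have lh : l./2 < n by lia.
rewrite /letter insubT.
have -> : val (phi (if odd l then (x (Sub l./2 lh))^-1 else x (Sub l./2 lh))) = [:: l].
  case o: (odd l); rewrite ?(homV phiM) phix /=; last by congr [:: _]; lia.
  by rewrite -[LHS]/(invw [:: l./2.*2]) /invw /= /negl odd_double; congr [:: _]; lia.
by [].
Qed.

Lemma basis_reduced_inj w w' : all (gtn n.*2) w -> all (gtn n.*2) w' ->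
  reduced w -> reduced w' -> ev w = ev w' -> w = w'.
Proof.
have [phi [_ phiE]] := basis_reduce.
move=> wl w'l rw rw' /(congr1 (fun f => val (phi f))).
by rewrite !phiE // !act_nil.
Qed.

(** The composite of the reduction with the evaluation is an endomorphism that
   fixes the basis, so it is the identity. *)
Lemma basis_ev_surj f : exists2 w, all (gtn n.*2) w & ev w = f.
Proof.
have [phi [phix _]] := basis free_gen.
pose psi0 f := ev (val (phi f)).
have psiM : {morph psi0 : a b / a * b}.
  by move=> a b; rewrite /psi0 gmulfM -ev_act.
pose psi : {multiplicative F -> F} := HB.pack psi0 (isMultiplicative.Build _ _ psi0 psiM).
have [id' [_ uniq_id]] := basis x.
have psix i : psi (x i) = x i.
  rewrite /psi /= /psi0 phix /= /ev evw_cons evw_nil mulg1 /letter.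
  by rewrite doubleK odd_double valK.
exists (val (phi f)); first exact: freew_all.
by rewrite -[LHS]/(psi f) (uniq_id psi psix) -(uniq_id idfun).
Qed.

End FreeGroup.

(** ** The group of integers and integral exponents *)

Definition zint := int.

HB.instance Definition _ := Choice.on zint.
HB.instance Definition _ := isGroup.Build zint
  (@GRing.addrA int) (@GRing.add0r int) (@GRing.addr0 int)
  (@GRing.addNr int) (@GRing.addrN int).

Lemma zint_inv (z : zint) : z^-1 = (- (z : int))%R.
Proof. by []. Qed.

Section IntegralPower.

Variable A : groupType.

Definition zexp (a : A) (z : int) : A := if z is Posz m then a ^+ m else a ^- `|z|%N.

Lemma zexpE a m k : zexp a (m%:Z - k%:Z)%R = a ^+ m * a ^- k.
Proof.
case: (leqP k m) => [le|/ltnW le].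
  rewrite (_ : (m%:Z - k%:Z)%R = ((m - k)%N%:Z)%R); last lia.
  by rewrite /= expgnFr.
rewrite (_ : (m%:Z - k%:Z)%R = (- (k - m)%N%:Z)%R); last lia.
have -> : zexp a (- (k - m)%N%:Z)%R = a ^- (k - m)%N.
  by case: (k - m)%N => [|j] //=; rewrite invg1.
by rewrite expgnFr // invgM invgK.
Qed.

Lemma zexpD a z t : zexp a (z + t)%R = zexp a z * zexp a t.
Proof.
have [[m k] <-] := int_of_pair_surj z; have [[i j] <-] := int_of_pair_surj t.
rewrite /int_of_pair /= !zexpE.
rewrite (_ : (_ + _)%R = ((m + i)%N%:Z - (k + j)%N%:Z)%R); last lia.
rewrite zexpE -!expVgn !expgnDr -!mulgA; congr (_ * _).
rewrite [RHS]mulgA [LHS]mulgA; congr (_ * _).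
exact/commuteX2/commuteV.
Qed.

End IntegralPower.

Section FreeAbelian.

Variables (A : groupType) (hA : forall a b : A, commute a b) (r : nat) (a : 'I_r -> A).

Definition powers (z : {ffun 'I_r -> zint}) : A := \prod_(j < r) zexp (a j) (z j).

Lemma powersM : is_hom powers.
Proof.
move=> y z; rewrite /powers.
elim: (index_enum _) => [|j s IH]; first by rewrite !big_nil mulg1.
rewrite !big_cons IH ffunE -[(y j * z j)%g]/((y j : int) + z j)%R zexpD.
rewrite -!mulgA; congr (_ * _); rewrite !mulgA; congr (_ * _); exact: hA.
Qed.

Definition unit_vector (j : 'I_r) : {ffun 'I_r -> zint} :=
  [ffun i => (if i == j then 1%R else 0%R) : int].

Lemma powers_unit j : powers (unit_vector j) = a j.
Proof.
rewrite /powers (eq_bigr (fun i => if i == j then a i else 1)).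
  by rewrite -big_mkcond big_pred1_eq.
by move=> i _; rewrite ffunE; case: eqP => _; rewrite /= ?expg1 ?expg0.
Qed.

Lemma powers_gen (H : A -> Prop) : subgroup H -> (forall j, H (a j)) ->
  forall z, H (powers z).
Proof.
move=> [H1 HM HV] Ha z; apply: big_ind => // j _.
have Hx m : H (a j ^+ m) by exact: subgroup_exp.
by rewrite /zexp; case: (z j) => m; auto.
Qed.

End FreeAbelian.

Lemma ffun_prod_eval r I (s : seq I) (f : I -> {ffun 'I_r -> zint}) i :
  (\prod_(k <- s) f k) i = \prod_(k <- s) f k i.
Proof.
elim: s => [|k s IH]; first by rewrite !big_nil ffunE.
by rewrite !big_cons ffunE IH.
Qed.

Lemma zexp_eval r (v : {ffun 'I_r -> zint}) z i : zexp v z i = (z * v i)%R.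
Proof.
have expE m : (v ^+ m) i = (m%:Z * v i)%R.
  elim: m => [|m IH]; first by rewrite expg0 ffunE GRing.mul0r.
  rewrite expgS ffunE IH -[LHS]/((v i : int) + m%:Z * v i)%R.
  by rewrite -addn1 PoszD; ring.
case: z => m; rewrite /zexp ?expE //.
rewrite ffunE zint_inv expE -[`|_|%N]/(m.+1) NegzE; set c : int := v i.
by ring.
Qed.

Lemma powers_unit_vectors r (z : {ffun 'I_r -> zint}) : powers (@unit_vector r) z = z.
Proof.
apply/ffunP => i; rewrite /powers ffun_prod_eval.
rewrite (eq_bigr (fun j => if j == i then z j else 1)).
  by rewrite -big_mkcond big_pred1_eq.
move=> j _; rewrite zexp_eval ffunE eq_sym; case: eqP => _.
  exact: GRing.mulr1.
exact: GRing.mulr0.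
Qed.

(** * The direct product of a free group and a free abelian group *)

Section Product.

Variables (n : nat) (F : groupType) (x : 'I_n -> F) (r : nat).
Hypothesis basis : free_basis x.

Local Notation Z := {ffun 'I_r -> zint}.
Local Notation E := (F * {ffun 'I_r -> zint})%type.

Let pi (y : E) : F := y.1.
Let xl := letter x.

Definition coord (j : nat) (y : E) : int := if insub j is Some i then y.2 i else 0%R.

Lemma proj_hom : is_hom pi.
Proof. by []. Qed.

Lemma proj_central (a b : E) : pi a = 1 -> commute a b.
Proof.
case: a b => [f u] [g v]; rewrite /pi /= => ->; rewrite /commute -[LHS]/(_, _) -[RHS]/(_, _) /=.
rewrite mul1g mulg1; congr (_, _); apply/ffunP => i.
by rewrite !ffunE; exact: GRing.addrC.
Qed.

Lemma coordM j : ihom (coord j).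
Proof.
move=> a b; rewrite /coord; case: insub => [i|] //.
by rewrite -[(a * b).2]/(a.2 * b.2) ffunE.
Qed.

Lemma coord_inj (a : E) : pi a = 1 -> (forall j, j \in iota 0 r -> coord j a = 0%R) -> a = 1.
Proof.
case: a => f u; rewrite /pi /= => -> h; rewrite -[RHS]/(_, _); congr (_, _).
apply/ffunP => i; rewrite ffunE.
have := h i; rewrite mem_iota /= ltn_ord => /(_ isT).
by rewrite /coord valK.
Qed.

Lemma proj_surj (f : F) : exists a, pi a = f.
Proof. by exists (f, 1). Qed.

Definition eletter (l : nat) : E :=
  (xl l, if insub (l./2 - n)%N is Some j
         then if l./2 < n then 1 else if odd l then (unit_vector j)^-1 else unit_vector j
         else 1).

Definition eword (w : seq nat) : E := \prod_(l <- map eletter w) l.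

Lemma eletter_negl l : eletter (negl l) = (eletter l)^-1.
Proof.
rewrite /eletter -[RHS]/(_, _) /= negl_half odd_negl /xl letter_negl; congr (_, _).
case: insub => [j|]; last by rewrite invg1.
by case: ifP; rewrite ?invg1 //; case: odd; rewrite ?invgK.
Qed.

Lemma eword_cat w w' : eword (w ++ w') = eword w * eword w'.
Proof. by rewrite /eword map_cat big_cat. Qed.

Lemma eword_cons l w : eword (l :: w) = eletter l * eword w.
Proof. by rewrite /eword big_cons. Qed.

Lemma eword_nil : eword [::] = 1.
Proof. by rewrite /eword big_nil. Qed.

Lemma eword_inv w : eword (invw w) = (eword w)^-1.
Proof.
elim: w => [|l w IH]; first by rewrite !eword_nil invg1.
rewrite invw_cons -cats1 eword_cat eword_cons eword_nil mulg1 IH eletter_negl.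
by rewrite eword_cons invgM.
Qed.

Lemma eword_surj y : exists w, eword w = y.
Proof.
pose H y := exists w, eword w = y.
have subH : subgroup H.
  split=> [|_ _ [u <-] [v <-]|_ [u <-]].
  - by exists [::]; exact: eword_nil.
  - by exists (u ++ v); exact: eword_cat.
  - by exists (invw u); exact: eword_inv.
have [H1 HM HV] := subH.
case: y => f z; rewrite (_ : (f, z) = (f, 1) * (1, z)); last first.
  by rewrite -[RHS]/(_, _) /= mulg1 mul1g.
apply: HM.
  have [w wl <-] := basis_ev_surj basis f; exists w.
  elim: w wl => [|l w IH]; first by rewrite eword_nil evw_nil.
  case/andP=> ll /IH; rewrite eword_cons evw_cons => ->.
  rewrite -[LHS]/(_, _) /=; congr (_, _); rewrite mulg1.
  have -> : l./2 < n by move: ll => /=; lia.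
  by case: insub.
have hom1z : is_hom (fun z : Z => (1 : F, z)) by move=> u v; rewrite -[RHS]/(_, _) /= mulg1.
rewrite -[z]powers_unit_vectors.
apply: (powers_gen (H := fun z => H (1, z)) (subgroup_preim hom1z subH)) => j.
exists [:: (n + j).*2]; rewrite eword_cons eword_nil mulg1 /eletter.
rewrite /xl letter_out; last by rewrite leq_double leq_addr.
rewrite doubleK addKn valK odd_double ifF //.
by apply/negbTE; rewrite -leqNgt leq_addr.
Qed.

#[local] Instance num_E : Numbered E := num_quot _ eword_surj.

Lemma effective_eword : effective eword.
Proof. exact: effective_quot. Qed.

Lemma effective_invw : effective invw.
Proof.
apply: effective_rev; apply: (effective_map (f := fun _ => negl)); first exact: effective_id.
by apply: effective_negl; effective_auto.
Qed.

Lemma effective_push : effective (fun z : nat * seq nat => push z.1 z.2).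
Proof.
apply: (@effective_ext _ _ _ _ (fun z : nat * seq nat =>
   if (size z.2 != 0) && (nth 0 z.2 0 == negl z.1) then behead z.2 else z.1 :: z.2)).
  by case=> l [|b w] //=; case: eqP.
apply: effective_if; effective_auto.
- by apply: effective_size; effective_auto.
- by apply: effective_nth; effective_auto.
- by apply: effective_negl; effective_auto.
- by apply: effective_behead; effective_auto.
Qed.

(** Decides the word problem for the free factor; letters that are not free are
   dropped. *)
Definition reduce (w : seq nat) := foldr (fun l v => if l < n.*2 then push l v else v) [::] w.

Lemma reduceP w : [/\ all (gtn n.*2) (reduce w), reduced (reduce w) &
  evw xl (reduce w) = pi (eword w)].
Proof.
elim: w => [|l w [wl rw ew]]; first by rewrite /= evw_nil eword_nil.
rewrite eword_cons -[pi _]/(xl l * pi (eword w)) -ew /=; case: ltnP => [ll|lg].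
  by rewrite all_push // reduced_push // ev_push.
by split=> //; rewrite /xl letter_out // mul1g.
Qed.

Lemma reduce_eq1 w : (pi (eword w) == 1) = (reduce w == [::]).
Proof.
have [wl rw <-] := reduceP w; apply/eqP/eqP => [|->]; last exact: evw_nil.
by rewrite -(evw_nil xl) => /(basis_reduced_inj (w' := [::]) basis wl isT rw isT).
Qed.

Lemma effective_reduce : effective reduce.
Proof.
apply: (effective_foldr (X := seq nat) (l := id) (a := fun=> [::])
  (f := fun _ l v => if l < n.*2 then push l v else v));
  [exact: effective_id | apply: effective_if; last by effective_auto | exact: effective_const].
- by effective_auto.
- by apply: (effective_comp (f := fun z => push z.1 z.2) (g := fun t => t.2) effective_push); effective_auto.
Qed.

Lemma effective_pi_eq : effective (fun z : E * E => pi z.1 == pi z.2).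
Proof.
apply: (effective_quot2 eword_surj (f := fun a b => pi a == pi b)).
apply: (@effective_ext _ _ _ _ (fun z : seq nat * seq nat => size (reduce (z.1 ++ invw z.2)) == 0%N)).
  move=> z; rewrite size_eq0 -reduce_eq1 eword_cat eword_inv.
  by rewrite -[pi _]/(pi (eword z.1) * (pi (eword z.2))^-1) divg_eq1.
have h1 := effective_reduce; have h2 := effective_invw.
by apply: effective_eqn; effective_auto; apply: effective_size; effective_auto.
Qed.


Lemma effective_eletter : effective eletter.
Proof.
apply: (@effective_ext _ _ _ _ (fun l => eword [:: l])).
  by move=> l; rewrite eword_cons eword_nil mulg1.
by apply: (effective_comp (f := eword) effective_eword); effective_auto.
Qed.

Lemma coord_eletter j l : j < r -> coord j (eletter l) =
  if l == (n + j).*2 then 1%R else if l == (n + j).*2.+1 then (-1)%R else 0%R.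
Proof.
move=> jr; rewrite /coord insubT /eletter /=; set i : 'I_r := Sub j jr.
have one0 : ((1%g : Z) i : int) = 0%R by rewrite ffunE.
case: (@insubP _ _ 'I_r (l./2 - n)%N) => [k kr vk|]; last first.
  by move=> /negP h; rewrite one0; do 2?case: eqP => [?|_]; lia.
case: ifP => [ln|ln]; first by rewrite one0; do 2?case: eqP => [?|_]; lia.
have ik : (i == k) = (j == l./2 - n)%N by rewrite -vk.
case o: (odd l); rewrite !ffunE ?zint_inv ik; case: (j =P _) => h;
  do 2?case: eqP => [?|?]; lia.
Qed.

Lemma effective_coord j : effective (coord j : E -> int).
Proof.
apply: (effective_quot1 eword_surj); case: (ltnP j r) => [jr|rj]; last first.
  apply: (@effective_ext _ _ _ _ (fun _ => 0%R)); last exact: effective_const.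
  by move=> w; rewrite /coord insubF //; lia.
pose c l : int := if l == (n + j).*2 then 1%R else if l == (n + j).*2.+1 then (-1)%R else 0%R.
have cc : effective c by apply: effective_if; [effective_auto | effective_auto | apply: effective_if; effective_auto].
apply: effective_ext (effective_foldr (X := seq nat) (l := id) (a := fun=> 0%R)
  (f := fun _ l a => (c l + a)%R) effective_id _ (effective_const _)).
  move=> w; elim: w => [|l w IH] /=; first by rewrite eword_nil (ihom1 (coordM j)).
  by rewrite eword_cons coordM coord_eletter // IH.
by apply: effective_int_add; effective_auto.
Qed.

Lemma effective_group_E : effective_group E.
Proof.
split.
- apply: (effective_quot2 eword_surj (f := fun a b => a * b)).
  apply: (@effective_ext _ _ _ _ (fun z => eword (z.1 ++ z.2))).
    by move=> z; rewrite eword_cat.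
  by apply: (effective_comp (f := eword) effective_eword); effective_auto.
- apply: (effective_quot1 eword_surj).
  apply: (@effective_ext _ _ _ _ (fun w => eword (invw w))).
    by move=> w; rewrite eword_inv.
  exact: (effective_comp (f := eword) effective_eword effective_invw).
- pose same (js : seq nat) (z : E * E) := all (fun j => coord j z.1 == coord j z.2) js.
  apply: (@effective_ext _ _ _ _ (fun z : E * E => (pi z.1 == pi z.2) && same (iota 0 r) z)).
    case=> a b /=; apply/idP/eqP => [/andP[/eqP hpi /allP h]|->]; last first.
      by rewrite eqxx; apply/allP.
    apply: divg1_eq; apply: coord_inj; first by rewrite /pi /= -/(pi a) hpi mulgV.
    by move=> j /h /eqP hj; rewrite coordM (ihomV (coordM j)) hj GRing.addrN.
  apply: effective_and; first exact: effective_pi_eq.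
  elim: (iota 0 r) => [|j js IH] /=; first exact: effective_const.
  apply: effective_and; last exact: IH.
  by have cj := effective_coord j; apply: (effective_eq deceq_int); effective_auto.
Qed.

(** ** Quotients by a finitely generated central subgroup *)

Section Quotient.

Variables (G : groupType) (rho : E -> G).
Hypothesis rhoM : is_hom rho.
Hypothesis rho_surj : forall y, exists a, rho a = y.
Hypothesis rho_ker : forall a, rho a = 1 -> pi a = 1.

Variables (k : nat) (g : 'I_k -> G).
Hypothesis gen_g : generating_family g.

Lemma rho_kernel_fg : exists N : seq E, forall a, gen N a <-> rho a = 1.
Proof.
have subD : subgroup (fun a => rho a = 1).
  split=> [|u v hu hv|u hu]; rewrite ?(hom1 rhoM) ?rhoM ?(homV rhoM) ?hu ?hv ?mulg1 ?invg1 //.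
have [N hN] := kernel_generators proj_hom coordM coord_inj subD.
by exists N => a; rewrite -hN; split=> [[]|h] //; split=> //; exact: rho_ker.
Qed.

Lemma lift_exists : exists2 L : nat -> E, effective L &
  forall i (b : bool), rho (L ((val i).*2 + b)%N) = if b then (g i)^-1 else g i.
Proof.
have [s hs] := choice rho_surj.
pose L l : E := if insub l./2 is Some i then
    if odd l then (s (g i))^-1 else s (g i) else 1.
exists L.
  apply: (@effective_ext _ _ _ _ (fun l => nth 1 (map L (iota 0 k.*2)) l)).
    move=> l; case: (ltnP l k.*2) => [lk|kl].
      by rewrite (nth_map 0) ?size_iota // nth_iota.
    rewrite nth_default ?size_map ?size_iota // /L insubF //; lia.
  by apply: effective_nth; effective_auto.
move=> i b; rewrite /L (_ : _./2 = val i) ?valK; last by case: (b); lia.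
have -> : odd ((val i).*2 + b)%N = b by case: (b); lia.
by case: b; rewrite ?(homV rhoM) hs.
Qed.

Section Lift.

Variables (N : seq E) (L : nat -> E).
Hypothesis hN : forall a, gen N a <-> rho a = 1.
Hypothesis cL : effective L.
Hypothesis hL : forall i (b : bool), rho (L ((val i).*2 + b)%N) = if b then (g i)^-1 else g i.

Definition lift (w : seq nat) : E := \prod_(y <- map L w) y.

(** With the generators of the kernel added, subgroups correspond to their full
   preimages, which turns intersections into intersections and preserves finite
   generation in both directions. *)
Definition lifts (R : seq (seq nat)) : seq E := map lift R ++ N.

Definition codes (R : seq (word k)) := map (map (@code_letter k)) R.

Lemma rho_lift (w : word k) : rho (lift (map (@code_letter k) w)) = eval_word g w.
Proof.
rewrite /lift (hom_prod rhoM) /eval_word !big_map.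
by apply: eq_bigr => -[i b] _; rewrite hL.
Qed.

Lemma gen_lifts (R : seq (word k)) a :
  gen (lifts (codes R)) a <-> subgroup_of_words g R (rho a).
Proof.
have subR : subgroup (subgroup_of_words g R).
  by split; [exact: Gen1|exact: GenM|exact: GenV].
split=> [|h].
  apply: (gen_min (H := fun a => subgroup_of_words g R (rho a))).
    exact: (subgroup_preim rhoM subR).
  move=> b; rewrite mem_cat => /orP[|/gen_in/hN ->]; last exact: Gen1.
  case/mapP=> _ /mapP[w wR ->] ->; rewrite rho_lift.
  by apply: GenIn; exists w.
have [b gb hb] : exists2 b, gen (lifts (codes R)) b & rho b = rho a.
  pose H y := exists2 b, gen (lifts (codes R)) b & rho b = y.
  apply: (generated_min (H := H)) h; first exact: (subgroup_image rhoM (gen_subgroup _)).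
  move=> _ [w wR ->]; exists (lift (map (@code_letter k) w)); last exact: rho_lift.
  by apply: gen_in; rewrite mem_cat; apply/orP; left; do 2 apply: map_f.
rewrite -(mulVKg b a); apply: (GenM gb).
have /hN : rho (b^-1 * a) = 1 by rewrite rhoM (homV rhoM) hb mulVg.
by apply: gen_subset => z zN; rewrite mem_cat zN orbT.
Qed.

Lemma lift_surj a : exists w : word k, rho (lift (map (@code_letter k) w)) = rho a.
Proof.
elim: (gen_g (rho a)) => [_ [i ->]||y z _ [u hu] _ [v hv]|y _ [u hu]].
- exists [:: (i, false)]; rewrite rho_lift /eval_word big_seq1 //.
- by exists [::]; rewrite rho_lift /eval_word big_nil.
- by exists (u ++ v); move: hu hv; rewrite !rho_lift /eval_word big_cat => -> ->.
- exists (rev (map (fun l => (l.1, ~~ l.2)) u)); move: hu; rewrite !rho_lift => <-.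
  rewrite /eval_word; elim: u => [|[i b] u IH]; first by rewrite !big_nil invg1.
  rewrite /= rev_cons -cats1 big_cat big_seq1 IH big_cons invgM /=.
  by case: b; rewrite ?invgK.
Qed.

Lemma lifts_complete (U : seq E) : (forall a, rho a = 1 -> gen U a) ->
  exists T : seq (word k), forall a, gen (lifts (codes T)) a <-> gen U a.
Proof.
move=> kerU; have [s hs] := choice lift_surj.
exists (map s U) => a; split.
  apply: gen_min; first exact: gen_subgroup.
  move=> b; rewrite mem_cat => /orP[|/gen_in/hN]; last exact: kerU.
  case/mapP=> _ /mapP[_ /mapP[u uU ->] ->] ->.
  rewrite -(mulVKg u (lift _)); apply: GenM; first exact: gen_in.
  by apply: kerU; rewrite rhoM (homV rhoM) hs mulVg.
apply: gen_min; first exact: gen_subgroup.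
move=> u uU; apply/gen_lifts; rewrite -hs rho_lift; apply: GenIn.
by exists (s u) => //; exact: map_f.
Qed.

Lemma effective_lifts : effective lifts.
Proof.
apply: effective_cat; last by effective_auto.
apply: (effective_map (f := fun _ => lift)); first by effective_auto.
apply: (effective_prodg effective_group_E); apply: (effective_map (f := fun _ => L)); effective_auto.
Qed.

(** The number 0 stands for the negative answer, and the successor of the code
   of a list of words for that list. *)
Definition solves (RS : seq (seq nat) * seq (seq nat)) (z : nat) :=
  (z = 0%N /\ infinite_cert pi n xl coord (iota 0 r) (lifts RS.1) (lifts RS.2)) \/
  exists T : seq (seq nat), [/\ z = (CodeSeq.code (map CodeSeq.code T)).+1,
    all (all (gtn k.*2)) T &
    inter_cert pi n xl coord (iota 0 r) (lifts RS.1) (lifts RS.2) (lifts T)].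

Lemma sd_solves : sd (fun z => solves z.1 z.2).
Proof.
have pi1 : pi 1 = 1 by [].
have pi_eletter l : pi (eletter l) = xl l by [].
have cl := effective_lifts.
apply: sd_or.
  apply: sd_and; first by apply: (sd_eq deceq_nat); effective_auto.
  refine (@sd_infinite_cert _ _ _ effective_group_E pi n xl coord (iota 0 r) pi1 effective_pi_eq
    eletter effective_eletter pi_eletter effective_coord _ _
    (fun z => lifts z.1.1) (fun z => lifts z.1.2) _ _); effective_auto.
apply: sd_ex; apply: sd_and3.
- apply: (sd_eq deceq_nat); first by effective_auto.
  apply: effective_succ; apply: (effective_comp (f := fun T => CodeSeq.code (map CodeSeq.code T))).
    exists id; split; first by rec_solve.
    move=> m /=; rewrite -map_comp map_id_in ?CodeSeq.decodeK // => c _ /=.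
    by rewrite map_id CodeSeq.decodeK.
  by effective_auto.
- apply: sd_dec; apply: (effective_all (p := fun _ => all (gtn k.*2))); first by effective_auto.
  by apply: (effective_all (p := fun _ => gtn k.*2)); effective_auto.
- refine (@sd_inter_cert _ _ _ effective_group_E pi n xl coord (iota 0 r) pi1 effective_pi_eq
    eletter effective_eletter pi_eletter effective_coord _ _
    (fun z => lifts z.1.1.1) (fun z => lifts z.1.1.2) (fun z => lifts z.2) _ _ _); effective_auto.
Qed.

Lemma codes_surj (T : seq (seq nat)) : all (all (gtn k.*2)) T ->
  exists T0 : seq (word k), codes T0 = T.
Proof.
have word_surj w : all (gtn k.*2) w -> exists w0 : word k, map (@code_letter k) w0 = w.
  elim: w => [|l w IH] /=; first by exists [::].
  case/andP=> lk /IH[w0 <-].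
  have hl : l./2 < k by lia.
  exists ((Ordinal hl, odd l) :: w0); rewrite /= /code_letter /=; congr (_ :: _).
  by lia.
elim: T => [|w T IH] /=; first by exists [::].
by case/andP=> /word_surj[w0 <-] /IH[T0 <-]; exists (w0 :: T0).
Qed.

Lemma all_codes (T : seq (word k)) : all (all (gtn k.*2)) (codes T).
Proof.
apply/allP => _ /mapP[w _ ->]; apply/allP => _ /mapP[[i b] _ ->].
by rewrite /= /code_letter /=; have := ltn_ord i; case: b; lia.
Qed.

End Lift.

End Quotient.

(** Certificates for both answers are searched for simultaneously; one of them
   exists, and whichever is found first is correct. *)
Theorem quotient_solvable (G : groupType) (rho : E -> G) : is_hom rho ->
  (forall y, exists a, rho a = y) -> (forall a, rho a = 1 -> pi a = 1) ->
  subgroup_intersection_solvable G.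
Proof.
move=> rhoM rho_surj rho_ker k g gen_g.
have [N hN] := rho_kernel_fg rhoM rho_ker.
have [L cL hL] := lift_exists rhoM rho_surj g.
pose up (R : seq (word k)) := lifts N L (codes R).
have genP (R : seq (word k)) a : gen (up R) a <-> subgroup_of_words g R (rho a) :=
  gen_lifts rhoM hN hL R a.
have xl_inj := basis_reduced_inj basis.
have xl_surj := basis_ev_surj basis.
have xl_neg := @letter_negl n F x.
have kerin RS a : rho a = 1 -> gen (lifts N L RS) a.
  by move/hN; apply: gen_subset => z zN; rewrite mem_cat zN orbT.
have total RS : exists z, solves k N L RS z.
  case: (pselect (finitely_generated (fun a => gen (lifts N L RS.1) a /\ gen (lifts N L RS.2) a))).
    move=> [U hU]; have [|T hT] := lifts_complete rhoM gen_g hN hL (U := U).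
      by move=> a ha; apply/hU; split; exact: kerin.
    exists (CodeSeq.code (map CodeSeq.code (codes T))).+1; right; exists (codes T); split=> //.
      exact: all_codes.
    apply/(inter_certP proj_hom proj_central coordM coord_inj proj_surj xl_neg xl_inj xl_surj).
    by move=> y; rewrite hT hU.
  move=> nfg; exists 0%N; left; split=> //.
  exact: (infinite_cert_complete proj_hom proj_central coordM coord_inj proj_surj
    xl_neg xl_inj xl_surj nfg).
have [h [[phi [rphi hphi]] hh]] := sd_choice (sd_solves k N cL) total.
pose RS (p : seq (word k) * seq (word k)) := (codes p.1, codes p.2).
have ans p : exists o : option (seq (word k)), code_answer o = h (RS p) /\
    match o with
    | Some T => forall y, subgroup_of_words g T y <-> words_inter g p.1 p.2 y
    | None => ~ finitely_generated (words_inter g p.1 p.2)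
    end.
  case: (hh (RS p)) => [[-> inf]|[T [-> /codes_surj[T0 <-] ok]]].
    exists None; split=> // fgI.
    apply: (infinite_cert_sound proj_hom proj_central coordM coord_inj proj_surj
      xl_neg xl_inj xl_surj inf).
    apply: (extension_fg rhoM).
    - by split=> [|u v [? ?] [? ?]|u [? ?]]; split; solve [exact: Gen1|exact: GenM|exact: GenV].
    - apply: fg_ext fgI => y; split=> [[h1 h2]|[a [/genP h1 /genP h2] <-]] //.
      have [a ay] := rho_surj y; exists a => //.
      by split; apply/genP; rewrite ay.
    - exists N => a; rewrite -/(gen N a) hN; split=> [[]|ha] //.
      by split=> //; split; exact: kerin.
  exists (Some T0); split=> [|y].
    by rewrite /code_answer /code_words /codes -map_comp.
  have [a <-] := rho_surj y; rewrite -genP /words_inter -!genP.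
  have /(inter_certP proj_hom proj_central coordM coord_inj proj_surj xl_neg xl_inj xl_surj) -> := ok.
  by [].
have [f hf] := choice ans.
exists (fun R S => f (R, S)); split=> [|R S]; last by have [_] := hf (R, S).
exists (fun v => phi (npair (nth 0%N v 0) (nth 0%N v 1))); split.
  by apply: (rec_app1 rphi); apply: (rec_app2 rec_pair); exact: rec_nth.
move=> R S; have [-> _] := hf (R, S).
rewrite -[LHS]/(phi (npair (code_words R) (code_words S))).
have -> : phi (npair (code_words R) (code_words S)) =
  h (rep (npair (code_words R) (code_words S))) by exact: hphi.
rewrite /= nfst_pair nsnd_pair /RS /= /code_words /codes.
rewrite !CodeSeq.codeK; congr (h (_, _)).
  by rewrite -map_comp; apply: eq_map => w; rewrite /= map_id CodeSeq.codeK.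
by rewrite -map_comp; apply: eq_map => w; rewrite /= map_id CodeSeq.codeK.
Qed.

End Product.

Theorem corollary4p21 (n : nat) (F : groupType) (x : 'I_n -> F)
    (hF : free_basis x)
    (A : groupType) (hA : forall a b : A, commute a b)
    (hAfg : finitely_generated (fun _ : A => True)) :
  subgroup_intersection_solvable (F * A)%type.
Proof.
have [X hX] := hAfg.
pose a (j : 'I_(size X)) := nth 1 X j.
have tauM := powersM hA a.
apply: (@quotient_solvable n F x (size X) hF _ (fun y => (y.1, powers a y.2))).
- by move=> y z; rewrite -[RHS]/(_, _) /= -tauM.
- move=> [f b]; have gb : gen X b by apply/hX.
  have [z _ <-] : exists2 z, True & powers a z = b.
    apply: (gen_min (H := fun b => exists2 z, True & powers a z = b)) gb.
      exact: (subgroup_image tauM (H := fun=> True)).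
    move=> c cX; have lt : index c X < size X by rewrite index_mem.
    exists (unit_vector (Ordinal lt)) => //.
    by rewrite powers_unit /a /= nth_index.
  by exists (f, z).
- by case=> f z [].
Qed.
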